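(* Let $l\ge1$. $O(2l)$ and $\hat{\mathcal D}^+$ form a dual pair on the Fock space $\mathcal F^{\otimes l}$ of $l$ pairs of fermionic fields with half-integral modes: their actions commute and there is the $(O(2l),\hat{\mathcal D}^+)$-module decomposition $$\mathcal F^{\otimes l}\cong\bigoplus_{\lambda\in\Sigma(D)}V(O(2l);\lambda)\otimes L\big(\hat{\mathcal D}^+;e(\lambda),l\big).$$
   Context: **Algebra.** $\hat{\mathcal D}=\mathcal D\oplus\mathbb CC$, $\mathcal D$ spanned by $t^kf(D)$ ($k\in\mathbb Z$, $f\in\mathbb C[w]$, $D=t\frac d{dt}$), $C$ central, $[t^rf(D),t^sg(D)]=t^{r+s}(f(D+s)g(D)-f(D)g(D+r))+\Psi\,C$, $\Psi$ antisymmetric, $\Psi=\sum_{-r\le j\le-1}f(j)g(j+r)$ if $r=-s\ge0$, $\Psi=0$ if $r+s\ne0$; $\deg t^kf(D)=k$, $\deg C=0$. $\hat{\mathcal D}^+$: subalgebra spanned by $C$ and $t^kg(D+(k+1)/2)$, $k\in\mathbb Z$, $g$ an odd polynomial. **Modules.** For $c\in\mathbb C$ and a finite set $e$ of nonzero complex numbers $e_i$ (distinct up to sign) with multiplicities $n_i\in\mathbb C$, $L(\hat{\mathcal D}^+;e,c)$ is the irreducible highest weight module (highest weight vector killed by positive degree elements) with highest weight $\xi$ such that $\xi(C)=c$ and $-\sum_{n\text{ odd}}\xi((D+\frac12)^n)\frac{x^n}{n!}=\frac{\sum_in_i(\cosh(e_ix)-1)}{2\sinh(x/2)}$. **Fock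 space.** $\psi^{\pm,p}(z)=\sum_{n\in\frac12+\mathbb Z}\psi^{\pm,p}_nz^{-n-1/2}$ ($1\le p\le l$), $[\psi^{+,p}_m,\psi^{-,q}_n]_+=\delta_{pq}\delta_{m+n,0}$, other anticommutators zero; $\mathcal F^{\otimes l}$ is generated by $|0\rangle$ killed by all $\psi^{\pm,p}_n$, $n>0$. $:\ :$ is fermionic normal ordering. **Action of $\hat{\mathcal D}^+$.** Define $X_{ij}$ by $\sum_{i,j\in\mathbb Z}X_{ij}z^{i-1}w^{-j}=\sum_{k=1}^l(:\psi^{+,k}(z)\psi^{-,k}(w):-:\psi^{+,k}(w)\psi^{-,k}(z):)$. Then $C\mapsto l$ and $t^kf(D+\frac{k+1}2)\mapsto\frac12\sum_jf(-j+\frac{k+1}2)X_{j-k,j}$ for all $k$. **Action of $O(2l)$.** $O(2l)$ is the isometry group of $\mathbb C^{2l}=\mathrm{span}(v_{\pm p})$ with symmetric form $(v_p,v_{-q})=\delta_{pq}$, $(v_p,v_q)=(v_{-p},v_{-q})=0$; with $\Psi^{v_{\pm p}}(z)=\psi^{\pm,p}(z)$ extended linearly, $g$ fixes $|0\rangle$ and $g\Psi^v(z)g^{-1}=\Psi^{gv}(z)$. **Parameters.** $\Sigma(D)$ consists of all $\lambda=(m_1,\dots,m_l)$, integers $m_1\ge\dots\ge m_l\ge0$ (written $(m_1,\dots,\overline m_l)$ if $m_l>0$), together with $\lambda\otimes\det$ for those with $m_l=0$. $V(O(2l);\lambda)$ is the irreducible $O(2l)$-module of traceless tensors of symmetry type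 $\lambda$ (if $m_l>0$, its restriction to $SO(2l)$ is the sum of the modules of highest weights $(m_1,\dots,\pm m_l)$; if $m_l=0$ it is $SO(2l)$-irreducible of highest weight $\lambda$); $V(O(2l);\lambda\otimes\det)=V(O(2l);\lambda)\otimes\det$. Let $m_1\ge\dots\ge m_i>m_{i+1}=\dots=m_j=1>m_{j+1}=\dots=m_l=0$. $e(\lambda)$ for $\lambda=(m_1,\dots,m_l)$: exponents $m_1,\dots,m_i$ each contributing multiplicity $1$ (multiplicities of equal exponents add) and exponent $1$ with multiplicity $j-i$. $e(\lambda\otimes\det)$ ($j<l$): exponents $m_1,\dots,m_i$ each contributing multiplicity $1$ and exponent $1$ with multiplicity $2l-i-j$. *)

(* Defs.v *)
(* The complex numbers are [R[i]] for [R : realType]. *)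
From HB Require Import structures.
From mathcomp Require Import all_boot all_order all_algebra all_fingroup.
From mathcomp Require Import boolp classical_sets functions cardinality fsbigop.
From mathcomp Require Import reals complex.

Set Implicit Arguments.
Unset Strict Implicit.
Unset Printing Implicit Defensive.

Import Order.TTheory GRing.Theory Num.Theory.
Local Open Scope classical_set_scope.
Local Open Scope ring_scope.
Local Open Scope complex_scope.

(* Direct sums of arbitrary families of modules: finitely supported dependent
   functions. *)

Section DirectSum.
Variables (K : pzRingType) (I : Type) (T : I -> lmodType K).

Definition dprod := forall i, T i.
HB.instance Definition _ := gen_eqMixin dprod.
HB.instance Definition _ := gen_choiceMixin dprod.

Let zero : dprod := fun i => 0.
Let opp (f : dprod) : dprod := fun i => - f i.
Let add (f g : dprod) : dprod := fun i => f i + g i.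
Let scale (k : K) (f : dprod) : dprod := fun i => k *: f i.

Let addA : associative add.
Proof. by move=> f g h; apply: functional_extensionality_dep => i; exact: addrA. Qed.
Let addC : commutative add.
Proof. by move=> f g; apply: functional_extensionality_dep => i; exact: addrC. Qed.
Let add0 : left_id zero add.
Proof. by move=> f; apply: functional_extensionality_dep => i; exact: add0r. Qed.
Let addN : left_inverse zero opp add.
Proof. by move=> f; apply: functional_extensionality_dep => i; exact: addNr. Qed.
HB.instance Definition _ := GRing.isZmodule.Build dprod addA addC add0 addN.

Let scaleA a b f : scale a (scale b f) = scale (a * b) f.
Proof. by apply: functional_extensionality_dep => i; exact: scalerA. Qed.
Let scale1 : left_id 1 scale.
Proof. by move=> f; apply: functional_extensionality_dep => i; exact: scale1r. Qed.
Let scaleDr : right_distributive scale +%R.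
Proof. by move=> a f g; apply: functional_extensionality_dep => i; exact: scalerDr. Qed.
Let scaleDl f : {morph scale^~ f : a b / a + b}.
Proof. by move=> a b; apply: functional_extensionality_dep => i; exact: scalerDl. Qed.
HB.instance Definition _ :=
  GRing.Zmodule_isLmodule.Build K dprod scaleA scale1 scaleDr scaleDl.

Definition finsupp_pred : pred dprod :=
  fun f => `[< finite_set [set i | f i != 0] >].

Lemma finsupp_submod_closed : submod_closed finsupp_pred.
Proof.
split=> [|k f g /asboolP ff /asboolP fg]; apply/asboolP.
  suff -> : [set i | (0 : dprod) i != 0] = set0 by exact: finite_set0.
  by apply/seteqP; split => i //=; rewrite eqxx.
have : finite_set ([set i | f i != 0] `|` [set i | g i != 0]).
  by rewrite finite_setU.
apply: sub_finite_set => i /= n0.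
have [f0|] := eqVneq (f i) 0; last by left.
right; apply: contra n0 => /eqP g0; apply/eqP.
by rewrite -[LHS]/(k *: f i + g i) f0 g0 scaler0 addr0.
Qed.
HB.instance Definition _ :=
  GRing.isSubmodClosed.Build K dprod finsupp_pred finsupp_submod_closed.

Record dirsum := DirSum { dirsum_val : dprod ; _ : dirsum_val \in finsupp_pred }.
HB.instance Definition _ := [isSub for dirsum_val].
HB.instance Definition _ := [Choice of dirsum by <:].
HB.instance Definition _ := [SubChoice_isSubLmodule of dirsum by <:].

Definition dirsum_at (f : dirsum) (i : I) : T i := dirsum_val f i.
Coercion dirsum_at : dirsum >-> Funclass.

End DirectSum.

Section DirectSumInjection.
Variables (K : pzRingType) (I : eqType) (T : I -> lmodType K).

Lemma dfwith_finsupp (i : I) (x : T i) :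
  (dfwith (fun j : I => 0 : T j) x : dprod T) \in @finsupp_pred K I T.
Proof.
apply/asboolP; apply: (sub_finite_set _ (finite_set1 i)) => j /= n0.
by apply/eqP; apply: contraNT n0 => ji; rewrite dfwith_out // eq_sym.
Qed.

Definition dsum_in (i : I) (x : T i) : dirsum T := DirSum (dfwith_finsupp x).

End DirectSumInjection.

(* Tensor product of a finite-dimensional space V with an arbitrary space W, in
   coordinates along the library basis (e_k) of V: the k-th entry of an element is
   its W-coefficient on e_k. [tensor_universal] is the universal property. *)

Section Tensor.
Variables (K : fieldType) (V : vectType K) (W : lmodType K).

Definition tensor := {ffun 'I_(\dim {:V}) -> W}.
HB.instance Definition _ := GRing.Lmodule.on tensor.

Definition pure_tensor (v : V) (w : W) : tensor :=
  [ffun k => coord (vbasis {:V}) k v *: w].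

Lemma tensor_universal (U : lmodType K) (b : V -> W -> U) :
  (forall v, linear (b v)) -> (forall w, linear (b^~ w)) ->
  exists! h : tensor -> U,
    linear h /\ forall v w, h (pure_tensor v w) = b v w.
Proof.
move=> br bl.
have b0r v : b v 0 = 0.
  by have := br v (-1) 0 0; rewrite !scaleN1r oppr0 addr0 addNr.
have b0l w : b 0 w = 0.
  by have := bl w (-1) 0 0; rewrite !scaleN1r oppr0 addr0 addNr.
have b_sumr v n (F : 'I_n -> W) : b v (\sum_k F k) = \sum_k b v (F k).
  apply: (big_morph (b v)) => [x y|]; last exact: b0r.
  by have := br v 1 x y; rewrite !scale1r.
have b_suml w n (F : 'I_n -> V) : b (\sum_k F k) w = \sum_k b (F k) w.
  apply: (big_morph (b^~ w)) => [x y|]; last exact: b0l.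
  by have := bl w 1 x y; rewrite !scale1r.
have bZr v k w : b v (k *: w) = k *: b v w.
  by have := br v k w 0; rewrite b0r !addr0.
have bZl v k w : b (k *: v) w = k *: b v w.
  by have := bl w k v 0; rewrite b0l !addr0.
pose e := vbasis {:V}.
have coordE v : v = \sum_(k < \dim {:V}) coord e k v *: e`_k.
  by apply: coord_vbasis; rewrite memvf.
exists (fun u : tensor => \sum_(k < \dim {:V}) b e`_k (u k)); split.
  split=> [c u v|v w].
    rewrite scaler_sumr -big_split /=; apply: eq_bigr => k _.
    by rewrite !ffunE br.
  rewrite [in RHS](coordE v) b_suml; apply: eq_bigr => k _.
  by rewrite ffunE bZr bZl.
move=> h [hl hb]; apply/funext => u.
have h0 : h 0 = 0.
  by have := hl (-1) 0 0; rewrite !scaleN1r oppr0 addr0 addNr.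
have uE : u = \sum_(k < \dim {:V}) pure_tensor e`_k (u k).
  apply/ffunP => i; rewrite sum_ffunE (bigD1 i) //= big1 => [|k ki].
    by rewrite addr0 ffunE coord_free ?(basis_free (vbasisP _)) // eqxx scale1r.
  by rewrite ffunE coord_free ?(basis_free (vbasisP _)) // (negPf ki) scale0r.
have hD : {morph h : x y / x + y} by move=> x y; have := hl 1 x y; rewrite !scale1r.
by rewrite [in RHS]uE (big_morph h hD h0); apply: eq_bigr => k _; rewrite hb.
Qed.

(* f (x) h for linear f, h *)
Definition tensor_map (f : V -> V) (h : W -> W) (u : tensor) : tensor :=
  \sum_(k < \dim {:V}) pure_tensor (f (vbasis {:V})`_k) (h (u k)).

End Tensor.

Section Algebra.
Variable R : realType.
Local Notation C := R[i].

(* D is the direct sum over k of t^k C[w], with w standing for D = t d/dt. *)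
Definition Dalg := dirsum (fun _ : int => {poly C} : lmodType C).
Definition tD (k : int) (f : {poly C}) : Dalg :=
  @dsum_in _ _ (fun _ : int => {poly C} : lmodType C) k f.

Definition shiftp (s : C) (f : {poly C}) : {poly C} := f \Po ('X + s%:P).

Definition lie_D (a b : Dalg) : Dalg :=
  \sum_(r \in [set: int]) \sum_(s \in [set: int])
    tD (r + s) (shiftp s%:~R (a r) * b s - a r * shiftp r%:~R (b s)).

(* sum over -n <= j <= -1 of f(j) g(j + n), with j = -(i + 1) *)
Definition Psi0 (n : nat) (f g : {poly C}) : C :=
  \sum_(i < n) f.[- i.+1%:R] * g.[- i.+1%:R + n%:R].

Definition Psi_hom (r : int) (f : {poly C}) (s : int) (g : {poly C}) : C :=
  if r + s != 0 then 0
  else if 0 <= r then Psi0 `|r|%N f g else - Psi0 `|s|%N g f.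

Definition Psi_D (a b : Dalg) : C :=
  \sum_(r \in [set: int]) \sum_(s \in [set: int]) Psi_hom r (a r) s (b s).

(* (x, c) is x + c C *)
Definition Dhat : lmodType C := (Dalg * C^o)%type.
Definition Ccentral : Dhat := (0, 1).
Definition tDhat (k : int) (f : {poly C}) : Dhat := (tD k f, 0).

Definition lie (a b : Dhat) : Dhat := (lie_D a.1 b.1, Psi_D a.1 b.1).

Definition homogeneous (k : int) (a : Dhat) : Prop :=
  (forall r, r != k -> a.1 r = 0) /\ (k != 0 -> a.2 = 0).

Definition in_span (V : lmodType C) (S : V -> Prop) (v : V) : Prop :=
  exists (n : nat) (c : 'I_n -> C) (x : 'I_n -> V),
    (forall i, S (x i)) /\ v = \sum_i c i *: x i.

Definition odd_polynomial (g : {poly C}) : Prop := g \Po (- 'X) = - g.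

Definition Dplus_gen (a : Dhat) : Prop :=
  a = Ccentral \/
  exists (k : int) (g : {poly C}),
    odd_polynomial g /\ a = tDhat k (shiftp ((k%:~R + 1) / 2) g).

Definition Dplus : Dhat -> Prop := in_span Dplus_gen.

(* The operators attached to elements of Dhat outside Dplus are irrelevant. *)
Definition is_Dplus_action (M : lmodType C) (act : Dhat -> M -> M) : Prop :=
  [/\ forall a, Dplus a -> linear (act a),
      forall c a b v, Dplus a -> Dplus b ->
        act (c *: a + b) v = c *: act a v + act b v
    & forall a b v, Dplus a -> Dplus b ->
        act (lie a b) v = act a (act b v) - act b (act a v)].

Record Dplus_module := DplusModule {
  Dmod_carrier :> lmodType C;
  Dmod_act : Dhat -> Dmod_carrier -> Dmod_carrier;
  Dmod_actP : is_Dplus_action Dmod_act }.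

Definition is_subspace (V : lmodType C) (P : V -> Prop) : Prop :=
  P 0 /\ forall (c : C) u v, P u -> P v -> P (c *: u + v).

Definition irreducible_Dplus (M : Dplus_module) : Prop :=
  (exists v : M, v != 0) /\
  forall P : M -> Prop, is_subspace P ->
    (forall a v, Dplus a -> P v -> P (Dmod_act a v)) ->
    (exists2 v, P v & v != 0) -> forall v, P v.

Definition highest_weight_vector (M : Dplus_module) (xi : Dhat -> C) (v : M) :=
  [/\ v != 0,
      forall k a, 0 < k -> Dplus a -> homogeneous k a -> Dmod_act a v = 0
    & forall a, Dplus a -> homogeneous 0 a -> Dmod_act a v = xi a *: v].

(* Formal power series in x, as sequences of coefficients. *)
Definition fps := nat -> C.
Definition fps_mul (a b : fps) : fps := fun n => \sum_(i < n.+1) a i * b (n - i)%N.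
Definition cosh_fps (e : C) : fps := fun n => if odd n then 0 else e ^+ n / n`!%:R.
Definition sinh_fps (e : C) : fps := fun n => if odd n then e ^+ n / n`!%:R else 0.

(* e : list of pairs (exponent e_i, multiplicity n_i) *)
Definition weight_numerator (e : seq (C * C)) : fps :=
  fun n => \sum_(p <- e) p.2 * (cosh_fps p.1 n - (n == 0%N)%:R).

Definition weight_series (xi : Dhat -> C) : fps :=
  fun n => if odd n then - (xi (tDhat 0 (('X + (2^-1)%:P) ^+ n)) / n`!%:R) else 0.

(* The quotient of power series is expressed by multiplying out its denominator
   2 sinh(x/2). *)
Definition has_weight (e : seq (C * C)) (c : C) (xi : Dhat -> C) : Prop :=
  xi Ccentral = c /\
  forall n, fps_mul (weight_series xi) (fun k => 2 * sinh_fps 2^-1 k) n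
            = weight_numerator e n.

(* M is L(Dhat^+; e, c). A weight is a functional on the degree 0 part; any linear
   extension xi of it to Dhat will do. *)
Definition is_Lmodule (e : seq (C * C)) (c : C) (M : Dplus_module) : Prop :=
  irreducible_Dplus M /\
  exists (xi : {linear Dhat -> C^o}) (v : M),
    has_weight e c xi /\ highest_weight_vector xi v.

End Algebra.

Section Orthogonal.
Variables (R : realType) (l : nat).
Local Notation C := R[i].

(* In 'I_(l + l), [lshift l p] is the index of v_p and [rshift l p] that of v_{-p}. *)
Definition formJ : 'M[C]_(l + l) := block_mx 0 1%:M 1%:M 0.

(* column convention: g v_b = sum_a (g a b) v_a *)
Definition O2l : pred 'M[C]_(l + l) := [pred g | g^T *m formJ *m g == formJ].

(* Slots of tensors are indexed by the cells of the Young diagram of m. *)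
Definition cell (m : l.-tuple nat) := {r : 'I_l & 'I_(tnth m r)}.

Definition tensors (m : l.-tuple nat) := {ffun {ffun cell m -> 'I_(l + l)} -> C^o}.

Section Shape.
Variable m : l.-tuple nat.
Implicit Types (T : tensors m) (g : 'M[C]_(l + l)) (s : {perm cell m}).

Definition tensors_act g T : tensors m :=
  [ffun a : {ffun cell m -> 'I_(l + l)} =>
     \sum_(b : {ffun cell m -> 'I_(l + l)}) (\prod_x g (a x) (b x)) * T b].

Definition tensors_perm s T : tensors m :=
  [ffun a : {ffun cell m -> 'I_(l + l)} => T [ffun x => a (s x)]].

Definition row_perm s : bool := [forall x, tag (s x) == tag x].
Definition column_perm s : bool :=
  [forall x, (tagged (s x) : nat) == (tagged x : nat)].

Definition young_symmetrizer T : tensors m :=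
  \sum_(s | row_perm s) \sum_(t | column_perm t)
    (-1) ^+ t *: tensors_perm s (tensors_perm t T).

Definition contraction (x y : cell m) (a : {ffun cell m -> 'I_(l + l)}) T : C^o :=
  \sum_i \sum_j
    formJ i j * T [ffun z => if z == x then i else if z == y then j else a z].

Definition traceless : {vspace tensors m} :=
  (\bigcap_(p : cell m * cell m | p.1 != p.2)
     \bigcap_(a : {ffun cell m -> 'I_(l + l)})
        lker (linfun (contraction p.1 p.2 a)))%VS.

Definition weyl_space : {vspace tensors m} := (linfun young_symmetrizer @: traceless)%VS.

Definition weyl_act g (v : subvs_of weyl_space) : subvs_of weyl_space :=
  vsproj weyl_space (tensors_act g (vsval v)).

End Shape.

(* (m, false) is lambda = m, and (m, true) is m (x) det. *)
Definition SigmaD : Type :=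
  {x : l.-tuple nat * bool | sorted geq x.1 && (x.2 ==> (last 0%N x.1 == 0%N))}.

Definition VO (x : SigmaD) : vectType C := subvs_of (weyl_space (val x).1).

Definition VO_act (x : SigmaD) (g : 'M[C]_(l + l)) (v : VO x) : VO x :=
  (if (val x).2 then \det g else 1) *: weyl_act g v.

Definition e_exponents (x : SigmaD) : seq (C * C) :=
  let m := (val x).1 in
  let i := count (fun k => 1 < k)%N m in
  let j := count (fun k => 0 < k)%N m in
  [seq (k%:R, (count_mem k m)%:R) | k <- undup [seq k <- m | (1 < k)%N]] ++
  [:: (1, if (val x).2 then (2 * l - i - j)%:R else (j - i)%:R)].

(* F^{(x) l}: [psi a n] is the mode of index n + 1/2 (n : int) of
   psi^{+,p} if a = lshift l p, of psi^{-,p} if a = rshift l p. *)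
Record fock_space := FockSpace {
  fock_carrier :> lmodType C;
  psi : 'I_(l + l) -> int -> fock_carrier -> fock_carrier;
  vac : fock_carrier;
  psi_linear : forall a n, linear (psi a n);
  psi_anticomm : forall a b m n v,
    psi a m (psi b n v) + psi b n (psi a m v) =
    (if m + n + 1 == 0 then formJ a b else 0) *: v;
  psi_vac : forall a n, 0 <= n -> psi a n vac = 0;
  vac_neq0 : vac != 0;
  fock_generated : forall P : fock_carrier -> Prop, is_subspace P -> P vac ->
    (forall a n v, P v -> P (psi a n v)) -> forall v, P v }.

Section Fock.
Variable F : fock_space.

Definition nord_psi (a : 'I_(l + l)) (m : int) (b : 'I_(l + l)) (n : int) (v : F) : F :=
  if 0 <= m then - psi b n (psi a m v) else psi a m (psi b n v).

(* Coefficient of z^(i-1) w^(-j): the mode of index 1/2 - i at z, j - 1/2 at w. *)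
Definition Xop (i j : int) (v : F) : F :=
  \sum_(k < l) (nord_psi (lshift l k) (- i) (rshift l k) (j - 1) v
                - nord_psi (lshift l k) (j - 1) (rshift l k) (- i) v).

(* If a.1 k = f(w + (k+1)/2) then (a.1 k).[- j] = f(-j + (k+1)/2). For fixed v only
   finitely many terms are nonzero. *)
Definition fock_Dact (a : Dhat R) (v : F) : F :=
  (a.2 * l%:R) *: v +
  \sum_(k \in [set: int])
    2^-1 *: \sum_(j \in [set: int]) (a.1 k).[- j%:~R] *: Xop (j - k) j v.

Definition is_fock_Oact (rho : 'M[C]_(l + l) -> F -> F) : Prop :=
  [/\ forall g, O2l g -> linear (rho g),
      forall v, rho 1%:M v = v
    & forall g h v, O2l g -> O2l h -> rho (g *m h) v = rho g (rho h v)] /\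
  [/\ forall g, O2l g -> rho g (vac F) = vac F
    & forall g a n v, O2l g ->
        rho g (psi a n v) = \sum_b g b a *: psi b n (rho g v)].

Definition howe_sum (L : SigmaD -> Dplus_module R) : lmodType C :=
  dirsum (fun x : SigmaD => tensor (VO x) (L x) : lmodType C).

Definition is_bimodule_iso (rho : 'M[C]_(l + l) -> F -> F)
    (L : SigmaD -> Dplus_module R) (Phi : {linear F -> howe_sum L}) : Prop :=
  [/\ bijective Phi,
      forall g v (x : SigmaD), O2l g ->
        Phi (rho g v) x = tensor_map (@VO_act x g) id (Phi v x)
    & forall a v (x : SigmaD), Dplus a ->
        Phi (fock_Dact a v) x = tensor_map id (@Dmod_act _ (L x) a) (Phi v x)].

End Fock.
End Orthogonal.

(* Main.v *)
(** The Fock space carries a positive definite Hermitian form making the fermion modes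
    adjoint in pairs. On each vector the Lie algebra acts through finitely many of the
    O(2l)-invariant quadratic operators B p q, and conversely each B p q is, up to a scalar,
    an element of the algebra on any given vector; so submodules are the B-stable subspaces.
    Since the energy is bounded below and the form is positive, the Fock space is spanned by
    the modules generated by singular vectors, each of which is irreducible, and
    two vectors of the same weight generate isomorphic modules by the same form.

    It remains to find the space of singular vectors. They split by content (the
    number of fermions on each level), which is a partition with columns of length at most
    2l. For columns of length at most l, sending a tensor slot in column c to a creation
    operator on level c identifies the traceless tensors of that shape with the singular
    vectors of that content; surjectivity is the exchange (Garnir) relations. Exchanging
    the modes 1/2 and -1/2 replaces the length of the first column by its complement to 2l
    and twists by det, which gives the remaining contents. The highest weight is the
    content, and its generating series telescopes to the cosh formula. *)
Require Import Defs.
From HB Require Import structures.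
From mathcomp Require Import all_boot all_order all_algebra all_fingroup.
From mathcomp Require Import boolp classical_sets functions cardinality fsbigop.
From mathcomp Require Import reals complex.
From mathcomp Require Import zify ring.

Set Implicit Arguments.
Unset Strict Implicit.
Unset Printing Implicit Defensive.
Import Order.TTheory GRing.Theory Num.Theory.
Local Open Scope ring_scope.

(** * Clifford modules and the Fock space *)

Section Modes.
Variables (R : realType) (l : nat).
Local Notation C := R[i].

(** The Fock space is known only through its axioms, and the elements of the algebra act by infinite
    sums that become finite on each vector. Two devices answer this. A linear map is built as the
    submodule of a product generated by one pair of vectors; it is a graph because a pair (0, y)
    with y nonzero would contradict simplicity (for maps out of the Fock space) or positivity of the
    form (for intertwiners of highest weight modules). Statements on infinite sums are checked on
    finite truncations adapted to the vectors at hand. Complete reducibility also rests on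
    finiteness: orthogonal projections are constructed only onto finite-dimensional subspaces, which
    the energy filtration supplies. The central term is found without manipulating infinite sums:
    commutators with the fermions determine an operator up to a scalar, and the vacuum expectation
    reads off that scalar. Finally, the labels match the contents because of one inequality beyond
    being a partition: the first two columns of a singular content add up to at most 2l, which is
    the dominance of the vector with modes 1/2 and -1/2 exchanged. *)

Definition dix (a : 'I_(l + l)) : 'I_(l + l) :=
  match fintype.split a with inl k => rshift l k | inr k => lshift l k end.

Lemma dixK : involutive dix.
Proof.
by move=> a; rewrite /dix; case: (split_ordP a) => k ->; case: split_ordP => j /eqP;
  rewrite ?eq_lshift ?eq_rshift ?eq_lrshift ?eq_rlshift => // /eqP ->.
Qed.

Lemma dix_lshift (k : 'I_l) : dix (lshift l k) = rshift l k.
Proof. by rewrite /dix (unsplitK (inl _ k)). Qed.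

Lemma dix_rshift (k : 'I_l) : dix (rshift l k) = lshift l k.
Proof. by rewrite /dix (unsplitK (inr _ k)). Qed.

Lemma formJE a b : formJ R l a b = (b == dix a)%:R.
Proof.
rewrite /formJ; case: (split_ordP a) => i ->; case: (split_ordP b) => j ->;
  rewrite ?block_mxEul ?block_mxEur ?block_mxEdl ?block_mxEdr ?mxE
    ?dix_lshift ?dix_rshift ?eq_lshift ?eq_rshift ?eq_lrshift ?eq_rlshift //;
  by rewrite eq_sym.
Qed.

(** The integer [m] names the half-integer [m + 1/2], whose negative is named by [-1 - m]. *)
Definition bar (m : int) : int := - 1 - m.

Lemma barK : involutive bar.
Proof. by move=> m; rewrite /bar opprB addrC subrK. Qed.

Lemma bar_pos (n : nat) : bar (Posz n) = Negz n.
Proof. by rewrite /bar NegzE; lia. Qed.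

Lemma bar_neg (n : nat) : bar (Negz n) = Posz n.
Proof. by rewrite -bar_pos barK. Qed.

Lemma bar_ge0 m : (0 <= bar m) = (m < 0).
Proof. by rewrite /bar; lia. Qed.

Lemma bar_lt0 m : (bar m < 0) = (0 <= m).
Proof. by rewrite /bar; lia. Qed.

Local Notation mode := ('I_(l + l) * int)%type.
(** The only mode whose anticommutator with [x] is nonzero; it becomes the adjoint of [x] for the
    Hermitian form. *)
Definition star (x : mode) : mode := (dix x.1, bar x.2).

Lemma starK : involutive star.
Proof. by case=> a m; rewrite /star /= dixK barK. Qed.

Lemma eq_star x y : (x == star y) = (y == star x).
Proof. by apply/eqP/eqP => ->; rewrite starK. Qed.

End Modes.

Notation mode l := ('I_(l + l) * int)%type.

Section Subspace.
Variables (R : realType) (V : lmodType R[i]) (P : V -> Prop).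
Hypothesis HP : is_subspace P.

Lemma sub0 : P 0. Proof. exact: HP.1. Qed.
Lemma subL c u v : P u -> P v -> P (c *: u + v). Proof. exact: HP.2. Qed.
Lemma subZ c u : P u -> P (c *: u).
Proof. by move=> Pu; rewrite -[_ *: _]addr0; apply: subL => //; exact: sub0. Qed.
Lemma subD u v : P u -> P v -> P (u + v).
Proof. by move=> Pu Pv; rewrite -[u]scale1r; apply: subL. Qed.
Lemma subN u : P u -> P (- u).
Proof. by rewrite -scaleN1r; apply: subZ. Qed.
Lemma subB u v : P u -> P v -> P (u - v).
Proof. by move=> Pu /subN; apply: subD. Qed.
Lemma sub_sum (I : Type) (r : seq I) (Q : pred I) (f : I -> V) :
  (forall i, Q i -> P (f i)) -> P (\sum_(i <- r | Q i) f i).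
Proof. by move=> Pf; apply: big_ind => //; [exact: sub0 | exact: subD]. Qed.
Lemma sub_sum_seq (I : eqType) (r : seq I) (f : I -> V) :
  (forall i, i \in r -> P (f i)) -> P (\sum_(i <- r) f i).
Proof. by move=> Pf; rewrite big_seq; exact: sub_sum. Qed.
End Subspace.

Section Gen.
Variables (R : realType) (X : Type) (M : lmodType R[i]) (op : X -> M -> M) (w : M).

Inductive gen : M -> Prop :=
| gen_base : gen w
| gen_lin c u v : gen u -> gen v -> gen (c *: u + v)
| gen_op x v : gen v -> gen (op x v).

Lemma gen_subspace : is_subspace gen.
Proof.
split; last exact: gen_lin.
by rewrite -(addNr w) -scaleN1r; apply: gen_lin; exact: gen_base.
Qed.

End Gen.

(** * Simplicity of the Clifford module generated by a vacuum vector *)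

Section Car.
Variables (R : realType) (l : nat) (M : lmodType R[i]).
Variables (op : mode l -> M -> M) (w : M).
Hypothesis op_lin : forall x, linear (op x).
(** The relations are demanded only on the submodule generated by [w]: in the products used to build
    maps they may fail elsewhere. *)
Hypothesis op_ac : forall x y v, gen op w v ->
  op x (op y v) + op y (op x v) = (y == star x)%:R *: v.
Hypothesis op_w : forall x : mode l, 0 <= x.2 -> op x w = 0.
Local Notation G := (gen op w).

Let GP : is_subspace G. Proof. exact: gen_subspace. Qed.

Let opD x u v : op x (u + v) = op x u + op x v.
Proof. by have := op_lin x 1 u v; rewrite !scale1r. Qed.
Let op0 x : op x 0 = 0.
Proof. by have := op_lin x (-1) 0 0; rewrite !scaleN1r oppr0 addr0 addNr. Qed.
Let opZ x c v : op x (c *: v) = c *: op x v.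
Proof. by have := op_lin x c v 0; rewrite op0 !addr0. Qed.
Let opN x v : op x (- v) = - op x v.
Proof. by rewrite -scaleN1r opZ scaleN1r. Qed.

Let swap x y v : G v -> op x (op y v) = (y == star x)%:R *: v - op y (op x v).
Proof. by move=> Gv; rewrite -(op_ac x y Gv) addrK. Qed.

Let neq_star (x y : mode l) : (0 <= x.2) = (0 <= y.2) -> (x == star y) = false.
Proof. by move=> h; apply/negbTE/eqP => e; move: h; rewrite e /= bar_ge0 leNgt; case: (_ < _). Qed.

Let sq0 x v : G v -> op x (op x v) = 0.
Proof.
move=> Gv; have := op_ac x x Gv; rewrite neq_star // scale0r -mulr2n -scaler_nat.
by move=> /eqP; rewrite scaler_eq0 pnatr_eq0 /= => /eqP.
Qed.

Inductive creation_span : M -> Prop :=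
| creation_base : creation_span w
| creation_lin c u v :
    creation_span u -> creation_span v -> creation_span (c *: u + v)
| creation_op x u : x.2 < 0 -> creation_span u -> creation_span (op x u).

Let cG v : creation_span v -> G v.
Proof.
elim=> [|c u {}v _ Gu _ Gv|x u _ _ Gu]; first exact: gen_base.
  exact: gen_lin.
exact: gen_op.
Qed.

Let cP : is_subspace creation_span.
Proof.
split; last exact: creation_lin.
by rewrite -(addNr w) -scaleN1r; apply: creation_lin; exact: creation_base.
Qed.

Lemma creation_spans v : G v -> creation_span v.
Proof.
elim=> [|c u {}v _ cu _ cv|x {}v Gv cv]; [exact: creation_base|exact: creation_lin|].
have [x0|x0] := ltP x.2 0; first exact: creation_op.
elim: cv => {v Gv} [|c u v cu Hu cv Hv|y u y0 cu Hu].
- by rewrite op_w //; exact: sub0.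
- by rewrite op_lin; exact: creation_lin.
- rewrite swap; last exact: cG.
  by apply: (subB cP); [exact: subZ | exact: creation_op].
Qed.

(** For an annihilator [x] this projects onto the vectors in which the creation mode [star x] is
    empty. A long enough product [Q s] leaves only the vacuum component, and so stands in for the
    vacuum expectation before any form is available. *)
Let q x v := op x (op (star x) v).
Let Q s v := foldr q v s.

Let QG s v : G v -> G (Q s v).
Proof. by move=> Gv; elim: s => //= x s IH; do 2!apply: gen_op. Qed.

Let QL s c u v : Q s (c *: u + v) = c *: Q s u + Q s v.
Proof. by elim: s => //= x s ->; rewrite /q !op_lin. Qed.
Let Q0 s : Q s 0 = 0.
Proof. by elim: s => //= x s ->; rewrite /q !op0. Qed.

Let Q_fix (s : seq (mode l)) v : {in s, forall x : mode l, 0 <= x.2} -> (forall x : mode l, 0 <= x.2 -> op x v = 0) ->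
  G v -> Q s v = v.
Proof.
move=> s0 v0 Gv; elim: s s0 => //= x s IH s0.
rewrite IH; last by move=> y ys; apply: s0; rewrite inE ys orbT.
have x0 : 0 <= x.2 by apply: s0; rewrite inE eqxx.
by rewrite /q swap // eqxx scale1r v0 // op0 subr0.
Qed.

Let Q_op (s : seq (mode l)) y u : {in s, forall x : mode l, 0 <= x.2} -> y.2 < 0 -> G u ->
  Q s (op y u) = if star y \in s then 0 else op y (Q s u).
Proof.
move=> s0 y0 Gu; elim: s s0 => //= x s IH s0.
rewrite IH; last by move=> z zs; apply: s0; rewrite inE zs orbT.
have x0 : 0 <= x.2 by apply: s0; rewrite inE eqxx.
rewrite inE; case: (star y \in s); rewrite ?orbT ?orbF; first by rewrite /q !op0.
have GQ := QG s Gu; have [<-|yx] := eqVneq (star y) x.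
  by rewrite /q starK sq0 // op0.
have yx' : (y == star x) = false by rewrite eq_star eq_sym (negbTE yx).
have xy : (y == x) = false by apply/negbTE/eqP => e; move: x0; rewrite leNgt -e y0.
rewrite /q (swap (star x)) // starK xy scale0r sub0r opN swap; last exact: gen_op.
by rewrite yx' scale0r sub0r opprK.
Qed.

(** The number [a] is the vacuum coefficient of [v]. Quantifying over all lists containing [s] makes
    the property stable under linear combinations: two lists are merged by concatenation. *)
Lemma car_decomp v : G v -> exists a (s : seq (mode l)), {in s, forall x : mode l, 0 <= x.2} /\
  forall s' : seq (mode l), {subset s <= s'} -> {in s', forall x : mode l, 0 <= x.2} -> Q s' (v - a *: w) = 0.
Proof.
move=> /creation_spans; elim=> [|c u {}v _ [a [s [s0 h]]] _ [b [t [t0 k]]]|x u x0 cu _].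
- by exists 1, [::]; split=> // s' _ _; rewrite scale1r subrr Q0.
- exists (c * a + b), (s ++ t); split=> [x|s' ss s'0].
    by rewrite mem_cat => /orP[/s0|/t0].
  rewrite scalerDl opprD addrACA -scalerA -scalerBr QL h ?k ?scaler0 ?addr0 //.
    by move=> x xt; apply: ss; rewrite mem_cat xt orbT.
  by move=> x xs; apply: ss; rewrite mem_cat xs.
- exists 0, [:: star x]; split=> [y|s' ss s0]; first by rewrite inE => /eqP ->; rewrite bar_ge0.
  rewrite scale0r subr0 Q_op ?ss ?inE //; exact: cG.
Qed.

(** [Q s] fixes whatever all annihilators kill, and for large [s] it kills [v - a *: w]. *)
Lemma car_schur v : G v -> (forall x : mode l, 0 <= x.2 -> op x v = 0) -> exists a, v = a *: w.
Proof.
move=> Gv v0; have [a [s [s0 h]]] := car_decomp Gv; exists a.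
apply/eqP; rewrite -subr_eq0 -(@Q_fix s (v - a *: w)) ?h //.
- by move=> x x0; rewrite opD opN opZ v0 // op_w // scaler0 subr0.
- by apply: (subB GP) => //; apply: (subZ GP); exact: gen_base.
Qed.

Lemma car_support v : G v -> exists s : seq (mode l),
  forall x : mode l, 0 <= x.2 -> x \notin s -> op x v = 0.
Proof.
move=> /creation_spans; elim=> [|c u {}v _ [s hs] _ [t ht]|x u x0 cu [s hs]].
- by exists [::] => x x0 _; rewrite op_w.
- exists (s ++ t) => x x0; rewrite mem_cat negb_or => /andP[xs xt].
  by rewrite op_lin hs // ht // scaler0 addr0.
- exists (star x :: s) => y y0; rewrite inE negb_or => /andP[yx ys].
  rewrite swap; last exact: cG.
  by rewrite eq_star (negbTE yx) scale0r hs // op0 subr0.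
Qed.

(** Annihilators are tried one at a time along the finite list of those that can act nontrivially.
    Whenever the result is nonzero it replaces the vector; what remains is killed by all of them,
    hence a nonzero multiple of [w]. *)
Lemma car_simple (N : M -> Prop) v :
  (forall x u, N u -> N (op x u)) -> (forall c u, N u -> N (c *: u)) ->
  N v -> G v -> v != 0 -> N w.
Proof.
move=> Nop NZ Nv Gv vn0; have [s hs] := car_support Gv.
have [u [Gu Nu un0 hu]] : exists u, [/\ G u, N u, u != 0 & forall x : mode l, 0 <= x.2 -> op x u = 0].
  elim: s => [|x s IH] in v Nv Gv vn0 hs *; first by exists v; split=> // x x0; exact: hs.
  have step u : N u -> G u -> u != 0 ->
      (forall y, 0 <= y.2 -> y \notin x :: s -> op y u = 0) -> op x u = 0 ->
      exists u, [/\ G u, N u, u != 0 & forall x : mode l, 0 <= x.2 -> op x u = 0].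
    move=> Nu Gu un0 hu xu; apply: (IH u) => // y y0 ys.
    by have [-> //|yx] := eqVneq y x; apply: hu => //; rewrite inE negb_or yx.
  have [x0|x0] := ltP x.2 0.
    apply: (IH v) => // y y0 ys; apply: hs => //; rewrite inE negb_or ys andbT.
    by apply/eqP => e; move: y0; rewrite leNgt e x0.
  have [xv|xv] := eqVneq (op x v) 0; first exact: (step v).
  apply: (step (op x v)) => //; [exact: Nop|exact: gen_op| |exact: sq0].
  by move=> y y0 ys; rewrite swap // neq_star ?x0 ?y0 // hs // op0 scale0r subr0.
have [a ua] := car_schur Gu hu.
have an0 : a != 0 by apply: contraNneq un0 => a0; rewrite ua a0 scale0r.
by rewrite -(scale1r w) -(mulVf an0) -scalerA -ua; apply: NZ.
Qed.

(** This is the vacuum expectation value. [car_decomp] gives its existence; the uniqueness of the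
    coefficient, tested on the concatenation of two lists, gives linearity. *)
Lemma car_functional : w != 0 -> exists e : M -> R[i],
  [/\ forall c u v, G u -> G v -> e (c *: u + v) = c * e u + e v,
      e w = 1 & forall x u, x.2 < 0 -> G u -> e (op x u) = 0].
Proof.
move=> wn0.
pose P v a := exists s : seq (mode l), {in s, forall x : mode l, 0 <= x.2} /\
  forall s' : seq (mode l), {subset s <= s'} ->
    {in s', forall x : mode l, 0 <= x.2} -> Q s' (v - a *: w) = 0.
have uniqP v a b : P v a -> P v b -> a = b.
  move=> [s [s0 hs]] [t [t0 ht]]; set s' := s ++ t.
  have s'0 : {in s', forall x : mode l, 0 <= x.2}.
    by move=> x; rewrite mem_cat => /orP[/s0|/t0].
  have ha : Q s' (v - a *: w) = 0 by apply: hs => // x; rewrite mem_cat => ->.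
  have hb : Q s' (v - b *: w) = 0 by apply: ht => // x; rewrite mem_cat orbC => ->.
  have : Q s' ((-1) *: (v - b *: w) + (v - a *: w)) = 0.
    by rewrite QL ha hb scaler0 addr0.
  rewrite scaleN1r opprB addrA subrK -scalerBl -[_ *: w]addr0 QL Q0 addr0 Q_fix //.
    by move=> /eqP; rewrite scaler_eq0 (negbTE wn0) orbF subr_eq0 => /eqP.
  exact: gen_base.
have [e he] : {e : M -> R[i] & forall v, G v -> P v (e v)}.
  apply: (boolp.choice (P := fun v a => G v -> P v a)) => v.
  have [Gv|nG] := pselect (G v); last by exists 0.
  by have [a ha] := car_decomp Gv; exists a.
exists e; split=> [c u v Gu Gv||x u x0 Gu].
- apply: (uniqP (c *: u + v)); first by apply: he; exact: gen_lin.
  have [[s [s0 hs]] [t [t0 ht]]] := (he u Gu, he v Gv).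
  exists (s ++ t); split=> [x|s' ss s'0]; first by rewrite mem_cat => /orP[/s0|/t0].
  rewrite scalerDl opprD addrACA -scalerA -scalerBr QL hs ?ht ?scaler0 ?addr0 //.
    by move=> x xt; apply: ss; rewrite mem_cat xt orbT.
  by move=> x xs; apply: ss; rewrite mem_cat xs.
- apply: (uniqP w); first by apply: he; exact: gen_base.
  by exists [::]; split=> // s' _ _; rewrite scale1r subrr Q0.
- apply: (uniqP (op x u)); first by apply: he; exact: gen_op.
  exists [:: star x]; split=> [y|s' ss s0]; first by rewrite inE => /eqP ->; rewrite bar_ge0.
  by rewrite scale0r subr0 Q_op ?ss ?inE.
Qed.

End Car.
Definition mk_linear (R : realType) (U V : lmodType R[i]) (f : U -> V)
    (hf : linear f) : {linear U -> V} :=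
  HB.pack f (GRing.isLinear.Build R[i] U V *:%R f hf).

(** * Universal property and Hermitian form of the Fock space *)

Section Fock.
Variables (R : realType) (l : nat) (F : fock_space R l).
Local Notation C := R[i].
Local Notation vac := (vac F).

Definition fpsi (x : mode l) (v : F) : F := psi x.1 x.2 v.

HB.instance Definition _ (x : mode l) :=
  GRing.isLinear.Build C F F *:%R (fpsi x) (@psi_linear R l F x.1 x.2).

Lemma fpsi_ac x y v : fpsi x (fpsi y v) + fpsi y (fpsi x v) = (y == star x)%:R *: v.
Proof.
rewrite /fpsi psi_anticomm formJE; case: x y => a m [b n] /=.
have -> : ((b, n) == star (a, m)) = (b == dix a) && (n == bar m) by [].
have -> : (m + n + 1 == 0) = (n == bar m) by rewrite /bar; apply/eqP/eqP; lia.
by case: (n == bar m); rewrite ?andbT ?andbF.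
Qed.

Lemma fpsiC x y v : fpsi x (fpsi y v) = (y == star x)%:R *: v - fpsi y (fpsi x v).
Proof. by rewrite -(fpsi_ac x y v) addrK. Qed.

Lemma fpsi_vac x : 0 <= x.2 -> fpsi x vac = 0.
Proof. exact: psi_vac. Qed.

Lemma fock_gen v : gen fpsi vac v.
Proof.
apply: fock_generated => [||a n u]; [exact: gen_subspace|exact: gen_base|].
exact: (@gen_op _ _ _ fpsi vac (a, n)).
Qed.

Lemma fock_ind (P : F -> Prop) : is_subspace P -> P vac ->
  (forall x v, P v -> P (fpsi x v)) -> forall v, P v.
Proof.
by move=> PS P0 Pop; apply: fock_generated => // a n v; exact: (Pop (a, n)).
Qed.

Lemma fock_schur v : (forall x : mode l, 0 <= x.2 -> fpsi x v = 0) ->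
  exists a, v = a *: vac.
Proof.
apply: car_schur (fock_gen v); [by move=> x; exact: linearP| |exact: fpsi_vac].
by move=> x y u _; exact: fpsi_ac.
Qed.

Lemma fock_support v : exists s : seq (mode l),
  forall x : mode l, 0 <= x.2 -> x \notin s -> fpsi x v = 0.
Proof.
apply: car_support (fock_gen v); [by move=> x; exact: linearP| |exact: fpsi_vac].
by move=> x y u _; exact: fpsi_ac.
Qed.

Section Universal.
Variables (G : lmodType C) (K : G -> Prop) (ph : mode l -> G -> G) (w : G).
Hypotheses (KP : is_subspace K) (Kw : K w) (Kph : forall x v, K v -> K (ph x v)).
Hypothesis ph_lin : forall x, linear (ph x).
Hypothesis ph_ac : forall x y v, K v ->
  ph x (ph y v) + ph y (ph x v) = (y == star x)%:R *: v.
Hypothesis ph_w : forall x, 0 <= x.2 -> ph x w = 0.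

(** The graph is the submodule of [F * G] generated by [(vac, w)]. If it contained [(0, y)] with
    [y != 0], simplicity applied to the pairs with zero first component would put [(vac, w)] among
    them. [K] is the part of [G] on which the Clifford relations are known. *)
Lemma fock_universal : exists h : {linear F -> G},
  [/\ h vac = w, forall x v, h (fpsi x v) = ph x (h v) & forall v, K (h v)].
Proof.
pose op x (p : F * G) := (fpsi x p.1, ph x p.2).
pose w2 := (vac, w) : F * G.
have GK p : gen op w2 p -> K p.2.
  by elim=> [//|c u v _ Ku _ Kv|x v _ Kv]; [exact: subL|exact: Kph].
have func v y y' : gen op w2 (v, y) -> gen op w2 (v, y') -> y = y'.
  move=> Gy Gy'; apply/eqP; rewrite -subr_eq0; apply/negPn/negP => yn0.
  have/eqP[] := @vac_neq0 _ _ F.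
  apply: (@car_simple _ _ _ op w2 _ _ _ (fun p => p.1 = 0) (v - v, y - y')).
  - by move=> x c [a b] [a' b']; rewrite /op /= linearP ph_lin.
  - move=> x z p Gp; rewrite /op /=; congr pair; first exact: fpsi_ac.
    by apply: ph_ac; exact: GK.
  - by move=> x x0; rewrite /op /= fpsi_vac // ph_w.
  - by move=> x [a b] /= ->; rewrite linear0.
  - by move=> c [a b] /= ->; rewrite scaler0.
  - by rewrite /= subrr.
  - exact: (subB (gen_subspace _ _) Gy Gy').
  - by rewrite subrr; apply: contra yn0 => /eqP [->].
have tot v : exists y, gen op w2 (v, y).
  apply: (@fock_ind (fun v => exists y, gen op w2 (v, y))) => [||x u [y Gy]].
  - split=> [|c u u' [y Gy] [y' Gy']]; first by exists 0; exact: (sub0 (gen_subspace _ _)).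
    by exists (c *: y + y'); exact: (gen_lin c Gy Gy').
  - by exists w; exact: gen_base.
  - by exists (ph x y); exact: (gen_op x Gy).
have [h hG] := choice tot.
have hl : linear h.
  by move=> c u v; apply: (func _ _ _ (hG _)); exact: (gen_lin c (hG u) (hG v)).
exists (mk_linear hl); split=> [|x v|v] /=.
- by apply: (func _ _ _ (hG _)); exact: gen_base.
- by apply: (func _ _ _ (hG _)); exact: (gen_op x (hG v)).
- exact: (GK _ (hG v)).
Qed.
End Universal.

(** The universal property defines [u |-> H u] with values in the functions on [F]: a mode acts by
    precomposition with its adjoint, and the vacuum goes to the conjugate of the vacuum expectation.
    The anticommutation relations hold on the conjugate-linear functions, which form [K]. *)
Lemma fock_form : exists H : F -> F -> C,
  [/\ forall v, linear (H^~ v : F -> C^o),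
      forall u v, H u v = (H v u)^*,
      forall x u v, H (fpsi x u) v = H u (fpsi (star x) v)
    & forall v, v != 0 -> 0 < H v v].
Proof.
have [||e [eL e1 e0]] := car_functional _ _ (fun x => @fpsi_vac x) (@vac_neq0 _ _ F).
- by move=> x; exact: linearP.
- by move=> x y u _; exact: fpsi_ac.
have {}eL c u v : e (c *: u + v) = c * e u + e v by apply: eL; exact: fock_gen.
have {}e0 x u : x.2 < 0 -> e (fpsi x u) = 0 by move=> ?; apply: e0 => //; exact: fock_gen.
pose K (f : F -> C^o) := forall c u v, f (c *: u + v) = c^* * f u + f v.
have KP : is_subspace K.
  split=> [c u v|c f g Kf Kg d u v]; first by rewrite mulr0 addr0.
  rewrite -[LHS]/(c * f (d *: u + v) + g (d *: u + v)) Kf Kg.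
  rewrite -[RHS]/(d^* * (c * f u + g u) + (c * f v + g v)); ring.
have [|||||H [Hv Hp HK]] := @fock_universal (F -> C^o) K
  (fun x f v => f (fpsi (star x) v)) (fun v => (e v)^* ) KP.
- by move=> c u v; rewrite eL rmorphD rmorphM.
- by move=> x f Kf c u v; rewrite linearP Kf.
- by move=> x c f g.
- move=> x y f Kf; apply/funext => v.
  have K0 : f 0 = 0 by have := Kf (-1) 0 0; rewrite scaler0 addr0 rmorphN1 mulN1r addNr.
  have KD u u' : f (u + u') = f u + f u'.
    by have := Kf 1 u u'; rewrite scale1r rmorph1 mul1r.
  rewrite -[LHS]/(f _ + f _) -KD fpsi_ac eq_star starK.
  rewrite -[X in f X]addr0 Kf K0 addr0 rmorph_nat.
  by rewrite [star y == x]eq_sym eq_star.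
- by move=> x x0; apply/funext => v; rewrite e0 ?bar_lt0 // rmorph0.
have Hl v : linear (H^~ v : F -> C^o) by move=> c u u'; rewrite /= linearP.
have H0 u : H u 0 = 0.
  by have := HK u (-1) 0 0; rewrite scaler0 addr0 rmorphN1 mulN1r addNr.
have Hvac v : H v vac = e v.
  have : creation_span fpsi vac v.
    apply: creation_spans (fock_gen v); [by move=> x; exact: linearP| |exact: fpsi_vac].
    by move=> x y u _; exact: fpsi_ac.
  elim.
  - by rewrite Hv e1 rmorph1.
  - by move=> c u {}v _ Hu _ H'v; rewrite Hl Hu H'v eL.
  - by move=> x u x0 _ _; rewrite Hp fpsi_vac ?bar_ge0 // H0 e0.
have Hs u v : H u v = (H v u)^*.
  move: v; apply: (fock_ind (P := fun u => forall v, H u v = (H v u)^* )).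
  - split=> [v|c u1 u2 h1 h2 v]; first by rewrite H0 linear0 rmorph0.
    by rewrite Hl h1 h2 HK !rmorphD !rmorphM /= conjCK.
  - by move=> v; rewrite Hvac Hv.
  - by move=> x u1 h v; rewrite Hp h -{2}(starK x) Hp.
exists (fun u v => H u v); split=> //; first by move=> x u v; rewrite Hp.
(* Induction on the annihilators that can act nontrivially. The parts of [v] with and without the
   mode [star x] are orthogonal, so [H v v] is [H u u + H v' v'], where [u] and [v'] no longer see
   [x]. *)
have pos (s : seq (mode l)) v : (forall x : mode l, 0 <= x.2 -> x \notin s -> fpsi x v = 0) ->
    0 <= H v v /\ (H v v = 0 -> v = 0).
  elim: s v => [|x s IH] v hv.
    have [a ->] : exists a, v = a *: vac by apply: fock_schur => x x0; exact: hv.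
    rewrite -[a *: vac]addr0 Hl linear0 HK H0 !addr0 Hvac e1 mulr1.
    rewrite -[_ *: _]/(a * a^* ) mul_conjC_ge0; split=> // /eqP.
    by rewrite mul_conjC_eq0 => /eqP ->; rewrite scale0r.
  have [x0|x0] := ltP x.2 0.
    apply: IH => y y0 ys; apply: hv => //; rewrite inE negb_or ys andbT.
    by apply/eqP => yx; move: y0; rewrite leNgt yx x0.
  have sq u : fpsi x (fpsi x u) = 0.
    have := fpsi_ac x x u; have -> : (x == star x) = false.
      by apply/negbTE/eqP => xs; move: (x0); rewrite xs /= bar_ge0 ltNge x0.
    rewrite scale0r -mulr2n -scaler_nat => /eqP.
    by rewrite scaler_eq0 pnatr_eq0 /= => /eqP.
  set u := fpsi x v; set v' := fpsi x (fpsi (star x) v).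
  have vE : v = fpsi (star x) u + v'.
    by rewrite addrC /u /v' fpsi_ac eqxx scale1r.
  have supp y : 0 <= y.2 -> y \notin s -> y != x -> fpsi y v = 0.
    by move=> y0 ys yx; apply: hv => //; rewrite inE negb_or yx.
  have [u0 uE] : 0 <= H u u /\ (H u u = 0 -> u = 0).
    apply: IH => y y0 ys; have [->|yx] := eqVneq y x; first exact: sq.
    rewrite /u fpsiC supp // linear0 subr0.
    have -> : (x == star y) = false.
      by apply/negbTE/eqP => xs; move: x0; rewrite xs /= bar_ge0 ltNge y0.
    by rewrite scale0r.
  have [v0 v'E] : 0 <= H v' v' /\ (H v' v' = 0 -> v' = 0).
    apply: IH => y y0 ys; have [->|yx] := eqVneq y x; first exact: sq.
    rewrite /v' fpsiC [fpsi y (fpsi (star x) v)]fpsiC (supp y) // linear0 subr0.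
    have -> : (x == star y) = false.
      by apply/negbTE/eqP => xs; move: x0; rewrite xs /= bar_ge0 ltNge y0.
    have -> : (star x == star y) = false.
      by apply/negbTE/eqP => xs; move: yx; rewrite -(starK x) xs starK eqxx.
    by rewrite !scale0r linear0 subr0.
  have HD a b c : H a (b + c) = H a b + H a c.
    by have := HK a 1 b c; rewrite scale1r rmorph1 mul1r.
  have HDl a b c : H (a + b) c = H a c + H b c by rewrite linearD.
  have cross : H (fpsi (star x) u) v' = 0 by rewrite Hp starK sq H0.
  have dia : H (fpsi (star x) u) (fpsi (star x) u) = H u u.
    rewrite Hp starK fpsiC eqxx scale1r /u sq linear0 subr0 //.
  have -> : H v v = H u u + H v' v'.
    by rewrite {1 2}vE HDl !HD dia cross [H v' _]Hs cross rmorph0 addr0 add0r.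
  split=> [|/eqP]; first exact: addr_ge0.
  rewrite paddr_eq0 // => /andP[/eqP /uE uz /eqP /v'E v'z].
  by rewrite vE uz v'z linear0 addr0.
move=> v vn0; have [s hs] := fock_support v; have [p0 pE] := pos s v hs.
by rewrite lt_def p0 andbT; apply: contra vn0 => /eqP /pE ->.
Qed.

End Fock.
(** * The action of the Lie algebra *)

Definition irange (N : nat) : seq int := [seq (Posz i - Posz N)%R | i <- iota 0 (N + N).+1].

Lemma mem_irange N (i : int) : (i \in irange N) = (`|i| <= N)%N.
Proof.
apply/mapP/idP => [[j] |h].
  by rewrite mem_iota => /andP[_ jN] ->; lia.
exists (absz (i + N)%R); last by lia.
by rewrite mem_iota; lia.
Qed.

Lemma irange_uniq N : uniq (irange N).
Proof. by rewrite map_inj_uniq ?iota_uniq // => i j /addIr []. Qed.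

Lemma fsum_irange (R : realType) (V : lmodType R[i]) (f : int -> V) N :
  (forall i : int, (N < `|i|)%N -> f i = 0) ->
  \sum_(i \in [set: int]) f i = \sum_(i <- irange N) f i.
Proof.
move=> f0; rewrite (fsbigE (irange N)) ?irange_uniq //.
  by apply: eq_bigl => i; rewrite in_setT.
by move=> i _; rewrite mem_irange -ltnNge => /f0.
Qed.

Lemma sum_irange_pred1 (R : realType) (V : lmodType R[i]) (f : int -> V) N (j : int) :
  (`|j| <= N)%N -> \sum_(i <- irange N) (i == j)%:R *: f i = f j.
Proof.
move=> jN; rewrite (bigD1_seq j) ?irange_uniq ?mem_irange //= eqxx scale1r big1 ?addr0 //.
by move=> i /negbTE ->; rewrite scale0r.
Qed.

Section Quadratic.
Variables (R : realType) (l : nat) (F : fock_space R l).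
Local Notation C := R[i].
Local Notation vac := (vac F).

Definition form : F -> F -> C := projT1 (cid (fock_form F)).

Lemma formP :
  [/\ forall v, linear (form^~ v : F -> C^o),
      forall u v, form u v = (form v u)^*,
      forall x u v, form (fpsi x u) v = form u (fpsi (star x) v)
    & forall v, v != 0 -> 0 < form v v].
Proof. exact: projT2 (cid (fock_form F)). Qed.

Lemma formC u v : form u v = (form v u)^*.
Proof. by case: formP => _ + _ _; apply. Qed.

Lemma form_psi x u v : form (fpsi x u) v = form u (fpsi (star x) v).
Proof. by case: formP => _ _ + _; apply. Qed.

Lemma form_gt0 v : v != 0 -> 0 < form v v.
Proof. by case: formP => _ _ _; apply. Qed.

Lemma form_linl c u u' v : form (c *: u + u') v = c * form u v + form u' v.
Proof. by case: formP => + _ _ _ => /(_ v c u u'). Qed.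

Lemma form0l v : form 0 v = 0.
Proof. by have := form_linl (-1) 0 0 v; rewrite scaler0 addr0 mulN1r addNr. Qed.

Lemma formDl u u' v : form (u + u') v = form u v + form u' v.
Proof. by have := form_linl 1 u u' v; rewrite scale1r mul1r. Qed.

Lemma formZl c u v : form (c *: u) v = c * form u v.
Proof. by rewrite -[c *: u]addr0 form_linl form0l addr0. Qed.

Lemma form0r v : form v 0 = 0.
Proof. by rewrite formC form0l rmorph0. Qed.

Lemma formDr u v v' : form u (v + v') = form u v + form u v'.
Proof. by rewrite formC formDl rmorphD /= -!formC. Qed.

Lemma formZr c u v : form u (c *: v) = c^* * form u v.
Proof. by rewrite formC formZl rmorphM /= -!formC. Qed.

Lemma formBl u u' v : form (u - u') v = form u v - form u' v.
Proof. by rewrite formDl -scaleN1r formZl mulN1r. Qed.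

Lemma form_suml (I : Type) (r : seq I) (P : pred I) (f : I -> F) v :
  form (\sum_(i <- r | P i) f i) v = \sum_(i <- r | P i) form (f i) v.
Proof. by apply: (big_morph (form^~ v)) => [x y|]; [exact: formDl | exact: form0l]. Qed.

Lemma form_sumr (I : Type) (r : seq I) (P : pred I) (f : I -> F) v :
  form v (\sum_(i <- r | P i) f i) = \sum_(i <- r | P i) form v (f i).
Proof. by apply: (big_morph (form v)) => [x y|]; [exact: formDr | exact: form0r]. Qed.

Lemma form_eq0 v : form v v = 0 -> v = 0.
Proof.
by move=> v0; apply/eqP/negPn/negP => /form_gt0; rewrite v0 ltxx.
Qed.

(* The O(2l)-invariant quadratic operators. *)
Definition B (p q : int) (v : F) : F := \sum_a fpsi (a, p) (fpsi (dix a, q) v).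

Lemma B_linear p q : linear (B p q).
Proof.
move=> c u v; rewrite /B scaler_sumr -big_split /=.
by apply: eq_bigr => a _; rewrite !linearP.
Qed.
HB.instance Definition _ p q := GRing.isLinear.Build C F F *:%R (B p q) (B_linear p q).

Lemma star_pair (a b : 'I_(l + l)) (p r : int) :
  ((b, r) == star (a, p)) = (b == dix a) && (r == bar p).
Proof. by []. Qed.

Lemma eq_bar (p r : int) : (r == bar p) = (p == bar r).
Proof. by apply/eqP/eqP => ->; rewrite barK. Qed.

(** On mode indices [B p q] acts as the matrix [E_(p, bar q) - E_(q, bar p)] of an infinite
    orthogonal Lie algebra; the species [b] is untouched. *)
Lemma B_psi p q b r v : B p q (fpsi (b, r) v) = fpsi (b, r) (B p q v)
  + (q == bar r)%:R *: fpsi (b, p) v - (p == bar r)%:R *: fpsi (b, q) v.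
Proof.
have step a : fpsi (a, p) (fpsi (dix a, q) (fpsi (b, r) v)) =
    fpsi (b, r) (fpsi (a, p) (fpsi (dix a, q) v))
    + (if a == b then (q == bar r)%:R *: fpsi (b, p) v else 0)
    - (if a == dix b then (p == bar r)%:R *: fpsi (b, q) v else 0).
  rewrite [fpsi (dix a, q) _]fpsiC linearB linearZ /= [fpsi (a, p) (fpsi (b, r) _)]fpsiC.
  rewrite !star_pair dixK (eq_bar q) (eq_bar p) opprB addrC -addrA [in RHS]addrAC -addrA.
  congr (_ + _); rewrite addrC [RHS]addrC; congr (_ - _).
    by rewrite [b == a]eq_sym; case: eqP => [->|_] //; rewrite scale0r.
  have -> : (b == dix a) = (a == dix b) by apply/eqP/eqP => ->; rewrite dixK.
  by case: eqP => [->|_]; rewrite ?dixK //= scale0r.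
rewrite {1}/B; under eq_bigr do rewrite step.
rewrite big_split sumrN big_split /= -linear_sum -!big_mkcond /=.
by rewrite !big_pred1_eq.
Qed.

Lemma B_B p q r s v : B p q (B r s v) = B r s (B p q v)
  + (q == bar r)%:R *: B p s v - (p == bar r)%:R *: B q s v
  + (q == bar s)%:R *: B r p v - (p == bar s)%:R *: B r q v.
Proof.
rewrite {2}/B linear_sum /=.
under eq_bigr => a _ do rewrite !B_psi linearB linearD !linearZ /=.
rewrite !(big_split, sumrN) /= -!scaler_sumr !sumrN !scalerN -!/(B _ _ _).
by rewrite [LHS](ACl (1*4*5*2*3)%AC).
Qed.

Lemma B_swap p q v : B p q v = ((q == bar p)%:R * (l + l)%:R) *: v - B q p v.
Proof.
rewrite /B [in RHS](reindex_inj (inv_inj (@dixK l))) /=.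
under eq_bigr => a _ do rewrite fpsiC star_pair eqxx /=.
rewrite big_split sumrN /=; congr (_ - _); last by apply: eq_bigr => a _; rewrite dixK.
by rewrite sumr_const card_ord -scaler_nat scalerA mulrC.
Qed.

Lemma form_B p q u v : form (B p q u) v = form u (B (bar q) (bar p) v).
Proof.
rewrite /B form_suml form_sumr.
by apply: eq_bigr => a _; rewrite !form_psi /star /= !dixK.
Qed.

End Quadratic.
Lemma scaler_swap (K : comPzRingType) (V : lmodType K) (a b : K) (v : V) :
  a *: (b *: v) = b *: (a *: v).
Proof. by rewrite !scalerA mulrC. Qed.

Section Action.
Variables (R : realType) (l : nat) (F : fock_space R l).
Local Notation C := R[i].
Local Notation vac := (vac F).
Local Notation B := (@B R l F).
Local Notation form := (@form R l F).

(* Normal ordering only subtracts the vacuum contraction. *)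
Definition nB (p q : int) (v : F) : F :=
  B p q v - (((0 <= p) && (q == bar p))%:R * (l + l)%:R) *: v.

Lemma nB_linear p q : linear (nB p q).
Proof.
move=> c u v; rewrite /nB linearP scalerBr scalerDr !scalerA mulrC opprD.
by rewrite addrACA (mulrC c).
Qed.
HB.instance Definition _ p q := GRing.isLinear.Build C F F *:%R (nB p q) (nB_linear p q).

(** Reversing the factors of the second product gives the terms with psi^- on the left, so the two
    products together sum over all [2l] species. Their vacuum contractions combine into the one
    subtracted in [nB]. *)
Lemma XopE i j v : Xop i j v = nB (- i) (j - 1) v.
Proof.
rewrite /Xop; move: (- i) (j - 1) => p q.
rewrite /nB /B big_split_ord /=.
under eq_bigr => k _ do rewrite -!/(fpsi (_, _) _).
have nE a r b s : nord_psi a r b s v = fpsi (a, r) (fpsi (b, s) v)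
    - ((0 <= r) && (b == dix a) && (s == bar r))%:R *: v.
  rewrite /nord_psi -!/(fpsi (_, _) _); case: ifP => _; last by rewrite scale0r subr0.
  by rewrite [in RHS]fpsiC star_pair addrAC subrr add0r.
pose A := \sum_(k < l) fpsi (lshift l k, p) (fpsi (rshift l k, q) v).
pose A' := \sum_(k < l) fpsi (rshift l k, p) (fpsi (lshift l k, q) v).
have kE (k : 'I_l) : nord_psi (lshift l k) p (rshift l k) q v
      - nord_psi (lshift l k) q (rshift l k) p v =
    fpsi (lshift l k, p) (fpsi (rshift l k, q) v)
    + fpsi (rshift l k, p) (fpsi (lshift l k, q) v)
    - (((0 <= p) && (q == bar p))%:R *+ 2) *: v.
  rewrite !nE !dix_lshift !eqxx !andbT [fpsi (lshift l k, q) (fpsi _ v)]fpsiC.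
  rewrite star_pair dix_lshift eqxx (eq_bar q p) /=.
  have comb (X Y : F) (a b d e : C) : a + b - d = e ->
      (X - a *: v) - (b *: v - Y - d *: v) = X + Y - e *: v.
    move=> <-; rewrite scalerBl scalerDl !opprB opprD !addrA.
    by rewrite [LHS](ACl (1*4*3*2*5)%AC).
  apply: comb; have [->|_] := eqVneq; last by rewrite !andbF mul0rn !addr0 subr0.
  rewrite !andbT bar_ge0 ltNge; case: (0 <= p); rewrite /= ?mulr2n; ring.
rewrite (eq_bigr _ (fun k _ => kE k)) sumrB big_split /= -/A -/A'.
congr (_ + _ - _).
- by apply: eq_bigr => k _; rewrite dix_lshift.
- by apply: eq_bigr => k _; rewrite dix_rshift.
by rewrite sumr_const card_ord -scaler_nat scalerA; congr (_ *: _); rewrite natrD mulr2n; ring.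
Qed.

Lemma nB_swap p q v : nB p q v = - nB q p v.
Proof.
rewrite /nB B_swap (eq_bar p q) opprB addrAC -scalerBl -mulrBl; congr ((_ * _) *: _ - _).
have [->|_] := eqVneq; last by rewrite !andbF subrr.
by rewrite !andbT bar_ge0; case: ltP => _; rewrite ?subrr ?subr0.
Qed.

Definition bounded (N : nat) (v : F) : Prop := forall x : mode l, N%:Z <= x.2 -> fpsi x v = 0.

Lemma bounded_exists v : exists N, bounded N v.
Proof.
have [s hs] := fock_support v; exists (\max_(x <- s) (absz x.2).+1)%N => x xN.
have x0 : 0 <= x.2 by apply: le_trans xN.
apply: hs => //; apply/negP => xs; 
have : ((absz x.2).+1 <= \max_(x <- s) (absz x.2).+1)%N by apply: (leq_bigmax_seq _ xs).
by lia.
Qed.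

Lemma nB_bounded N p q v : bounded N v -> (N%:Z <= p) || (N%:Z <= q) -> nB p q v = 0.
Proof.
wlog qN : p q / N%:Z <= q.
  move=> H bv /orP[pN|qN]; last by apply: H; rewrite ?qN ?orbT.
  by rewrite nB_swap H ?pN ?orbT ?oppr0.
move=> bv _; rewrite /nB; have -> : (0 <= p) && (q == bar p) = false by rewrite /bar; lia.
by rewrite mul0r scale0r subr0; apply: big1 => a _; rewrite [fpsi (dix a, q) v]bv // linear0.
Qed.

(** A finitely supported sum is zero by default when its support is infinite, so [fock_Dact] cannot
    be handled termwise at once; its properties are proved at a truncation valid for all the vectors
    involved. *)
Definition Dact_cut (N : nat) (a : Dhat R) (v : F) : F :=
  (a.2 * l%:R) *: v + \sum_(k <- irange N)
    2^-1 *: \sum_(j <- irange N) (a.1 k).[- j%:~R] *: nB (k - j) (j - 1) v.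

Lemma Dalg_support (d : Dalg R) : exists N, forall k, (N < `|k|)%N -> d k = 0.
Proof.
case: d => d /[dup] /asboolP /finite_seqP [s hs] p; exists (\max_(x <- s) (absz x))%N => k kN.
apply/eqP/negPn/negP => dk; have : k \in s.
  by have := congr1 (fun A => A k) hs => /= <-.
move=> ks; have : (absz k <= \max_(x <- s) absz x)%N by apply: (leq_bigmax_seq _ ks).
by lia.
Qed.

Lemma fock_Dact_cut a v : exists N0, forall N, (N0 <= N)%N -> fock_Dact a v = Dact_cut N a v.
Proof.
have [T hT] := Dalg_support a.1; have [M bv] := bounded_exists v.
exists (T + M)%N => N TN; rewrite /fock_Dact /Dact_cut; congr (_ + _).
rewrite (@fsum_irange _ _ _ N) => [|k kN]; last first.
  rewrite hT; last by lia.
  rewrite (@fsum_irange _ _ _ 0) => [|j _]; last by rewrite horner0 scale0r.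
  by rewrite big1 ?scaler0 // => j _; rewrite horner0 scale0r.
apply: eq_bigr => k _; have [kT|kT] := leqP (absz k) T; last first.
  rewrite hT // (@fsum_irange _ _ _ 0) => [|j _]; last by rewrite horner0 scale0r.
  by congr (_ *: _); rewrite !big1 // => j _; rewrite horner0 scale0r.
congr (_ *: _); rewrite (@fsum_irange _ _ _ N) => [|j jN].
  by apply: eq_bigr => j _; rewrite XopE opprB.
by rewrite XopE opprB (nB_bounded bv) ?scaler0 //; lia.
Qed.

Lemma Dact_cutL N a c u v : Dact_cut N a (c *: u + v) = c *: Dact_cut N a u + Dact_cut N a v.
Proof.
rewrite /Dact_cut [in RHS]scalerDr [RHS]addrACA; congr (_ + _).
  by rewrite scalerDr !scalerA mulrC.
rewrite scaler_sumr -big_split; apply: eq_bigr => k _ /=.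
rewrite [X in _ = X + _]scaler_swap -scalerDr; congr (_ *: _); rewrite scaler_sumr -big_split.
by apply: eq_bigr => j _; rewrite linearP scalerDr !scalerA mulrC.
Qed.

Lemma Dact_cut_lin N c a b v : Dact_cut N (c *: a + b) v = c *: Dact_cut N a v + Dact_cut N b v.
Proof.
rewrite /Dact_cut [in RHS]scalerDr [RHS]addrACA; congr (_ + _).
  by rewrite -[(c *: a + b).2]/(c * a.2 + b.2) mulrDl scalerDl scalerA mulrA.
rewrite scaler_sumr -big_split; apply: eq_bigr => k _ /=.
rewrite [X in _ = X + _]scaler_swap -scalerDr; congr (_ *: _); rewrite scaler_sumr -big_split.
apply: eq_bigr => j _; rewrite -[X in X.[_] *: _ = _]/(c *: a.1 k + b.1 k).
by rewrite hornerD hornerZ scalerDl scalerA.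
Qed.

Lemma fock_Dact_linear a : linear (@fock_Dact R l F a).
Proof.
move=> c u v; have [[N1 h1] [N2 h2] [N3 h3]] :=
  And3 (fock_Dact_cut a u) (fock_Dact_cut a v) (fock_Dact_cut a (c *: u + v)).
set N := (N1 + N2 + N3)%N.
by rewrite (h1 N) ?(h2 N) ?(h3 N) ?Dact_cutL // /N; lia.
Qed.
HB.instance Definition _ a := GRing.isLinear.Build C F F *:%R (@fock_Dact R l F a) (fock_Dact_linear a).

Lemma fock_Dact_lin c a b v :
  fock_Dact (c *: a + b) v = c *: fock_Dact a v + fock_Dact b v :> F.
Proof.
have [[N1 h1] [N2 h2] [N3 h3]] :=
  And3 (fock_Dact_cut a v) (fock_Dact_cut b v) (fock_Dact_cut (c *: a + b) v).
set N := (N1 + N2 + N3)%N.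
by rewrite (h1 N) ?(h2 N) ?(h3 N) ?Dact_cut_lin // /N; lia.
Qed.

End Action.

(** * Commutators of homogeneous elements and the cocycle *)

Section Bracket.
Variables (R : realType) (l : nat) (F : fock_space R l).
Local Notation C := R[i].
Local Notation vac := (vac F).
Local Notation B := (@B R l F).
Local Notation nB := (@nB R l F).
Local Notation form := (@form R l F).
Local Notation act := (@fock_Dact R l F).

Lemma tDE r (f : {poly C}) k : tD r f k = if k == r then f else 0.
Proof.
rewrite /tD /dsum_in /dirsum_at /=; case: eqVneq => [->|kr]; first by rewrite dfwith_in.
by rewrite dfwith_out // eq_sym.
Qed.

Lemma nB_psi p q b r v : nB p q (fpsi (b, r) v) = fpsi (b, r) (nB p q v)
  + (q == bar r)%:R *: fpsi (b, p) v - (p == bar r)%:R *: fpsi (b, q) v.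
Proof.
by rewrite /nB B_psi [in RHS]linearB [in RHS]linearZ /= [LHS](ACl (1*4*2*3)%AC).
Qed.

Lemma act_tDhat N M r f v : bounded M v -> (M + `|r| <= N)%N ->
  act (tDhat r f) v = 2^-1 *: \sum_(j <- irange N) f.[- j%:~R] *: nB (r - j) (j - 1) v.
Proof.
move=> bv MN; rewrite /fock_Dact mul0r scale0r add0r.
have E k : (tDhat r f).1 k = if k == r then f else 0 by exact: tDE.
have z k : k != r -> 2^-1 *: (\sum_(j \in [set: int]) ((tDhat r f).1 k).[- j%:~R] *: Xop (j - k) j v) = 0.
  move=> kr; rewrite E (negbTE kr) (@fsum_irange _ _ _ 0) => [|j _].
    by rewrite big1 ?scaler0 // => j _; rewrite horner0 scale0r.
  by rewrite horner0 scale0r.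
rewrite (@fsum_irange _ _ _ N); last first.
  by move=> k kN; apply: z; apply/eqP => kr; move: kN; rewrite kr; lia.
rewrite (eq_bigr (fun k => (k == r)%:R *:
    (2^-1 *: \sum_(j <- irange N) f.[- j%:~R] *: nB (r - j) (j - 1) v))); last first.
  move=> k _; have [->|kr] := eqVneq k r; last by rewrite z // scale0r.
  rewrite scale1r; congr (_ *: _); rewrite E eqxx (@fsum_irange _ _ _ N) => [|j jN].
    by apply: eq_bigr => j _; rewrite XopE opprB.
  by rewrite XopE opprB (nB_bounded bv) ?scaler0 //; lia.
by rewrite sum_irange_pred1 //; lia.
Qed.

(** Expresses on values that [f(w) = g(w + (r+1)/2)] with [g] odd, the condition for [t^r f(D)] to
    lie in the subalgebra. *)
Definition sym_poly (r : int) (f : {poly C}) := forall z, f.[- z - r%:~R - 1] = - f.[z].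

(** The two commutator terms of [B_psi] contribute equally by the symmetry of [f], which absorbs the
    factor 1/2. The modes of each species thus transform as the powers [t^n] under [t^r f(D)]. *)
Lemma act_psi r f b n v : sym_poly r f ->
  act (tDhat r f) (fpsi (b, n) v) =
  fpsi (b, n) (act (tDhat r f) v) + f.[n%:~R] *: fpsi (b, n + r) v.
Proof.
move=> sf; have [M1 b1] := bounded_exists v; have [M2 b2] := bounded_exists (fpsi (b, n) v).
pose N := (M1 + M2 + `|r| + `|n| + 1)%N.
rewrite !(@act_tDhat N _ r f _ b1) ?(@act_tDhat N _ r f _ b2) /N; [|lia|lia].
rewrite -/N linearZ /= [X in _ = _ *: X + _](_ : _ =
    \sum_(j <- irange N) fpsi (b, n) (f.[- j%:~R] *: nB (r - j) (j - 1) v)); last exact: linear_sum.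
under eq_bigr => j _ do rewrite nB_psi.
have e j : f.[- j%:~R] *: (fpsi (b, n) (nB (r - j) (j - 1) v)
    + (j - 1 == bar n)%:R *: fpsi (b, r - j) v - (r - j == bar n)%:R *: fpsi (b, j - 1) v)
  = fpsi (b, n) (f.[- j%:~R] *: nB (r - j) (j - 1) v)
    + (j == - n)%:R *: (f.[n%:~R] *: fpsi (b, n + r) v)
    + (j == r + n + 1)%:R *: (f.[n%:~R] *: fpsi (b, n + r) v).
  rewrite scalerBr scalerDr; congr (_ + _ + _); first by rewrite [in RHS]linearZ.
    have -> : (j - 1 == bar n) = (j == - n) by rewrite /bar; apply/eqP/eqP; lia.
    by case: eqP => [->|_]; rewrite ?scale0r ?scaler0 // !scale1r rmorphN opprK opprK addrC.
  have -> : (r - j == bar n) = (j == r + n + 1) by rewrite /bar; apply/eqP/eqP; lia.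
  case: eqP => [->|_]; last by rewrite !scale0r scaler0 oppr0.
  rewrite !scale1r -scaleNr addrK [n + r]addrC; congr (_ *: _).
  rewrite -[RHS]opprK -(sf n%:~R); congr (- f.[_]).
  by rewrite !intrD; ring.
under eq_bigr => j _ do rewrite e.
rewrite !big_split /= !sum_irange_pred1 ?absz_nat; [|rewrite /N; lia|rewrite /N; lia].
rewrite -addrA scalerDr; congr (_ + _); rewrite -mulr2n -[X in _ *: X = _]scaler_nat scalerA.
by rewrite mulVf ?scale1r // pnatr_eq0.
Qed.

Lemma act_vac_orth r f : form (act (tDhat r f) vac) vac = 0.
Proof.
have [M bM] := bounded_exists vac.
rewrite (@act_tDhat (M + `|r|) M) // formZl form_suml big1 ?mulr0 // => j _.
rewrite formZl; move: (r - j) (j - 1) => p q; suff -> : form (nB p q vac) vac = 0 by rewrite mulr0.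
have [pq|] := boolP ((0 <= p) || (0 <= q)).
  by rewrite (@nB_bounded _ _ _ 0) ?form0l // => x; exact: fpsi_vac.
rewrite negb_or -!ltNge => /andP[p0 q0].
rewrite /nB leNgt p0 mul0r scale0r subr0 form_suml big1 // => a _.
by rewrite form_psi [fpsi (star _) vac]fpsi_vac ?form0r // bar_ge0.
Qed.

Lemma act_vac r f : 0 <= r -> act (tDhat r f) vac = 0.
Proof.
move=> r0; rewrite (@act_tDhat (0 + `|r|) 0) //; last by move=> x; exact: fpsi_vac.
rewrite big1 ?scaler0 // => j _; rewrite (@nB_bounded _ _ _ 0) ?scaler0 //; last by lia.
by move=> x; exact: fpsi_vac.
Qed.

(* The only quadratic monomials on the vacuum seen by [act (tDhat r f)] are those it
   contracts back to the vacuum. *)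
Lemma form_act_nB r f p q : sym_poly r f ->
  form (act (tDhat r f) (nB p q vac)) vac =
  if [&& p < 0, q < 0 & p + r == bar q] then (l + l)%:R * f.[p%:~R] * form vac vac else 0.
Proof.
move=> sf; have [pq|] := boolP ((0 <= p) || (0 <= q)).
  have -> : [&& p < 0, q < 0 & p + r == bar q] = false.
    by rewrite !ltNge; case/orP: pq => ->; rewrite ?andbF.
  by rewrite (@nB_bounded _ _ _ 0) ?linear0 ?form0l // => x; exact: fpsi_vac.
rewrite negb_or -!ltNge => /andP[p0 q0]; rewrite p0 q0 /=.
rewrite /nB leNgt p0 mul0r scale0r subr0 /B linear_sum form_suml /=.
rewrite (eq_bigr (fun _ => if p + r == bar q then f.[p%:~R] * form vac vac else 0)).
  rewrite sumr_const card_ord; case: ifP => _; last by rewrite mul0rn.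
  by rewrite -mulrA mulr_natl.
have cre0 b n u : n < 0 -> form (fpsi (b, n) u) vac = 0.
  by move=> n0; rewrite form_psi fpsi_vac ?form0r // bar_ge0.
move=> a _; rewrite [LHS](_ : _ = form (f.[p%:~R] *: fpsi (a, p + r) (fpsi (dix a, q) vac)) vac); last first.
  by rewrite /= act_psi // formDl cre0 // add0r.
rewrite formZl; have [pr|pr] := leP 0 (p + r); last first.
  by rewrite cre0 // mulr0; case: eqP => // e; move: pr; rewrite e bar_lt0 leNgt q0.
rewrite fpsiC [fpsi (a, _) vac]fpsi_vac // linear0 subr0 star_pair eqxx eq_bar /=.
by case: eqP => _; rewrite ?scale1r // scale0r form0l mulr0.
Qed.

(** This produces the cocycle: the inner operator creates pairs of fermions and the outer one
    contracts them. The [2l] species contribute equally, and the factor 1/2 of the inner operator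
    leaves [l]. *)
Lemma form_act_act r f s g : sym_poly r f ->
  form (act (tDhat r f) (act (tDhat s g) vac)) vac =
  if (r + s == 0) && (0 <= r) then l%:R * Psi0 `|r| f g * form vac vac else 0.
Proof.
move=> sf; have [s0|s0] := leP 0 s.
  rewrite act_vac // linear0 form0l; case: ifP => // /andP[/eqP rs r0].
  have -> : r = 0 by lia.
  by rewrite absz0 /Psi0 big_ord0 mulr0 mul0r.
rewrite (@act_tDhat (0 + `|s|) 0 s) //; last by move=> x; exact: fpsi_vac.
rewrite linearZ linear_sum formZl form_suml /=.
have P0 : form vac vac \is a GRing.unit by rewrite unitfE gt_eqF // form_gt0 // vac_neq0.
have -> : \sum_(j <- irange (0 + `|s|)) form (act (tDhat r f)
      (g.[- j%:~R] *: nB (s - j) (j - 1) vac)) vac =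
    \sum_(j <- irange (0 + `|s|)) (if [&& s < j, j <= 0 & r + s == 0] then
      g.[- j%:~R] * ((l + l)%:R * f.[(s - j)%:~R] * form vac vac) else 0).
  apply: eq_bigr => j _; rewrite linearZ formZl /= form_act_nB //.
  have -> : (s - j + r == bar (j - 1)) = (r + s == 0) by rewrite /bar; apply/eqP/eqP; lia.
  have -> : (s - j < 0) = (s < j) by lia.
  have -> : (j - 1 < 0) = (j <= 0) by lia.
  by case: ifP => _; rewrite ?mulr0.
have [rs|rs] := eqVneq (r + s) 0; last first.
  by rewrite /= big1 ?mulr0 // => j _; rewrite !andbF.
have r0 : 0 <= r by lia.
rewrite r0 /= /Psi0; have [n rn] : exists n : nat, r = n by exists `|r|%N; lia.
have sn : s = - n%:Z by lia.
rewrite {}sn {}rn /= -big_mkcond /=.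
have -> : \sum_(j <- irange (0 + `|- n%:Z|) | [&& - n%:Z < j, j <= 0 & true])
     g.[- j%:~R] * ((l + l)%:R * f.[(- n%:Z - j)%:~R] * form vac vac) =
   \sum_(j <- [seq - (Posz i) | i <- iota 0 n])
     g.[- j%:~R] * ((l + l)%:R * f.[(- n%:Z - j)%:~R] * form vac vac).
  rewrite -big_filter; apply: perm_big; apply: uniq_perm.
  - by rewrite filter_uniq ?irange_uniq.
  - by rewrite map_inj_uniq ?iota_uniq // => i j /oppr_inj [].
  move=> j; rewrite mem_filter mem_irange; apply/idP/mapP => [h|[k]].
    by exists `|j|%N; [rewrite mem_iota; lia | lia].
  by rewrite mem_iota => /andP[_ kn] ->; lia.
rewrite big_map -[in iota 0 n](subn0 n) -/(index_iota 0 n) big_mkord.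
(* Reversing the order of summation moves the evaluation point of [f] to [-(i+1)] and that of [g] to
   [-(i+1) + n], as in [Psi0]. *)
rewrite (reindex_inj rev_ord_inj) /= mulr_sumr [l%:R * _]mulr_sumr mulr_suml; apply: eq_bigr => i _.
have -> : (- (n - i.+1)%:Z)%:~R = - n%:R + i.+1%:R :> C.
  rewrite -subzn ?ltn_ord // opprB; rewrite intrD rmorphN /=; ring.
rewrite (_ : (- n%:Z - - (n - i.+1)%:Z)%:~R = - i.+1%:R :> C); last first.
  by rewrite -subzn ?ltn_ord // intrD !rmorphN /= intrD rmorphN /=; ring.
rewrite opprD opprK natrD addrC.
have n2 : (2 : C) != 0 by rewrite pnatr_eq0.
by field.
Qed.

(** The image of the vacuum is again killed by all annihilators, hence a multiple of it, and the
    same multiple propagates along the modes. *)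
Lemma commutant_scalar (D : {linear F -> F}) :
  (forall x u, D (fpsi x u) = fpsi x (D u)) -> exists a, forall v, D v = a *: v.
Proof.
move=> Dpsi; have [a Da] : exists a, D vac = a *: vac.
  by apply: fock_schur => x x0; rewrite -Dpsi fpsi_vac // linear0.
exists a; apply: (fock_ind (P := fun v => D v = a *: v)) => // [|x v Dv].
  by split=> [|c u v Du Dv]; rewrite ?linear0 ?scaler0 // linearP Du Dv scalerDr scaler_swap.
by rewrite Dpsi Dv linearZ.
Qed.

(* Both sides have the same commutators with the fermions, so they differ by a
   scalar, which the vacuum expectation value detects. *)
Lemma bracket_unique (X Y Z : {linear F -> F}) (f g h : int -> C) (r s : int) (c : C) :
  (forall b n v, X (fpsi (b, n) v) = fpsi (b, n) (X v) + f n *: fpsi (b, n + r) v) ->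
  (forall b n v, Y (fpsi (b, n) v) = fpsi (b, n) (Y v) + g n *: fpsi (b, n + s) v) ->
  (forall b n v, Z (fpsi (b, n) v) = fpsi (b, n) (Z v) + h n *: fpsi (b, n + (r + s)) v) ->
  (forall n, h n = f (n + s) * g n - f n * g (n + r)) ->
  form (Z vac) vac + c * form vac vac = form (X (Y vac)) vac - form (Y (X vac)) vac ->
  forall v, Z v + c *: v = X (Y v) - Y (X v).
Proof.
move=> hX hY hZ hh hvac.
pose D u := Z u + c *: u - (X (Y u) - Y (X u)).
have Dlin : linear D.
  move=> d u w; rewrite /D !linearP /= [in RHS]scalerBr [in RHS]scalerDr [in RHS]scalerBr.
  by rewrite !scalerN !opprB !opprD !opprK !addrA [LHS](ACl (1*3*7*5*2*4*8*6)%AC).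
have Dpsi x u : mk_linear Dlin (fpsi x u) = fpsi x (mk_linear Dlin u).
  case: x => b n /=; rewrite /D hX hY hZ !linearD !linearN !linearZ /= hX hY hX hY.
  have e1 : n + s + r = n + (r + s) by rewrite -addrA [s + r]addrC.
  rewrite e1 -[n + r + s]addrA hh scalerBl !opprK !(opprD, scalerN, scalerDr, scalerA).
  rewrite [g n * f _]mulrC !addrA [LHS](ACl (1*4*5*9*6*11*7*10*2*8*3*12)%AC) /=.
  by rewrite subrK addrK !subrK.
have [a Da] := commutant_scalar Dpsi.
have : form (D vac) vac = 0 by rewrite /D !(formBl, formDl, formZl) hvac subrr.
rewrite -[D vac]/(mk_linear Dlin vac) Da formZl => /eqP.
rewrite mulf_eq0 (gt_eqF (form_gt0 (@vac_neq0 _ _ F))) orbF => /eqP a0 v.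
by apply/eqP; rewrite -subr_eq0 -[_ - _]/(mk_linear Dlin v) Da a0 scale0r.
Qed.

(** Commutators with the fermions reproduce the composition of differential operators, and the
    vacuum expectations of the two products reproduce [l] times the cocycle; at most one of these
    expectations is nonzero. *)
Lemma act_bracket r f s g v : sym_poly r f -> sym_poly s g ->
  act (tDhat (r + s) (shiftp s%:~R f * g - f * shiftp r%:~R g)) v
    + (Psi_hom r f s g * l%:R) *: v =
  act (tDhat r f) (act (tDhat s g) v) - act (tDhat s g) (act (tDhat r f) v).
Proof.
move=> sf sg; set h := shiftp _ f * g - _.
have hE z : h.[z] = f.[z + s%:~R] * g.[z] - f.[z] * g.[z + r%:~R].
  by rewrite /h /shiftp hornerD hornerN !hornerM !horner_comp !hornerD !hornerX !hornerC.
have sh : sym_poly (r + s) h.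
  move=> z; rewrite !hE intrD.
  have -> : - z - (r%:~R + s%:~R) - 1 + s%:~R = - z - r%:~R - 1 :> C by ring.
  have -> : - z - (r%:~R + s%:~R) - 1 + r%:~R = - z - s%:~R - 1 :> C by ring.
  have E1 : - z - (r%:~R + s%:~R) - 1 = - (z + s%:~R) - r%:~R - 1 :> C by ring.
  have E2 : - z - (r%:~R + s%:~R) - 1 = - (z + r%:~R) - s%:~R - 1 :> C by ring.
  by rewrite {1}E2 E1 !sf !sg !mulrNN opprB.
apply: (@bracket_unique (act (tDhat r f)) (act (tDhat s g)) (act (tDhat (r + s) h))
  (fun n => f.[n%:~R]) (fun n => g.[n%:~R]) (fun n => h.[n%:~R]) r s).
- by move=> b n u; exact: act_psi.
- by move=> b n u; exact: act_psi.
- by move=> b n u; exact: act_psi.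
- by move=> n; rewrite hE !intrD.
rewrite act_vac_orth add0r /= !form_act_act // [s + r]addrC /Psi_hom.
have [rs|rs] := eqVneq (r + s) 0; last by rewrite !mul0r subrr.
have [r0|r0] := leP 0 r.
  have [s0|s0] := leP 0 s; last by rewrite subr0 [_ * l%:R]mulrC.
  have -> : s = 0 by lia.
  by rewrite /Psi0 big_ord0 mulr0 mul0r subr0 [_ * l%:R]mulrC.
have -> : 0 <= s by lia.
by rewrite sub0r !mulNr [_ * l%:R]mulrC.
Qed.

End Bracket.

(** * The action of the whole subalgebra, and density of its image *)

Section DplusAction.
Variables (R : realType) (l : nat) (F : fock_space R l).
Local Notation C := R[i].
Local Notation nB := (@nB R l F).
Local Notation act := (@fock_Dact R l F).

Lemma Dplus_sym (a : Dhat R) k : Dplus a -> sym_poly k (a.1 k).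
Proof.
move=> [n [c [x [hx ->]]]] z.
pose P (b : Dhat R) := (b.1 k).[- z - k%:~R - 1] = - (b.1 k).[z].
have PS : is_subspace P.
  split=> [|d u v Pu Pv]; first by rewrite /P -[(_ : dirsum _) k]/0 !horner0 oppr0.
  rewrite /P -[(_ : dirsum _) k]/(d *: u.1 k + v.1 k) !hornerE Pu Pv mulrN; ring.
have /(_ n c x) : forall n (c : 'I_n -> C) x, (forall i, Dplus_gen (x i)) -> P (\sum_i c i *: x i).
  move=> m d y hy; apply: (sub_sum PS) => i _; apply: (subZ PS).
  have [->|[r [g [og ->]]]] := hy i; first by rewrite /P -[(_ : dirsum _) k]/0 !horner0 oppr0.
  rewrite /P -[(_ : dirsum _) k]/(tD r _ k) tDE; case: eqP => [->|_]; last by rewrite !horner0 oppr0.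
  have og' y0 : g.[- y0] = - g.[y0].
    by have := congr1 (fun q => q.[y0]) og; rewrite horner_comp !hornerE.
  rewrite /shiftp !horner_comp !hornerE -og'; congr g.[_].
  have n2 : (2 : C) != 0 by rewrite pnatr_eq0.
  by field.
exact.
Qed.

Lemma dirsum_sumE (I : Type) (s : seq I) (f : I -> Dalg R) k :
  (\sum_(i <- s) f i) k = \sum_(i <- s) f i k.
Proof. by apply: (big_morph (fun d : Dalg R => d k)). Qed.

Lemma Dalg_ext (d e : Dalg R) : (forall k, d k = e k) -> d = e.
Proof.
by move=> h; apply: val_inj; apply: functional_extensionality_dep => k; exact: h.
Qed.

Lemma act_sum (I : Type) (s : seq I) (f : I -> Dhat R) v :
  act (\sum_(i <- s) f i) v = \sum_(i <- s) act (f i) v.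
Proof.
apply: (big_morph (fun a => act a v)) => [a b|].
  by rewrite -[a in LHS]scale1r fock_Dact_lin scale1r.
by have := fock_Dact_lin (-1) (0 : Dhat R) 0 v; rewrite scaler0 addr0 scaleN1r addNr.
Qed.

Lemma act_central c v : act (c *: Ccentral R) v = (c * l%:R) *: v.
Proof.
rewrite /fock_Dact (@fsum_irange _ _ _ 0) => [|k _].
  rewrite big1 ?addr0 => [|k _]; first by rewrite -[(_ *: _).2]/(c * 1) mulr1.
  rewrite (@fsum_irange _ _ _ 0) => [|j _].
    by rewrite big1 ?scaler0 // => j _; rewrite -[(_ : dirsum _) k]/(c *: 0) scaler0 horner0 scale0r.
  by rewrite -[(_ : dirsum _) k]/(c *: 0) scaler0 horner0 scale0r.
rewrite (@fsum_irange _ _ _ 0) => [|j _].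
  by rewrite big1 ?scaler0 // => j _; rewrite -[(_ : dirsum _) k]/(c *: 0) scaler0 horner0 scale0r.
by rewrite -[(_ : dirsum _) k]/(c *: 0) scaler0 horner0 scale0r.
Qed.

Lemma pair_sumE (I : Type) (s : seq I) (f : I -> Dalg R) (c : C) :
  (\sum_(i <- s) f i, c) = \sum_(i <- s) (f i, 0) + c *: Ccentral R :> Dhat R.
Proof.
have -> : \sum_(i <- s) ((f i, 0) : Dhat R) = (\sum_(i <- s) f i, 0) :> Dhat R.
  elim: s => [|i s IH]; first by rewrite !big_nil.
  by rewrite !big_cons IH; congr pair; rewrite addr0.
have E (x y : Dhat R) : x.1 = y.1 -> x.2 = y.2 -> x = y by case: x y => x1 x2 [y1 y2] /= -> ->.
apply: E; first by rewrite -[RHS]/(_ + c *: 0) scaler0 addr0.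
by rewrite -[RHS]/(0 + c * 1) mulr1 add0r.
Qed.

Lemma Dalg_split N (d : Dalg R) : (forall k, (N < `|k|)%N -> d k = 0) ->
  d = \sum_(r <- irange N) tD r (d r).
Proof.
move=> dN; apply: Dalg_ext => k; rewrite dirsum_sumE.
have [kN|kN] := leqP `|k| N; last first.
  rewrite dN // big_seq big1 // => r; rewrite mem_irange tDE => rN.
  by case: eqP => // kr; move: kN; rewrite kr ltnNge rN.
rewrite (eq_bigr (fun r => (r == k)%:R *: d k)) ?sum_irange_pred1 // => r _.
by rewrite tDE eq_sym; case: eqP => [->|_]; rewrite ?scale1r ?scale0r.
Qed.

Lemma sum_commutator (A A' : int -> {linear F -> F}) s (ca cb : C) (v : F) :
  \sum_(r <- s) \sum_(t <- s) (A r (A' t v) - A' t (A r v)) =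
  \sum_(r <- s) A r (\sum_(t <- s) A' t v + cb *: v)
    + ca *: (\sum_(t <- s) A' t v + cb *: v)
  - (\sum_(t <- s) A' t (\sum_(r <- s) A r v + ca *: v)
    + cb *: (\sum_(r <- s) A r v + ca *: v)).
Proof.
have E (P Q : int -> {linear F -> F}) c : \sum_(r <- s) P r (\sum_(t <- s) Q t v + c *: v) =
    \sum_(r <- s) \sum_(t <- s) P r (Q t v) + c *: \sum_(r <- s) P r v.
  rewrite scaler_sumr -big_split; apply: eq_bigr => r _ /=.
  by rewrite linearD linearZ linear_sum.
under eq_bigr => r _ do rewrite sumrB.
rewrite sumrB !E !scalerDr [cb *: (ca *: v)]scaler_swap.
rewrite [\sum_(r <- s) \sum_(t <- s) A' r (A t v)]exchange_big /=.
by rewrite !opprD !addrA [RHS](ACl (1*5*2*7*3*6*4*8)%AC) /= !addrK.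
Qed.

Lemma act_split N (a : Dhat R) v : (forall k, (N < `|k|)%N -> a.1 k = 0) ->
  act a v = \sum_(r <- irange N) act (tDhat r (a.1 r)) v + (a.2 * l%:R) *: v.
Proof.
move=> aN; rewrite {1}(surjective_pairing a) {1}(Dalg_split aN) pair_sumE.
by rewrite -[X in X + _]scale1r fock_Dact_lin act_sum act_central scale1r.
Qed.

Lemma act_lie (a b : Dhat R) v : Dplus a -> Dplus b ->
  act (lie a b) v = act a (act b v) - act b (act a v).
Proof.
move=> pa pb; have [N1 h1] := Dalg_support a.1; have [N2 h2] := Dalg_support b.1.
set N := (N1 + N2)%N.
have aN k : (N < `|k|)%N -> a.1 k = 0 by move=> h; apply: h1; lia.
have bN k : (N < `|k|)%N -> b.1 k = 0 by move=> h; apply: h2; lia.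
pose h r s := shiftp s%:~R (a.1 r) * b.1 s - a.1 r * shiftp r%:~R (b.1 s).
have td0 k : tD k (0 : {poly C}) = 0.
  by apply: Dalg_ext => j; rewrite tDE; case: eqP.
have sh0 z : shiftp z (0 : {poly C}) = 0 by rewrite /shiftp comp_poly0.
have lieE : lie a b = \sum_(r <- irange N) \sum_(s <- irange N) tDhat (r + s) (h r s)
    + (\sum_(r <- irange N) \sum_(s <- irange N) Psi_hom r (a.1 r) s (b.1 s)) *: Ccentral R.
  have -> : lie a b = (\sum_(r <- irange N) \sum_(s <- irange N) tD (r + s) (h r s),
     \sum_(r <- irange N) \sum_(s <- irange N) Psi_hom r (a.1 r) s (b.1 s)).
    rewrite /lie /lie_D /Psi_D; congr pair.
      rewrite (@fsum_irange _ _ _ N) => [|r rN].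
        apply: eq_bigr => r _; apply: fsum_irange => s sN.
        by rewrite bN // sh0 !mulr0 subr0 td0.
      rewrite (@fsum_irange _ _ _ 0) => [|s _]; last by rewrite aN // sh0 !mul0r subr0 td0.
      by rewrite big1 // => s _; rewrite aN // sh0 !mul0r subr0 td0.
    have P0l m g : Psi0 m (0 : {poly C}) g = 0.
      by rewrite /Psi0 big1 // => i _; rewrite horner0 mul0r.
    have P0r m g : Psi0 m g (0 : {poly C}) = 0.
      by rewrite /Psi0 big1 // => i _; rewrite horner0 mulr0.
    rewrite (@fsum_irange _ C^o _ N) => [|r rN].
      apply: eq_bigr => r _; apply: (@fsum_irange _ C^o) => s sN.
      by rewrite bN // /Psi_hom P0l P0r oppr0 !if_same.
    rewrite (@fsum_irange _ C^o _ 0) => [|s _].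
      by rewrite big1 // => s _; rewrite aN // /Psi_hom P0l P0r oppr0 !if_same.
    by rewrite aN // /Psi_hom P0l P0r oppr0 !if_same.
  rewrite pair_sumE; congr (_ + _); apply: eq_bigr => r _.
  elim: (irange N) => [|s t IH]; first by rewrite !big_nil.
  by rewrite !big_cons -IH; congr pair; rewrite addr0.
rewrite lieE -[X in X + _]scale1r fock_Dact_lin scale1r act_sum act_central.
rewrite mulr_suml scaler_suml -big_split /=.
transitivity (\sum_(r <- irange N) \sum_(s <- irange N)
   (act (tDhat r (a.1 r)) (act (tDhat s (b.1 s)) v)
    - act (tDhat s (b.1 s)) (act (tDhat r (a.1 r)) v))).
  apply: eq_bigr => r _; rewrite act_sum mulr_suml scaler_suml -big_split /=.
  by apply: eq_bigr => s _; apply: act_bracket; exact: Dplus_sym.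
rewrite !(act_split _ aN) !(act_split _ bN).
exact: (sum_commutator (fun r => act (tDhat r (a.1 r))) (fun s => act (tDhat s (b.1 s)))).
Qed.

Lemma fock_Dact_action : is_Dplus_action (@fock_Dact R l F).
Proof.
split=> [a _|c a b v _ _|a b v pa pb]; [exact: fock_Dact_linear|exact: fock_Dact_lin|].
exact: act_lie.
Qed.

Lemma Dplus0 : Dplus (0 : Dhat R).
Proof. by exists 0, (fun _ => 0), (fun _ => 0); split=> [[] //|]; rewrite big_ord0. Qed.

Lemma homogeneous_tDhat k (f : {poly C}) : homogeneous k (tDhat k f).
Proof. by split=> // r rk; rewrite -[LHS]/(tD k f r) tDE (negbTE rk). Qed.

(* An odd polynomial interpolating 1 at the point of [nB p q], -1 at that of [nB q p],
   and 0 at all the others that matter isolates a single quadratic operator. *)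
Lemma Dplus_dense p q M : exists a : Dhat R, [/\ Dplus a, homogeneous (p + q + 1) a
  & forall v : F, bounded M v -> act a v = nB p q v].
Proof.
have n2 : (2 : C) != 0 by rewrite pnatr_eq0.
have [->|pq] := eqVneq p q.
  exists 0; split=> [||v _]; [exact: Dplus0|by split|].
  have -> : nB q q v = 0.
    have /eqP := nB_swap q q v; rewrite -addr_eq0 -mulr2n -scaler_nat.
    by rewrite scaler_eq0 (negbTE n2) => /eqP.
  by have := act_central 0 v; rewrite scale0r mul0r scale0r.
(* For [j] outside [[-N, N]] one of the indices [k - j] and [j - 1] is at least [M], so that term
   kills [v] and the polynomial has to vanish at finitely many points only. *)
pose k := p + q + 1; pose N := (M + `|k| + `|p| + `|q| + 1)%N.
pose pt (j : int) : C := - j%:~R + (k%:~R + 1) / 2.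
pose J := [seq j <- irange N | (j != q + 1) && (j != p + 1)].
pose g0 : {poly C} := 'X * \prod_(j <- J) ('X ^+ 2 - (pt j ^+ 2)%:P).
have ptE : pt (q + 1) = (p - q)%:~R / 2 by rewrite /pt /k !intrD rmorphN /=; field.
have pt' j : pt (k + 1 - j) = - pt j by rewrite /pt !intrD rmorphN /=; field.
have g0E z : g0.[z] = z * \prod_(j <- J) (z ^+ 2 - pt j ^+ 2).
  by rewrite /g0 hornerM hornerX horner_prod; congr (_ * _); apply: eq_bigr => j _; rewrite !hornerE.
have g0odd z : g0.[- z] = - g0.[z] by rewrite !g0E mulNr; congr (- (_ * _)); apply: eq_bigr => j _; rewrite sqrrN.
have pt0 : g0.[pt (q + 1)] != 0.
  rewrite g0E mulf_neq0 //.
    by rewrite ptE mulf_neq0 ?invr_eq0 // intr_eq0 subr_eq0.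
  rewrite prodf_seq_neq0; apply/allP => j; rewrite mem_filter => /andP[/andP[j1 j2] _] /=.
  rewrite subr_eq0 eqf_sqr -pt' negb_or; apply/andP; split; apply/eqP => /(congr1 (fun z => - z + (k%:~R + 1) / 2)).
    by rewrite /pt !opprD !opprK !subrK => /intr_inj e; rewrite e eqxx in j1.
  rewrite /pt !opprD !opprK !subrK => /intr_inj e; move: j2; rewrite (_ : j = p + 1) ?eqxx //.
  by move: e; rewrite /k; lia.
pose g := g0.[pt (q + 1)]^-1 *: g0.
have gE z : g.[z] = g0.[pt (q + 1)]^-1 * g0.[z] by rewrite hornerZ.
pose f := shiftp ((k%:~R + 1) / 2) g.
have fE (j : int) : f.[- j%:~R] = g.[pt j] by rewrite /f /shiftp horner_comp !hornerE.
exists (tDhat k f); split=> [||v bv]; last 1 first.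
- rewrite (@act_tDhat _ _ _ N M) //; last by rewrite /N; lia.
  rewrite (eq_bigr (fun j => (j == q + 1)%:R *: nB p q v + (j == p + 1)%:R *: nB p q v)).
    rewrite big_split /= !sum_irange_pred1; [|rewrite /N; lia|rewrite /N; lia].
    by rewrite -mulr2n -[X in _ *: X]scaler_nat scalerA mulVf ?scale1r.
  move=> j _; have [->|jq] := eqVneq j (q + 1).
    rewrite fE gE mulVf // addrK; have -> : k - (q + 1) = p by rewrite /k; lia.
    by have -> : (q + 1 == p + 1) = false; [apply/eqP; move/eqP: pq; lia|rewrite scale0r addr0].
  rewrite scale0r add0r; have [->|jp] := eqVneq j (p + 1).
    have -> : p + 1 = k + 1 - (q + 1) by rewrite /k; lia.
    rewrite fE pt' gE g0odd mulrN mulVf // nB_swap scaleN1r opprK scale1r.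
    by congr (nB _ _ v); rewrite /k; lia.
  rewrite scale0r fE gE (g0E (pt j)); have [jN|jN] := boolP (j \in irange N); last first.
    rewrite (nB_bounded bv) ?scaler0 //; move: jN; rewrite mem_irange /N; lia.
  rewrite [X in _ * (_ * X)](_ : _ = 0) ?mulr0 ?scale0r //.
  apply/eqP; rewrite prodf_seq_eq0; apply/hasP; exists j; last by rewrite /= subrr.
  by rewrite mem_filter jq jp.
- exists 1, (fun=> 1), (fun=> tDhat k f); split; last by rewrite big_ord1 scale1r.
  move=> _; right; exists k, g; split=> //; rewrite /odd_polynomial.
  rewrite /g comp_polyZ /g0 comp_polyM comp_polyX mulNr scalerN; congr (- (_ *: (_ * _))).
  rewrite rmorph_prod; apply: eq_bigr => j _ /=.
  by rewrite comp_polyB comp_polyC rmorphXn /= comp_polyX sqrrN.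
- exact: homogeneous_tDhat.
Qed.

End DplusAction.
(** * The orthogonal group *)

Section Words.
Variables (R : realType) (l : nat) (F : fock_space R l).
Local Notation C := R[i].
Local Notation vac := (vac F).
Local Notation form := (@form R l F).
Implicit Types (w s : seq (mode l)) (x y : mode l).

Definition mono w : F := foldr (@fpsi R l F) vac w.
Definition creations w := all (fun x : mode l => x.2 < 0) w.

Lemma creation_star x y : x.2 < 0 -> y.2 < 0 -> (y == star x) = false.
Proof.
by move=> x0 y0; apply/eqP => e; move: y0; rewrite e bar_lt0 leNgt x0.
Qed.

Lemma creation_anti x y v : x.2 < 0 -> y.2 < 0 -> fpsi x (fpsi y v) = - fpsi y (fpsi x v) :> F.
Proof. by move=> x0 y0; rewrite fpsiC creation_star // scale0r sub0r. Qed.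

Lemma creation_sq x v : x.2 < 0 -> fpsi x (fpsi x v) = 0 :> F.
Proof.
move=> x0; have /eqP := creation_anti v x0 x0.
by rewrite -addr_eq0 -mulr2n -scaler_nat scaler_eq0 pnatr_eq0 /= => /eqP.
Qed.

Lemma creation_word x w v : x.2 < 0 -> creations w ->
  fpsi x (foldr (@fpsi R l F) v w) = (-1) ^+ size w *: foldr (@fpsi R l F) (fpsi x v) w.
Proof.
move=> x0; elim: w => /= [|y w IH /andP[y0 cw]]; first by rewrite scale1r.
by rewrite creation_anti // IH // linearZ /= exprS mulN1r scaleNr.
Qed.

Lemma mono_cat w s : mono (w ++ s) = foldr (@fpsi R l F) (mono s) w.
Proof. by rewrite /mono foldr_cat. Qed.

Lemma mono_swap s1 s2 s3 x y : creations (s1 ++ x :: s2 ++ y :: s3) ->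
  mono (s1 ++ x :: s2 ++ y :: s3) = - mono (s1 ++ y :: s2 ++ x :: s3).
Proof.
rewrite /creations all_cat /= all_cat /= => /and4P[_ x0 c2 /andP[y0 c3]].
rewrite ![mono (s1 ++ _)]mono_cat.
have -> : mono (x :: s2 ++ y :: s3) = - mono (y :: s2 ++ x :: s3).
  rewrite -[LHS]/(fpsi x (mono (s2 ++ _))) -[mono (y :: _)]/(fpsi y (mono (s2 ++ _))).
  rewrite !mono_cat (creation_word (mono (y :: s3)) x0 c2) (creation_word (mono (x :: s3)) y0 c2).
  rewrite -[mono (y :: s3)]/(fpsi y (mono s3)) creation_anti //.
  rewrite -scalerN; congr (_ *: _).
  elim: (s2) => //= z s ->; exact: linearN.
by elim: s1 => //= z s ->; rewrite linearN.
Qed.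

Lemma mono_mem x w : creations w -> x \in w -> fpsi x (mono w) = 0.
Proof.
elim: w => //= y w IH /andP[y0 cw]; rewrite inE => /orP[/eqP ->|xw].
  by rewrite -/(mono w) creation_sq.
have x0 : x.2 < 0 by apply: (allP cw).
by rewrite creation_anti // -/(mono w) IH // linear0 oppr0.
Qed.

Lemma mono_nuniq w : creations w -> ~~ uniq w -> mono w = 0.
Proof.
elim: w => //= y w IH /andP[y0 cw]; rewrite negb_and negbK => /orP[yw|nu].
  exact: mono_mem.
by rewrite -/(mono w) IH // linear0.
Qed.

Lemma mono_annih x w : creations w -> 0 <= x.2 -> star x \notin w -> fpsi x (mono w) = 0.
Proof.
move=> + x0; elim: w => /= [_ _|y w IH /andP[y0 cw]]; first exact: fpsi_vac.
rewrite inE negb_or eq_sym => /andP[/negbTE yx xw].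
by rewrite fpsiC yx scale0r sub0r -/(mono w) IH // linear0 oppr0.
Qed.

Lemma mono_unpop x w : creations w -> x.2 < 0 -> x \notin w ->
  fpsi (star x) (fpsi x (mono w)) = mono w.
Proof.
move=> cw x0 xw; rewrite fpsiC starK eqxx scale1r.
have h : fpsi (star x) (mono w) = 0 by apply: mono_annih; rewrite ?starK // /star /= bar_ge0.
by rewrite h linear0 subr0.
Qed.

Lemma mono_pull x w : creations w -> x \in w ->
  mono w = (-1) ^+ index x w *: fpsi x (mono (rem x w)).
Proof.
move=> cw xw; have x0 : x.2 < 0 by apply: (allP cw).
have xi := xw; rewrite -index_mem in xi.
have wE : w = take (index x w) w ++ x :: drop (index x w).+1 w.
  by rewrite -[LHS](cat_take_drop (index x w)) (drop_nth x) // nth_index.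
have -> : rem x w = take (index x w) w ++ drop (index x w).+1 w by rewrite remE.
have ct : creations (take (index x w) w).
  by apply/allP => y /mem_take; apply: (allP cw).
rewrite {1}wE !mono_cat /= creation_word // size_takel ?(ltnW xi) //.
by rewrite scalerA -exprD -signr_odd oddD addbb scale1r.
Qed.

Lemma form_mono w : creations w -> uniq w -> form (mono w) (mono w) = form vac vac.
Proof.
elim: w => //= x w IH /andP[x0 cw] /andP[xw uw].
by rewrite form_psi -/(mono w) mono_unpop // IH.
Qed.

Lemma form_mono_perm w s : creations w -> creations s ->
  form (mono w) (mono s) != 0 -> perm_eq w s.
Proof.
elim: w s => [|x w IH] s /=.
  move=> _; case: s => //= y s /andP[y0 _].
  by rewrite formC form_psi fpsi_vac ?bar_ge0 // form0r rmorph0 eqxx.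
move=> /andP[x0 cw] cs; rewrite form_psi -/(mono w).
have [xs|xs] := boolP (x \in s); last first.
  have h : fpsi (star x) (mono s) = 0 by apply: mono_annih; rewrite ?starK // /star /= bar_ge0.
  by rewrite h form0r eqxx.
have [us|us] := boolP (uniq s); last by rewrite (mono_nuniq cs us) linear0 form0r eqxx.
have cr : creations (rem x s) by apply/allP => y /mem_rem; apply: (allP cs).
rewrite (mono_pull cs xs) linearZ /= mono_unpop ?mem_rem_uniqF // formZr mulf_eq0 negb_or.
move=> /andP[_ /(IH _ cw cr)] p; apply: (perm_trans _ (_ : perm_eq (x :: rem x s) s)).
  by rewrite perm_cons.
by rewrite perm_sym perm_to_rem.
Qed.

Section Indexed.
Variable T : finType.
Implicit Types (f : T -> mode l).

Lemma mono_tperm f (x y : T) : (forall z, (f z).2 < 0) -> x != y ->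
  mono [seq f (tperm x y z) | z <- enum T] = - mono [seq f z | z <- enum T].
Proof.
move=> f0; wlog xy : x y / (index x (enum T) < index y (enum T))%N.
  move=> H xy; have [h|h|h] := ltngtP (index x (enum T)) (index y (enum T)).
  - exact: (H x y h xy).
  - by rewrite tpermC; apply: (H y x h); rewrite eq_sym.
  - by move: xy; rewrite -(nth_index x (mem_enum T x)) h nth_index ?mem_enum // eqxx.
move=> _; have [p1 [p2 p2E]] : exists p1 p2, enum T = p1 ++ x :: p2.
  by case/splitPr: (mem_enum T x : x \in enum T) => p1 p2; exists p1, p2.
have ye : y \in p2.
  have := mem_enum T y; rewrite p2E mem_cat inE => /or3P[yp|/eqP xy'|//].
    have := enum_uniq T; rewrite p2E cat_uniq => /and3P[_ /hasPn xp _].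
    move: xy; rewrite p2E !index_cat yp (negbTE (xp x _)) ?inE ?eqxx //=.
    have : (index y p1 < size p1)%N by rewrite index_mem.
    by rewrite eqxx; lia.
  by move: xy; rewrite xy' ltnn.
have [q1 [q2 q2E]] : exists q1 q2, p2 = q1 ++ y :: q2.
  by case/splitPr: ye => q1 q2; exists q1, q2.
have e : enum T = p1 ++ x :: q1 ++ y :: q2 by rewrite p2E q2E.
have := enum_uniq T; rewrite e cat_uniq /= cat_uniq /= !mem_cat !inE !negb_or.
move=> /and5P[_ /andP[xp1 /hasPn hp] /and3P[xq1 xNy xq2] _ /and3P[/andP[yq1 /hasPn hq] yq2 _]].
have fixl (s : seq T) : x \notin s -> y \notin s ->
    [seq f (tperm x y z) | z <- s] = [seq f z | z <- s].
  move=> xs ys; apply/eq_in_map => z zs; rewrite tpermD //.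
    by apply: contraNneq xs => ->.
  by apply: contraNneq ys => ->.
have yp1 : y \notin p1 by apply: hp; rewrite mem_cat inE eqxx !orbT.
rewrite !map_cat /= !map_cat /= !fixl // tpermL tpermR mono_swap //.
have cw (s : seq T) : all (fun x : mode l => x.2 < 0) [seq f z | z <- s].
  by rewrite all_map; apply/allP => z _; exact: f0.
by rewrite /creations !all_cat /= !all_cat /= !cw !f0.
Qed.

Lemma mono_perm f (t : {perm T}) : (forall z, (f z).2 < 0) ->
  mono [seq f (t z) | z <- enum T] = (-1) ^+ t *: mono [seq f z | z <- enum T].
Proof.
have [ts -> dts] := prod_tpermP t.
elim: ts dts f => [_|[x y] ts IH /= /andP[xy dts]] f f0.
  rewrite big_nil odd_perm1 scale1r; congr mono; apply: eq_map => z; by rewrite perm1.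
rewrite big_cons odd_permM odd_tperm xy addTb signrN scaleNr -scalerN.
set u := (\prod_(_ <- ts) _)%g.
have -> : [seq f ((tperm x y * u)%g z) | z <- enum T] =
    [seq (f \o u) (tperm x y z) | z <- enum T] by apply: eq_map => z /=; rewrite permM.
transitivity (- mono [seq f (u z) | z <- enum T]); first by apply: (@mono_tperm (f \o u)) => // z; exact: f0.
by rewrite IH // scalerN.
Qed.

End Indexed.
End Words.
Section OrthogonalGroup.
Variables (R : realType) (l : nat).
Local Notation C := R[i].
Local Notation J := (formJ R l).
Implicit Types g h : 'M[C]_(l + l).

Lemma O2l_col g a a' : O2l g -> \sum_b g b a * g (dix b) a' = (a' == dix a)%:R.
Proof.
move=> /eqP /(congr1 (fun M : 'M_(l + l) => M a a')); rewrite formJE mxE => <-.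
rewrite [RHS](reindex_inj (inv_inj (@dixK l))) /=; apply: eq_bigr => b _; congr (_ * _).
rewrite mxE (bigD1 b) //= big1 => [|c cb]; first by rewrite formJE mxE eqxx mulr1 addr0.
by rewrite formJE (inj_eq (inv_inj (@dixK l))) eq_sym (negbTE cb) mulr0.
Qed.

Lemma formJ_sq : J *m J = 1%:M.
Proof.
apply/matrixP => a b; rewrite !mxE (bigD1 (dix a)) //= big1 => [|c ca].
  by rewrite !formJE eqxx dixK mul1r addr0 eq_sym.
by rewrite formJE (negbTE ca) mul0r.
Qed.

Lemma O2l_tr g : O2l g -> O2l g^T.
Proof.
move=> /eqP og; apply/eqP; rewrite trmxK.
have : (J *m g^T *m J) *m g = 1%:M by rewrite -!mulmxA [g^T *m (J *m g)]mulmxA og formJ_sq.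
move/mulmx1C => e; rewrite -[LHS]mulmx1 -formJ_sq mulmxA -[RHS]mul1mx -e.
by rewrite !mulmxA.
Qed.

Lemma O2l_row g b b' : O2l g -> \sum_a g b a * g b' (dix a) = (b' == dix b)%:R.
Proof.
move=> /O2l_tr /O2l_col <-; apply: eq_bigr => a _; by rewrite !mxE.
Qed.

Lemma O2l_mul g h : O2l g -> O2l h -> O2l (g *m h).
Proof.
move=> /eqP og /eqP oh; apply/eqP.
by rewrite trmx_mul -!mulmxA [J *m _]mulmxA [g^T *m _]mulmxA [g^T *m _]mulmxA og mulmxA oh.
Qed.

Variable F : fock_space R l.
Local Notation vac := (vac F).

Lemma fock_linear_ext (f h : {linear F -> F}) (ph : mode l -> F -> F) : f vac = h vac ->
  (forall x v, f (fpsi x v) = ph x (f v)) -> (forall x v, h (fpsi x v) = ph x (h v)) -> f =1 h.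
Proof.
move=> fh hf hh; apply: (fock_ind (P := fun v => f v = h v)) => // [|x v].
  by split=> [|c u v]; rewrite ?linear0 // => hu hv; rewrite !linearP hu hv.
by move=> e; rewrite hf hh e.
Qed.

Definition rotated g (x : mode l) (v : F) : F := \sum_b g b x.1 *: fpsi (b, x.2) v.

Lemma rotated_linear g x : linear (rotated g x).
Proof.
move=> c u v; rewrite /rotated scaler_sumr -big_split; apply: eq_bigr => b _ /=.
by rewrite linearP scalerDr scaler_swap.
Qed.
HB.instance Definition _ g x := GRing.isLinear.Build C F F *:%R (rotated g x) (rotated_linear g x).

(** The identity [g^T J g = J] says that the rotated modes satisfy the same Clifford relations, so
    the universal property applies. *)
Lemma rotation_exists g : O2l g -> exists h : {linear F -> F},
  h vac = vac /\ forall x v, h (fpsi x v) = rotated g x (h v).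
Proof.
move=> og; have [||||||h [hv hp _]] :=
  @fock_universal _ _ F F (fun=> True) (rotated g) vac => //; last by exists h.
- by move=> x; exact: rotated_linear.
- move=> x y v _; rewrite /rotated.
  under eq_bigr => b _ do rewrite linear_sum scaler_sumr.
  under [X in _ + X]eq_bigr => b _ do rewrite linear_sum scaler_sumr.
  rewrite [X in _ + X]exchange_big -big_split /=.
  transitivity (\sum_b \sum_(c | c == dix b) (g b x.1 * g c y.1 * (y.2 == bar x.2)%:R) *: v).
    apply: eq_bigr => b _; rewrite -big_split [RHS]big_mkcond; apply: eq_bigr => c _ /=.
    rewrite !linearZ /= [g c y.1 *: _]scaler_swap -!scalerDr fpsi_ac star_pair scalerA.
    by case: (c == dix b); rewrite ?scale0r ?scaler0 //= scalerA.
  under eq_bigr => b _ do rewrite big_pred1_eq.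
  rewrite -scaler_suml -mulr_suml O2l_col // -natrM mulnb.
  by case: x y => a m [a' n].
- by move=> x x0; rewrite /rotated big1 // => b _; rewrite fpsi_vac // scaler0.
Qed.

Lemma fock_Oact_exists : exists rho : 'M[C]_(l + l) -> F -> F, is_fock_Oact rho.
Proof.
have /boolp.choice [rho hr] : forall g, exists h : {linear F -> F},
    O2l g -> h vac = vac /\ forall x v, h (fpsi x v) = rotated g x (h v).
  move=> g; have [/rotation_exists [h hh]|ng] := boolP (O2l g); first by exists h.
  by exists (idfun : {linear F -> F}).
exists (fun g => rho g).
split; [split=> [g og|v|g h v og oh]|split=> [g og|g a n v og]].
- by move=> c u v; rewrite linearP.
- have o1 : O2l (1%:M : 'M[C]_(l + l)) by apply/eqP; rewrite trmx1 mul1mx mulmx1.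
  have [h0 hp] := hr _ o1.
  apply: (@fock_linear_ext (rho 1%:M) (idfun : {linear F -> F}) (@fpsi R l F)) => // x u.
  rewrite hp /rotated (bigD1 x.1) //= big1 => [|b bx].
    by rewrite mxE eqxx scale1r addr0 -surjective_pairing.
  by rewrite mxE (negbTE bx) scale0r.
- have [[g0 gp] [h0 hp] [gh0 ghp]] := And3 (hr _ og) (hr _ oh) (hr _ (O2l_mul og oh)).
  apply: (@fock_linear_ext (rho (g *m h)) (rho g \o rho h : {linear F -> F}) (rotated (g *m h))) => //=.
    by rewrite gh0 h0 g0.
  move=> x u; rewrite hp /rotated linear_sum.
  under eq_bigr => b _ do rewrite linearZ /= gp /rotated scaler_sumr.
  rewrite exchange_big /=; apply: eq_bigr => c _.
  by rewrite mxE scaler_suml; apply: eq_bigr => b _; rewrite scalerA mulrC.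
- by have [h0 _] := hr _ og.
- by have [_ hp] := hr _ og; exact: (hp (a, n)).
Qed.

Section Commute.
Variable rho : 'M[C]_(l + l) -> F -> F.
Hypothesis Hrho : is_fock_Oact rho.

Lemma rho_linear g : O2l g -> linear (rho g).
Proof. by case: Hrho => [[h _ _] _] /h. Qed.

Lemma rho_vac g : O2l g -> rho g vac = vac.
Proof. by case: Hrho => [_ [h _]] /h. Qed.

Lemma rho_fpsi g x v : O2l g -> rho g (fpsi x v) = rotated g x (rho g v).
Proof. by case: Hrho => [_ [_ h]] og; rewrite /fpsi h. Qed.

(** The species are contracted along the tensor [sum_a v_a (x) v_(-a)], which [g] fixes because its
    transpose is orthogonal as well. *)
Lemma rho_B g p q v : O2l g -> rho g (B p q v) = B p q (rho g v).
Proof.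
move=> og; have rl := mk_linear (rho_linear og).
rewrite /B -[rho g]/(mk_linear (rho_linear og) : _ -> _) linear_sum /=.
under eq_bigr => a _ do rewrite !rho_fpsi // /rotated /=.
under eq_bigr => a _.
  under eq_bigr => b _ do rewrite linear_sum scaler_sumr.
  over.
rewrite exchange_big /=; apply: eq_bigr => b _; rewrite exchange_big /=.
rewrite (bigD1 (dix b)) //= [X in _ + X]big1 ?addr0 => [|c cb].
  under eq_bigr => a _ do rewrite linearZ /= scalerA.
  by rewrite -scaler_suml O2l_row // eqxx scale1r.
under eq_bigr => a _ do rewrite linearZ /= scalerA.
by rewrite -scaler_suml O2l_row // (negbTE cb) scale0r.
Qed.

Lemma rho_act g a v : O2l g -> rho g (fock_Dact a v) = fock_Dact a (rho g v).
Proof.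
move=> og; have [N1 h1] := fock_Dact_cut a v; have [N2 h2] := fock_Dact_cut a (rho g v).
rewrite (h1 (N1 + N2)%N) ?leq_addr // (h2 (N1 + N2)%N) ?leq_addl // /Dact_cut.
pose r := mk_linear (rho_linear og).
rewrite -[LHS]/(r _) linearD linearZ linear_sum; congr (_ + _); apply: eq_bigr => k _.
rewrite linearZ linear_sum; congr (_ *: _); apply: eq_bigr => j _.
by rewrite linearZ /nB linearB linearZ /= rho_B.
Qed.

Lemma rho_mono (T : finType) g (a : T -> 'I_(l + l)) (n : T -> int) : O2l g ->
  rho g (mono F [seq (a x, n x) | x <- enum T]) =
  \sum_(b : {ffun T -> 'I_(l + l)}) (\prod_x g (b x) (a x)) *:
     mono F [seq (b x, n x) | x <- enum T].
Proof.
move=> og; pose r := mk_linear (rho_linear og).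
(* Slots outside [s] carry a Kronecker delta, so that the sum ranges over all functions on [T] at
   every stage of the induction. *)
have E (s : seq T) : uniq s -> rho g (mono F [seq (a x, n x) | x <- s]) =
    \sum_(b : {ffun T -> 'I_(l + l)})
      (\prod_x (if x \in s then g (b x) (a x) else (b x == a x)%:R)) *:
         mono F [seq (b x, n x) | x <- s].
  elim: s => [_|x s IH /= /andP[xs us]].
    rewrite /= rho_vac // (bigD1 [ffun x => a x]) //= big1 => [|x _]; last by rewrite ffunE eqxx.
    rewrite scale1r big1 ?addr0 // => b ba.
    have [y ya] : exists y, b y != a y.
      apply/existsP; rewrite -negb_forall; apply: contra ba => /forallP h.
      by apply/eqP/ffunP => z; rewrite ffunE; apply/eqP.
    by rewrite (bigD1 y) //= (negbTE ya) mul0r scale0r.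
  rewrite rho_fpsi // -/(mono F [seq (a y, n y) | y <- s]) IH // /rotated /=.
  under eq_bigr => i _ do rewrite linear_sum scaler_sumr.
  pose upd (b : {ffun T -> 'I_(l + l)}) i := [ffun y => if y == x then i else b y].
  rewrite [RHS](partition_big (fun b : {ffun T -> 'I_(l + l)} => b x) xpredT) //=.
  apply: eq_bigr => i _.
  rewrite (bigID (fun b : {ffun T -> 'I_(l + l)} => b x == a x)) /= [X in _ + X]big1 ?addr0; last first.
    move=> b bx; rewrite (bigD1 x) //= (negbTE xs) (negbTE bx) mul0r !scale0r.
    by rewrite linear0 scaler0.
  rewrite [RHS](reindex_onto (upd^~ i) (upd^~ (a x))) /=; last first.
    by move=> b /eqP bx; apply/ffunP => y; rewrite !ffunE; case: eqP => // ->.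
  apply: eq_big => [b|b /eqP bx].
    have -> : upd b i x = i by rewrite ffunE eqxx.
    rewrite eqxx /=; apply/eqP/eqP => [bx|<-].
      by apply/ffunP => y; rewrite !ffunE; case: eqP => // ->.
    by rewrite !ffunE eqxx.
  rewrite linearZ /= scalerA; congr (_ *: _).
    rewrite (bigD1 x) //= (negbTE xs) bx eqxx mul1r [RHS](bigD1 x) //= inE eqxx ffunE eqxx.
    congr (_ * _); apply: eq_bigr => y yx; rewrite inE (negbTE yx) ffunE (negbTE yx) /=.
    by case: ifP.
  rewrite /= ffunE eqxx; congr (fpsi _ (mono F _)); apply/eq_in_map => y ys.
  by rewrite ffunE; case: eqP => // yx; rewrite -yx ys in xs.
rewrite E ?enum_uniq //; apply: eq_bigr => b _; congr (_ *: _).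
by apply: eq_bigr => x _; rewrite mem_enum.
Qed.
End Commute.
End OrthogonalGroup.
(** * Highest weight vectors *)

Section Energy.
Variables (R : realType) (l : nat) (F : fock_space R l).
Local Notation C := R[i].
Local Notation vac := (vac F).
Local Notation form := (@form R l F).
Local Notation B := (@B R l F).
Local Notation mono := (@mono R l F).

(* Twice the energy of the mode. *)
Definition energy (x : mode l) : int := - (x.2 + x.2 + 1).
Definition word_energy (w : seq (mode l)) : int := \sum_(x <- w) energy x.

Lemma word_energy_ge w : creations w -> (size w)%:Z <= word_energy w.
Proof.
elim: w => [|x w IH] /=; first by rewrite /word_energy big_nil.
move=> /andP[x0 /IH]; rewrite /word_energy big_cons; move: (\sum_(_ <- _) _) => e.
by rewrite /energy; lia.
Qed.

Inductive below (N : int) : F -> Prop :=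
| below0 : below N 0
| below_lin c u v : below N u -> below N v -> below N (c *: u + v)
| below_mono w : creations w -> word_energy w <= N -> below N (mono w).

Lemma below_subspace N : is_subspace (below N).
Proof. by split; [exact: below0 | exact: below_lin]. Qed.

Lemma belowS N M v : N <= M -> below N v -> below M v.
Proof.
move=> NM; elim=> [|c u u' _ bu _ bu'|w cw wN]; [exact: below0|exact: below_lin|].
by apply: below_mono => //; apply: le_trans NM.
Qed.

Lemma below_neg N v : N < 0 -> below N v -> v = 0.
Proof.
move=> N0; elim=> [//|c u u' _ -> _ ->|w cw wN]; first by rewrite scaler0 addr0.
have := word_energy_ge cw; lia.
Qed.

Lemma below_creation N x v : x.2 < 0 -> below N v -> below (N + energy x) (fpsi x v).
Proof.
move=> x0; elim=> [|c u u' _ bu _ bu'|w cw wN].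
- by rewrite linear0; exact: below0.
- by rewrite linearP; exact: below_lin.
- rewrite -[fpsi _ _]/(mono (x :: w)); apply: below_mono; rewrite /= ?x0 //.
  by rewrite /word_energy big_cons -/(word_energy w); lia.
Qed.

Lemma below_fpsi N x v : below N v -> below (N + energy x) (fpsi x v).
Proof.
have [x0|x0] := ltP x.2 0; first exact: below_creation.
elim=> [|c u u' _ bu _ bu'|w + +].
- by rewrite linear0; exact: below0.
- by rewrite linearP; exact: below_lin.
elim: w N => [|y w IH] N /=; first by move=> _ _; rewrite fpsi_vac //; exact: below0.
move=> /andP[y0 cw]; rewrite /word_energy big_cons -/(word_energy w) => wN.
rewrite -/(mono w) fpsiC; apply: (subB (below_subspace _)).
  have [e|_] := eqVneq y (star x); last by rewrite scale0r; exact: below0.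
  rewrite scale1r; apply: below_mono => //.
  by move: wN; rewrite e /energy /star /= /bar; lia.
have -> : N + energy x = N - energy y + energy x + energy y by lia.
by apply: below_creation => //; apply: IH => //; lia.
Qed.

Lemma below_B N p q v : below N v -> below (N - (p + q + 1) *+ 2) (B p q v).
Proof.
move=> bv; apply: (sub_sum (below_subspace _)) => a _.
have -> : N - (p + q + 1) *+ 2 = N + energy (dix a, q) + energy (a, p).
  by rewrite /energy /=; lia.
by do 2!apply: below_fpsi.
Qed.

Lemma below_exists v : exists n : nat, below n v.
Proof.
have : creation_span (@fpsi R l F) vac v.
  apply: creation_spans (fock_gen v); [by move=> x; exact: linearP| |exact: fpsi_vac].
  by move=> x y u _; exact: fpsi_ac.
elim=> [|c u u' _ [n bn] _ [m bm]|x u x0 _ [n bn]].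
- by exists 0%N; apply: (@below_mono _ [::]); rewrite // /word_energy big_nil.
- by exists (n + m)%N; apply: below_lin; [apply: belowS bn|apply: belowS bm]; lia.
- exists (n + `|energy x|)%N; apply: belowS (below_creation x0 bn); lia.
Qed.

Fixpoint words (A : seq (mode l)) (k : nat) : seq (seq (mode l)) :=
  if k is k'.+1 then [::] :: [seq x :: w | x <- A, w <- words A k'] else [:: [::]].

Lemma mem_words A k w : (size w <= k)%N -> {subset w <= A} -> w \in words A k.
Proof.
elim: k w => [|k IH] [|x w] //= wk wA; rewrite inE /=.
apply/allpairsP; exists (x, w); split=> //=; first by apply: wA; rewrite inE eqxx.
by apply: IH => // y yw; apply: wA; rewrite inE yw orbT.
Qed.

(** Every creation mode has doubled energy at least 1, so the words that occur have length at most
    [n] and mode indices in a finite range. *)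
Lemma below_span (n : nat) : exists s : seq F, forall v, below n v ->
  exists c : 'I_(size s) -> C, v = \sum_i c i *: s`_i.
Proof.
pose A := [seq (a, Negz k) | a <- enum 'I_(l + l), k <- iota 0 n.+1] : seq (mode l).
exists [seq mono w | w <- words A n] => v.
elim=> [|c u u' _ [d ->] _ [e ->]|w cw wn].
- by exists (fun=> 0); rewrite big1 // => i _; rewrite scale0r.
- exists (fun i => c * d i + e i); rewrite scaler_sumr -big_split; apply: eq_bigr => i _ /=.
  by rewrite scalerDl scalerA.
have ww : w \in words A n.
  apply: mem_words; first by rewrite -lez_nat (le_trans (word_energy_ge cw)).
  move=> x xw; have x0 : x.2 < 0 by apply: (allP cw).
  have xn : energy x <= n.
    apply: le_trans wn; rewrite /word_energy (big_rem x) //=.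
    have cr : creations (rem x w) by apply/allP => y /mem_rem; apply: (allP cw).
    by rewrite lerDl (le_trans _ (word_energy_ge cr)).
  apply/allpairsP; exists (x.1, absz (bar x.2)); split.
  - by rewrite mem_enum.
  - rewrite mem_iota /=; move: xn x0; rewrite /energy /bar; move: (x.2) => m; lia.
  - by rewrite /= -bar_pos gez0_abs ?bar_ge0 // barK -surjective_pairing.
have wi : (index w (words A n) < size [seq mono w | w <- words A n])%N by rewrite size_map index_mem.
exists (fun i => (i == Ordinal wi)%:R); rewrite (bigD1 (Ordinal wi)) //= big1 => [|i /negbTE ->].
  by rewrite eqxx scale1r addr0 (nth_map [::]) ?index_mem // nth_index.
by rewrite scale0r.
Qed.

(** Project along a maximal orthogonal family of nonzero vectors of [P]. Its length is at most
    [size s]: a longer family has a linear relation, and pairing it with each member kills every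
    coefficient. The vectors of [s] need not lie in [P]. *)
Lemma ortho_proj (P : F -> Prop) (s : seq F) : is_subspace P ->
  (forall v, P v -> exists c : 'I_(size s) -> C, v = \sum_i c i *: s`_i) ->
  forall v, exists2 p, P p & forall u, P u -> form (v - p) u = 0.
Proof.
move=> PS Ps v.
pose fam m := exists f : 'I_m -> F, (forall i, P (f i) /\ f i != 0) /\
  forall i j, i != j -> form (f i) (f j) = 0.
have fam0 : exists m, `[< fam m >].
  exists 0%N; apply/asboolP; exists (fun _ => 0); split; by case.
have famS m : `[< fam m >] -> (m <= size s)%N.
  move=> /asboolP [f [fP fo]]; rewrite leqNgt; apply/negP => sm.
  have /boolp.choice [c hc] : forall i, exists c : 'I_(size s) -> C, f i = \sum_j c j *: s`_j.
    by move=> i; apply: Ps; case: (fP i).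
  pose A : 'M[C]_(m, size s) := \matrix_(i, j) c i j.
  have : kermx A != 0.
    by rewrite -mxrank_eq0 mxrank_ker -lt0n subn_gt0 (leq_ltn_trans (rank_leq_col A)).
  case/eqP; apply/row_matrixP => k; rewrite row0; apply/rowP => i; rewrite mxE [RHS]mxE.
  set u := row k (kermx A); have uA : u *m A = 0 by rewrite -row_mul mulmx_ker row0.
  have uf : \sum_i u 0 i *: f i = 0.
    under eq_bigr => j _ do rewrite hc scaler_sumr.
    rewrite exchange_big big1 //= => j _.
    under eq_bigr => i0 _ do rewrite scalerA.
    rewrite -scaler_suml; have := congr1 (fun M : 'rV_(size s) => M 0 j) uA.
    rewrite !mxE => e; rewrite [X in X *: _](_ : _ = 0) ?scale0r // -[RHS]e.
    by apply: eq_bigr => i0 _; rewrite [A _ _]mxE.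
  have : form (\sum_i u 0 i *: f i) (f i) = 0 by rewrite uf form0l.
  rewrite form_suml (bigD1 i) //= big1 => [|j ji]; last by rewrite formZl fo // mulr0.
  rewrite addr0 formZl => /eqP; rewrite mulf_eq0 => /orP[/eqP u0|]; first by rewrite -[RHS]u0 [RHS]mxE.
  by have [_ /form_gt0 fi] := fP i; rewrite gt_eqF.
case: (ex_maxnP fam0 famS) => m /asboolP [f [fP fo]] mmax.
pose pr v := \sum_i (form v (f i) / form (f i) (f i)) *: f i.
have prP u : P (pr u) by apply: (sub_sum PS) => i _; apply: (subZ PS); case: (fP i).
have pro u i : form (u - pr u) (f i) = 0.
  rewrite formBl form_suml (bigD1 i) //= big1 => [|j ji]; last by rewrite formZl (fo j i ji) mulr0.
  have [_ /form_gt0 fi] := fP i.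
  by rewrite addr0 formZl divfK ?subrr // gt_eqF.
exists (pr v) => // u Pu; have [e|un0] := eqVneq (u - pr u) 0.
  have -> : u = pr u by apply/eqP; rewrite -subr_eq0 e.
  by rewrite form_sumr big1 // => i _; rewrite formZr pro mulr0.
have /mmax : `[< fam m.+1 >]; last by rewrite ltnn.
apply/asboolP; exists (fun i => if unlift ord_max i is Some j then f j else u - pr u).
split=> [k|k k' kk'].
  case: (unlift ord_max k) => [k'|]; first exact: fP.
  by split; [exact: (subB PS Pu (prP u)) | exact: un0].
case: (unliftP ord_max k') => [i'|] ei; case: (unliftP ord_max k) => [j'|] ej //.
- by apply: fo; apply: contra_neq kk' => ij'; rewrite ei ej ij'.
- by rewrite formC pro rmorph0.
by move: kk'; rewrite ei ej eqxx.
Qed.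

(** The indices stand for [p + 1/2] and [q + 1/2], so [B p q] has degree [p + q + 1] and the
    condition selects the positive degrees. *)
Definition singular (v : F) := forall p q, 0 <= p + q -> B p q v = 0.

Lemma singular_subspace : is_subspace singular.
Proof.
split=> [p q _|c u v su sv p q pq]; first by rewrite linear0.
by rewrite linearP /= su // sv // scaler0 addr0.
Qed.

(** Subtract from [v] its projection onto the part of [P] of energy at most [n]. A positive-degree
    [B] sends the difference [w] to lower energy, hence into [P] by induction, and the adjoint of
    [B] brings it back to that part of [P]. Orthogonality gives [form (B w) (B w) = 0], so [w] is
    singular. *)
Lemma singular_spans (P : F -> Prop) : is_subspace P ->
  (forall p q v, P v -> P (B p q v)) -> (forall v, singular v -> P v) -> forall v, P v.
Proof.
move=> PS PB Psing v; have [n] := below_exists v.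
elim/ltn_ind: n v => n IH v bv.
have [s hs] := below_span n.
have QS : is_subspace (fun u => P u /\ below n u).
  split=> [|c u u' [Pu bu] [Pu' bu']]; first by split; [exact: (sub0 PS)|exact: below0].
  by split; [exact: (subL PS)|exact: below_lin].
have [|p [Pp bp] po] := ortho_proj (s := s) QS _ v; first by move=> u [_ /hs].
have bw : below n (v - p) by apply: (subB (below_subspace n)).
have Bw a b : 0 <= a + b -> P (B a b (v - p)).
  move=> ab; have := below_B a b bw; have [neg|ge0] := ltP (n%:Z - (a + b + 1) *+ 2) 0.
    by move/(below_neg neg) => ->; exact: (sub0 PS).
  move=> h; apply: (IH `|n%:Z - (a + b + 1) *+ 2|%N); first by lia.
  by rewrite gez0_abs.
rewrite -(subrK p v); apply: (subD PS) => //; apply: Psing => a b ab.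
apply: form_eq0; rewrite form_B; apply: po; split; first by apply: PB; exact: Bw.
apply: belowS (below_B _ _ (below_B a b bw)); rewrite /bar; lia.
Qed.

End Energy.

(* Operators of positive degree lower a filtration bounded below, so every nonzero
   invariant subspace contains a nonzero vector that they kill. *)
Lemma lowest_exists (R : realType) (M : lmodType R[i]) (op : int -> int -> M -> M)
    (fil : int -> M -> Prop) (P : M -> Prop) (v : M) :
  (forall N u, N < 0 -> fil N u -> u = 0) ->
  (forall N p q u, fil N u -> fil (N - (p + q + 1) *+ 2) (op p q u)) ->
  (forall p q u, P u -> P (op p q u)) ->
  (exists n : nat, fil n v) -> P v -> v != 0 ->
  exists u, [/\ P u, u != 0 & forall p q, 0 <= p + q -> op p q u = 0].
Proof.
move=> neg low Pop [n fv]; elim/ltn_ind: n v fv => n IH v fv Pv vn0.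
have [h|h] := pselect (forall p q, 0 <= p + q -> op p q v = 0); first by exists v.
have [p [q [pq opn0]]] : exists p q, 0 <= p + q /\ op p q v != 0.
  apply: contra_notP h => h p q pq; apply/eqP/negPn/negP => o.
  by apply: h; exists p, q.
have := low _ p q _ fv; have [n0|n0] := ltP (n%:Z - (p + q + 1) *+ 2) 0.
  by move/(neg _ _ n0)/eqP; rewrite (negbTE opn0).
rewrite -(gez0_abs n0) => fo; apply: (IH _ _ _ fo) => //; first by lia.
exact: Pop.
Qed.

(** * Contents of singular vectors *)

Section Weights.
Variables (R : realType) (l : nat) (F : fock_space R l).
Local Notation C := R[i].
Local Notation vac := (vac F).
Local Notation form := (@form R l F).
Local Notation B := (@B R l F).
Local Notation mono := (@mono R l F).

(** [Negz n] is the creation index [-(n + 1/2)] and [Posz n] its opposite, so [B (Negz n) (Posz n)]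
    counts the fermions on level [n]. *)
Definition has_content (mu : nat -> nat) (v : F) :=
  forall n, B (Negz n) (Posz n) v = (mu n)%:R *: v.

Lemma has_content_subspace mu : is_subspace (has_content mu).
Proof.
split=> [n|c u v hu hv n]; first by rewrite linear0 scaler0.
by rewrite linearP /= hu hv scalerDr scaler_swap.
Qed.

Lemma Posz_bar n p : (Posz n == bar p) = (p == Negz n).
Proof. by rewrite eq_bar bar_pos. Qed.

Lemma Negz_bar n p : (Negz n == bar p) = (p == Posz n).
Proof. by rewrite eq_bar bar_neg. Qed.

Definition content_shift (p q : int) (n : nat) : C :=
  (p == Negz n)%:R - (p == Posz n)%:R + (q == Negz n)%:R - (q == Posz n)%:R.

Lemma number_B p q n v : B (Negz n) (Posz n) (B p q v) =
  B p q (B (Negz n) (Posz n) v) + content_shift p q n *: B p q v.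
Proof.
have e (r s : int) (w : F) : (r == s)%:R *: w = if r == s then w else 0.
  by case: eqP; rewrite ?scale1r ?scale0r.
rewrite B_B !Posz_bar !Negz_bar /content_shift !(scalerDl, scaleNr) !addrA !e.
by congr (_ + _ - _ + _ - _); case: eqP => // ->.
Qed.

Definition content (w : seq (mode l)) (n : nat) : nat := count (fun x => x.2 == Negz n) w.

Lemma mono_content w : creations w -> has_content (content w) (mono w).
Proof.
move=> + n; elim: w => [_|[b r] w IH /= /andP[r0 cw]].
  rewrite scale0r; apply: big1 => a _; by rewrite [fpsi _ vac]fpsi_vac // linear0.
rewrite -/(mono w) B_psi IH // Posz_bar Negz_bar.
have -> : (r == Posz n) = false by apply/eqP => e; move: r0; rewrite e.
rewrite scale0r subr0 linearZ natrD scalerDl addrC; congr (_ + _).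
by case: eqP => [->|_]; rewrite ?scale0r.
Qed.

Lemma eigen_ortho n (a b : C) u v : a^* = a -> a != b ->
  B (Negz n) (Posz n) u = b *: u -> B (Negz n) (Posz n) v = a *: v -> form u v = 0.
Proof.
move=> ar ab hu hv; have := form_B (Negz n) (Posz n) u v.
rewrite bar_pos bar_neg hu hv formZl formZr ar => /eqP.
by rewrite -subr_eq0 -mulrBl mulf_eq0 subr_eq0 eq_sym (negbTE ab) => /eqP.
Qed.

Lemma content_ortho mu nu u v n : mu n != nu n ->
  has_content mu u -> has_content nu v -> form u v = 0.
Proof.
move=> mn hu hv; apply: (eigen_ortho (a := (nu n)%:R) (b := (mu n)%:R)) (hu n) (hv n).
  exact: rmorph_nat.
by rewrite eqr_nat eq_sym.
Qed.

Lemma mono_expansion v : exists s : seq (C * seq (mode l)),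
  (forall t, t \in s -> creations t.2) /\ v = \sum_(t <- s) t.1 *: mono t.2.
Proof.
have : creation_span (@fpsi R l F) vac v.
  apply: creation_spans (fock_gen v); [by move=> x; exact: linearP| |exact: fpsi_vac].
  by move=> x y u _; exact: fpsi_ac.
elim=> [|c u u' _ [s [hs ->]] _ [t [ht ->]]|x u x0 _ [s [hs ->]]].
- by exists [:: (1, [::])]; split=> [t|]; [rewrite inE => /eqP ->|rewrite big_seq1 scale1r].
- exists ([seq (c * p.1, p.2) | p <- s] ++ t); split=> [p|].
    by rewrite mem_cat => /orP[/mapP[q qs ->]|/ht //]; exact: (hs q qs).
  rewrite big_cat big_map scaler_sumr /=; congr (_ + _).
  by apply: eq_bigr => p _; rewrite scalerA.
- exists [seq (p.1, x :: p.2) | p <- s]; split=> [p /mapP[q qs ->]|].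
    by rewrite /= x0; exact: (hs q qs).
  by rewrite big_map linear_sum; apply: eq_bigr => p _; rewrite linearZ.
Qed.

(** [B p q] shifts all contents by the same amount, so the images of components of distinct contents
    stay orthogonal; since they add up to zero, each of them vanishes and each component is
    singular. *)
Lemma singular_contents (P : F -> Prop) : is_subspace P ->
  (forall mu v, has_content mu v -> singular v -> (exists K, forall n, (K <= n)%N -> mu n = 0%N) ->
     P v) ->
  forall v, singular v -> P v.
Proof.
move=> PS Pmu v sv; have [s [hs vE]] := mono_expansion v.
pose K := (\max_(t <- s) \max_(x <- t.2) (absz x.2).+1)%N.
have hK t n : t \in s -> (K <= n)%N -> content t.2 n = 0%N.
  move=> ts Kn; apply/eqP; rewrite -leqn0 leqNgt -has_count; apply/negP => /hasP[x xt /eqP xn].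
  have h1 : ((absz x.2).+1 <= \max_(x <- t.2) (absz x.2).+1)%N.
    by rewrite (big_rem x) //= leq_maxl.
  have h2 : (\max_(x <- t.2) (absz x.2).+1 <= K)%N.
    by rewrite /K [X in (_ <= X)%N](big_rem t) //= leq_maxl.
  by move: h1; rewrite xn; move: (leq_trans h2 Kn) => /=; lia.
pose ct (w : seq (mode l)) := [seq content w n | n <- iota 0 K].
pose cs := undup [seq ct t.2 | t <- s].
pose vc k := \sum_(t <- s | ct t.2 == k) t.1 *: mono t.2.
have vs : v = \sum_(k <- cs) vc k.
  rewrite vE /vc; under [RHS]eq_bigr => k _ do rewrite big_mkcond.
  rewrite exchange_big /=; apply: eq_big_seq => t ts.
  rewrite -big_mkcond -big_filter.
  have -> : [seq k <- cs | ct t.2 == k] = [:: ct t.2].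
    under eq_filter => k do rewrite eq_sym.
    by rewrite filter_pred1_uniq ?undup_uniq // mem_undup; apply/mapP; exists t.
  by rewrite big_seq1.
have hc k : has_content (nth 0%N k) (vc k).
  rewrite /vc big_seq_cond; apply: (sub_sum (has_content_subspace _)) => t /andP[ts /eqP tk].
  apply: (subZ (has_content_subspace _)) => n; rewrite (mono_content (hs t ts)) -tk.
  have [nK|Kn] := ltnP n K; first by rewrite (nth_map 0%N) ?size_iota // nth_iota.
  by rewrite hK // nth_default // size_map size_iota.
have kK k : k \in cs -> size k = K.
  by rewrite mem_undup => /mapP[t _ ->]; rewrite size_map size_iota.
rewrite vs; apply: (sub_sum_seq PS) => k kcs; apply: (Pmu _ _ (hc k)); last first.
  by exists K => n Kn; rewrite nth_default // kK.
move=> p q pq; apply: form_eq0.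
have Bv : B p q v = \sum_(k' <- cs) B p q (vc k') by rewrite {1}vs linear_sum.
have := form0r (B p q (vc k)); rewrite -(sv p q pq) Bv form_sumr.
rewrite (bigD1_seq k) ?undup_uniq // big_seq_cond big1 => [|k' /andP[k'cs kk']].
  by rewrite -[LHS]/(_ + 0) addr0.
have [n nn] : exists n, nth 0%N k' n != nth 0%N k n.
  apply: contrapT => h; case/eqP: kk'; apply: (eq_from_nth (x0 := 0%N)); rewrite ?kK // => n _.
  by apply/eqP/negPn/negP => ne; apply: h; exists n.
apply: (eigen_ortho (n := n) (a := (nth 0%N k' n)%:R + content_shift p q n)
  (b := (nth 0%N k n)%:R + content_shift p q n)).
- by rewrite /content_shift !(rmorphD, rmorphB, rmorphN, rmorph_nat).
- by rewrite (inj_eq (addIr _)) eqr_nat.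
- by rewrite number_B hc linearZ -scalerDl.
- by rewrite number_B hc linearZ -scalerDl.
Qed.

(** An sl(2) argument: lowering one fermion from level [n] to level [n + 1] multiplies the square
    norm of [v] by [mu n - mu n.+1]. *)
Lemma dominant mu v n : has_content mu v -> singular v -> v != 0 -> (mu n.+1 <= mu n)%N.
Proof.
move=> hv sv vn0; have := form_B (Negz n.+1) (Posz n) v (B (Negz n.+1) (Posz n) v).
have e0 : B (Negz n) (Posz n.+1) v = 0 by apply: sv; lia.
rewrite bar_pos bar_neg B_B e0 linear0 add0r !Posz_bar !Negz_bar !eqxx /=.
rewrite scale0r subr0 scale0r addr0 !scale1r !hv -scalerBl formZr => E.
have p0 := form_gt0 vn0.
have : 0 <= form (B (Negz n.+1) (Posz n) v) (B (Negz n.+1) (Posz n) v).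
  have [->|/form_gt0 /ltW //] := eqVneq (B (Negz n.+1) (Posz n) v) 0; by rewrite form0l.
by rewrite E rmorphB !rmorph_nat pmulr_lge0 // subr_ge0 ler_nat.
Qed.

End Weights.

Section Lower.
Variables (R : realType) (M : lmodType R[i]) (op : int -> int -> M -> M) (w : M).

Inductive lower : M -> Prop :=
| lower_base : lower w
| lower_lin c u v : lower u -> lower v -> lower (c *: u + v)
| lower_op p q v : p + q + 1 < 0 -> lower v -> lower (op p q v).

Lemma lower_subspace : is_subspace lower.
Proof.
split; last exact: lower_lin.
by rewrite -(addNr w) -scaleN1r; apply: lower_lin; exact: lower_base.
Qed.

Hypothesis op_lin : forall p q, linear (op p q).
Hypothesis op_op : forall p q r s v, op p q (op r s v) = op r s (op p q v)
  + (q == bar r)%:R *: op p s v - (p == bar r)%:R *: op q s v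
  + (q == bar s)%:R *: op r p v - (p == bar s)%:R *: op r q v.
Hypothesis op_pos : forall p q, 0 <= p + q -> op p q w = 0.
Hypothesis op_zero : forall p q, p + q + 1 = 0 -> exists a, op p q w = a *: w.

(** Commuting [op p q] past the last factor leaves only terms covered by induction; on the
    generator, positive operators vanish and those of degree zero are scalars. [M] is abstract
    because this is used both on [F] and on [F * F]. *)
Lemma lower_closed p q v : lower v -> lower (op p q v).
Proof.
move=> lv; elim: lv p q => {v} [p q|c u v _ hu _ hv p q|r s v rs lv IH p q].
- have [pq|pq] := ltP (p + q + 1) 0; first exact: lower_op (lower_base).
  have [pq'|pq'] := leP 0 (p + q); first by rewrite op_pos //; exact: (sub0 lower_subspace).
  have [|a ->] := @op_zero p q; first by lia.
  by apply: (subZ lower_subspace); exact: lower_base.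
- by rewrite op_lin; apply: lower_lin.
- rewrite op_op; have S := lower_subspace.
  have Z (b : bool) a c : lower (b%:R *: op a c v) by apply: (subZ S); exact: IH.
  apply: (subB S) => //; apply: (subD S) => //; apply: (subB S) => //; apply: (subD S) => //.
  exact: lower_op.
Qed.
End Lower.

(** * Modules generated by highest weight vectors of the same content *)

Section Isotypic.
Variables (R : realType) (l : nat) (F : fock_space R l).
Local Notation C := R[i].
Local Notation form := (@form R l F).
Local Notation B := (@B R l F).
Variable mu : nat -> nat.

Definition hwv (v : F) := singular v /\ has_content mu v.

Lemma hwv_subspace : is_subspace hwv.
Proof.
split; first by split; [exact: (sub0 (singular_subspace F))|exact: (sub0 (has_content_subspace _ mu))].
move=> c u v [su hu] [sv hv]; split; first exact: (subL (singular_subspace F)).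
exact: (subL (has_content_subspace F mu)).
Qed.

(** The scalar comes before [v]: it depends on the content alone, so a pair of vectors of the same
    content is scaled as a whole. *)
Lemma hwv_zero p q : p + q + 1 = 0 -> exists a, forall v, hwv v -> B p q v = a *: v.
Proof.
move=> pq; have qp : q = bar p by rewrite /bar; lia.
case: p pq qp => n _ ->.
  exists ((l + l)%:R - (mu n)%:R) => v [_ hv].
  by rewrite B_swap eqxx mul1r bar_pos hv -scalerBl.
by exists (mu n)%:R => v [_ hv]; rewrite bar_neg hv.
Qed.

(** Under this diagonal action [(v, s)] generates the graph of the intertwiner sending [v] to
    [s]. *)
Let op2 p q (y : F * F) : F * F := (B p q y.1, B p q y.2).

Let op2_op p q r s v : op2 p q (op2 r s v) = op2 r s (op2 p q v)
  + (q == bar r)%:R *: op2 p s v - (p == bar r)%:R *: op2 q s v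
  + (q == bar s)%:R *: op2 r p v - (p == bar s)%:R *: op2 r q v.
Proof. by congr pair; exact: B_B. Qed.

Let closed2 v s p q y : hwv v -> hwv s -> lower op2 (v, s) y -> lower op2 (v, s) (op2 p q y).
Proof.
move=> hv hs; apply: lower_closed.
- by move=> a b c u u'; rewrite /op2 /= !linearP.
- exact: op2_op.
- by move=> a b ab; rewrite /op2 /= (hv.1 a b ab) (hs.1 a b ab).
- by move=> a b /hwv_zero [c hc]; exists c; rewrite /op2 /= !hc.
Qed.

Lemma lower_B v p q y : hwv v -> lower B v y -> lower B v (B p q y).
Proof.
move=> hv; apply: lower_closed.
- by move=> a b c u u'; rewrite linearP.
- by move=> *; exact: B_B.
- by move=> a b ab; exact: hv.1.
- by move=> a b /hwv_zero [c hc]; exists c; rewrite hc.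
Qed.

Lemma lower_orth u : singular u -> forall p q y, p + q + 1 < 0 -> form (B p q y) u = 0.
Proof. by move=> su p q y pq; rewrite form_B su ?form0r // /bar; lia. Qed.

(** Adjunction moves all operators to one side until only [v] and [s] are paired, so the two forms
    are proportional on the graph. In particular a pair [(0, z)] in it has [z] of norm zero. *)
Let isometry v s y z : hwv v -> hwv s -> lower op2 (v, s) y -> lower op2 (v, s) z ->
  form y.1 z.1 * form s s = form y.2 z.2 * form v v.
Proof.
move=> hv hs Gy.
elim: Gy z => {y} [z|c y y' _ hy _ hy' z Gz|p q y pq Gy IH z Gz].
- elim=> {z} [|c y y' _ hy _ hy'|p q y pq Gy _] /=; first by rewrite mulrC.
    by rewrite !(formDr, formZr) !mulrDl -!mulrA hy hy'.
  have o u t : singular u -> form u (B p q t) = 0.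
    by move=> su; rewrite formC lower_orth ?rmorph0.
  by rewrite !o ?mul0r; [|exact: hs.1|exact: hv.1].
- by rewrite /= !(formDl, formZl) !mulrDl -!mulrA hy // hy'.
- by rewrite /= !form_B; exact: (IH _ (closed2 _ _ hv hs Gz)).
Qed.

Lemma transfer_exists v s : hwv v -> v != 0 -> hwv s -> exists T : F -> F,
  [/\ T v = s,
      forall c y y', lower B v y -> lower B v y' -> T (c *: y + y') = c *: T y + T y'
    & forall p q y, lower B v y -> T (B p q y) = B p q (T y)].
Proof.
move=> hv vn0 hs; pose G y z := lower op2 (v, s) (y, z).
have S := lower_subspace op2 (v, s).
have uniqG y z z' : G y z -> G y z' -> z = z'.
  move=> Gz Gz'; apply/eqP; rewrite -subr_eq0; apply/eqP/form_eq0.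
  have Gd : lower op2 (v, s) (y - y, z - z') := subB S Gz Gz'.
  have := isometry hv hs Gd Gd; rewrite /= subrr form0l mul0r => /esym/eqP.
  by rewrite mulf_eq0 (gt_eqF (form_gt0 vn0)) orbF => /eqP.
have tot y : lower B v y -> exists z, G y z.
  elim=> [|c u u' _ [z hz] _ [z' hz']|p q u pq _ [z hz]].
  - by exists s; exact: lower_base.
  - by exists (c *: z + z'); exact: (lower_lin c hz hz').
  - by exists (B p q z); exact: (lower_op pq hz).
have /boolp.choice [T hT] : forall y, exists z, lower B v y -> G y z.
  move=> y; have [ly|nl] := pselect (lower B v y); last by exists 0.
  by have [z hz] := tot y ly; exists z.
exists T; split=> [|c y y' ly ly'|p q y ly].
- by apply: (uniqG v); [apply: hT; exact: lower_base|exact: lower_base].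
- apply: (uniqG (c *: y + y')); first by apply: hT; exact: lower_lin.
  exact: (lower_lin c (hT y ly) (hT y' ly')).
- apply: (uniqG (B p q y)); first by apply: hT; exact: lower_B.
  exact: (closed2 p q hv hs (hT y ly)).
Qed.

(* [transfer v s] is the intertwiner from the module generated by [v] sending [v] to [s]
   (junk unless both are highest weight vectors of content [mu] and [v != 0]). *)
Definition transfer (v s : F) : F -> F :=
  if pselect [/\ hwv v, v != 0 & hwv s] is left h
  then let: And3 h1 h2 h3 := h in projT1 (cid (transfer_exists h1 h2 h3)) else id.

Lemma transferP v s : hwv v -> v != 0 -> hwv s ->
  [/\ transfer v s v = s,
      forall c y y', lower B v y -> lower B v y' ->
        transfer v s (c *: y + y') = c *: transfer v s y + transfer v s y'
    & forall p q y, lower B v y -> transfer v s (B p q y) = B p q (transfer v s y)].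
Proof.
move=> hv vn0 hs; rewrite /transfer; case: pselect => [[h1 h2 h3]|[]]; last by split.
exact: projT2 (cid (transfer_exists h1 h2 h3)).
Qed.

Section Transfer.
Variable v : F.
Hypotheses (hv : hwv v) (vn0 : v != 0).

Lemma transfer_base s : hwv s -> transfer v s v = s.
Proof. by case/(transferP hv vn0). Qed.

Lemma transfer_lin s c y y' : hwv s -> lower B v y -> lower B v y' ->
  transfer v s (c *: y + y') = c *: transfer v s y + transfer v s y'.
Proof. by case/(transferP hv vn0) => _ h _; exact: h. Qed.

Lemma transfer_B s p q y : hwv s -> lower B v y -> transfer v s (B p q y) = B p q (transfer v s y).
Proof. by case/(transferP hv vn0) => _ _; exact. Qed.

Lemma transfer_linl c s s' y : hwv s -> hwv s' -> lower B v y ->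
  transfer v (c *: s + s') y = c *: transfer v s y + transfer v s' y.
Proof.
move=> hs hs'; have hss := subL hwv_subspace c hs hs'.
elim=> [|d u u' lu hu lu' hu'|p q u pq lu hu].
- by rewrite !transfer_base.
- rewrite !transfer_lin // hu hu' !scalerDr addrACA; congr (_ + _ + _).
  exact: scaler_swap.
- by rewrite !transfer_B // hu linearP.
Qed.

Lemma transfer_comm (r : {linear F -> F}) s y : (forall p q u, r (B p q u) = B p q (r u)) ->
  hwv s -> hwv (r s) -> lower B v y -> r (transfer v s y) = transfer v (r s) y.
Proof.
move=> rB hs hrs; elim=> [|d u u' lu hu lu' hu'|p q u pq lu hu].
- by rewrite !transfer_base.
- by rewrite !transfer_lin // linearP /= hu hu'.
- by rewrite !transfer_B // rB hu.
Qed.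

(** Images of negative-degree operators are orthogonal to all singular vectors. Up to a multiple of
    [v], [y] is a sum of such images, and the difference is itself singular, hence orthogonal to
    itself. *)
Lemma lower_singular y : lower B v y -> singular y -> exists a, y = a *: v.
Proof.
move=> ly sy; have [a ha] : exists a, forall u, singular u -> form (y - a *: v) u = 0.
  elim: ly {sy} => [|c u u' _ [a ha] _ [b hb]|p q u pq lu _].
  - by exists 1 => u _; rewrite scale1r subrr form0l.
  - exists (c * a + b) => z sz.
    by rewrite scalerDl opprD addrACA -scalerA -scalerBr form_linl ha // hb // mulr0 addr0.
  - by exists 0 => z sz; rewrite scale0r subr0 lower_orth.
exists a; apply/eqP; rewrite -subr_eq0; apply/eqP/form_eq0/ha.
have S := singular_subspace F; apply: (subB S) => //; apply: (subZ S); exact: hv.1.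
Qed.

Lemma lower_irreducible (P : F -> Prop) : is_subspace P ->
  (forall p q u, P u -> lower B v u -> P (B p q u)) ->
  (exists2 u, P u /\ lower B v u & u != 0) -> forall u, lower B v u -> P u.
Proof.
move=> PS PB [u [Pu lu] un0].
have [||||||z [[Pz lz] zn0 sz]] := @lowest_exists _ F B (@below R l F)
  (fun u => P u /\ lower B v u) u => //.
- by move=> N z N0; exact: below_neg.
- by move=> *; exact: below_B.
- by move=> p q z [Pz lz]; split; [exact: PB|exact: lower_B].
- exact: below_exists.
have [a za] := lower_singular lz sz.
have an0 : a != 0 by apply: contraNneq zn0 => a0; rewrite za a0 scale0r.
have Pv : P v by rewrite -(scale1r v) -(mulVf an0) -scalerA -za; exact: (subZ PS).
move=> y; elim=> [//|c x x' _ Px _ Px'|p q x _ lx Px]; first exact: (subL PS).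
exact: PB.
Qed.

End Transfer.
End Isotypic.
(* Exchanging the modes 1/2 and -1/2 is an automorphism of the Clifford algebra that
   permutes the operators of positive degree: it is the diagram automorphism of type D,
   and it twists the action of O(2l) by the determinant. *)
Section Flip.
Variables (R : realType) (l : nat) (F : fock_space R l).
Local Notation C := R[i].
Local Notation vac := (vac F).
Local Notation form := (@form R l F).
Local Notation B := (@B R l F).
Local Notation mono := (@mono R l F).

Definition swp (m : int) : int :=
  if m == Posz 0 then Negz 0 else if m == Negz 0 then Posz 0 else m.

Lemma swpK : involutive swp.
Proof. by case=> [[|n]|[|n]]. Qed.

Lemma swp_bar m : swp (bar m) = bar (swp m).
Proof. by case: m => n; rewrite ?bar_pos ?bar_neg; case: n => [|n]; rewrite /swp /= ?bar_pos ?bar_neg. Qed.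

Definition swm (x : mode l) : mode l := (x.1, swp x.2).

(** The vacuum for the exchanged modes: all states on level 0 are occupied, so the modes of index
    -1/2 kill it and those of index 1/2 do not. *)
Definition filled : seq (mode l) := [seq (a, Negz 0) | a <- enum 'I_(l + l)].

Lemma filled_creations : creations filled.
Proof. by rewrite /creations all_map; apply/allP. Qed.

Lemma filled_uniq : uniq filled.
Proof. by rewrite map_inj_uniq ?enum_uniq // => a b []. Qed.

Lemma flip_ex : exists t : {linear F -> F},
  t vac = mono filled /\ forall x v, t (fpsi x v) = fpsi (swm x) (t v).
Proof.
have [||||||t [tv tp _]] := @fock_universal _ _ F F (fun=> True)
  (fun x v => fpsi (swm x) v) (mono filled) => //; last by exists t.
- by move=> x c u v; rewrite linearP.
- move=> x y v _; rewrite fpsi_ac; case: x y => a m [b n]; congr (_%:R *: _); congr nat_of_bool.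
  by rewrite /swm !star_pair /= -swp_bar (inj_eq (inv_inj swpK)).
- case=> a [[|n]|n] // _; rewrite /swm /swp /=.
    by apply: mono_mem; [exact: filled_creations|apply/mapP; exists a; rewrite ?mem_enum].
  apply: mono_annih; [exact: filled_creations|by []|].
  by apply/mapP => -[b _] /(congr1 snd) /=; rewrite bar_pos.
Qed.

Definition flip : {linear F -> F} := projT1 (cid flip_ex).

Lemma flip_vac : flip vac = mono filled.
Proof. by case: (projT2 (cid flip_ex)). Qed.

Lemma flip_fpsi x v : flip (fpsi x v) = fpsi (swm x) (flip v).
Proof. by case: (projT2 (cid flip_ex)) => _; exact. Qed.

Lemma flip_inj v : flip v = 0 -> v = 0.
Proof.
move=> fv; apply/eqP/negPn/negP => vn0.
have : flip vac = 0.
  apply: (@car_simple _ _ _ (@fpsi R l F) vac _ _ _ (fun u => flip u = 0) v) => //.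
  - by move=> x; exact: linearP.
  - by move=> x y u _; exact: fpsi_ac.
  - exact: fpsi_vac.
  - by move=> x u fu; rewrite flip_fpsi fu linear0.
  - by move=> c u fu; rewrite linearZ /= fu scaler0.
  - exact: fock_gen.
rewrite flip_vac => e; have := form_mono F filled_creations filled_uniq.
by rewrite e form0l => /esym/form_eq0/eqP; rewrite (negbTE (@vac_neq0 _ _ F)).
Qed.

Lemma flip_B p q v : flip (B p q v) = B (swp p) (swp q) (flip v).
Proof. by rewrite /B linear_sum; apply: eq_bigr => a _; rewrite !flip_fpsi. Qed.

(** The square commutes with every fermion, so it is a scalar, nonzero because [flip] is
    injective. *)
Lemma flip_flip : exists2 a : C, a != 0 & forall v, flip (flip v) = a *: v.
Proof.
have [|a ha] := @commutant_scalar _ _ _ (flip \o flip : {linear F -> F}).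
  by move=> [b m] v /=; rewrite !flip_fpsi /swm /= swpK.
exists a => //; apply: contraNneq (@vac_neq0 _ _ F) => a0; apply/eqP/flip_inj/flip_inj.
by have := ha vac => /= ->; rewrite a0 scale0r.
Qed.

Lemma B_diag q v : B q q v = 0.
Proof.
have /eqP := B_swap q q v; have -> : (q == bar q) = false by rewrite /bar; lia.
rewrite mul0r scale0r sub0r -addr_eq0 -mulr2n -scaler_nat scaler_eq0 pnatr_eq0 /=.
by move=> /eqP.
Qed.

Lemma flip_singular (v : F) : singular v -> singular (flip v).
Proof.
move=> sv p q pq; rewrite -(swpK p) -(swpK q) -flip_B.
(* The exchange turns [(0, 0)] into [(-1, -1)], of negative degree; this is harmless since [B p p]
   vanishes. Every other pair keeps a nonnegative sum. *)
have [<-|pq'] := eqVneq p q; first by rewrite B_diag linear0.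
rewrite sv ?linear0 //; move: pq pq'; rewrite /swp.
by case: p => [[|p]|[|p]]; case: q => [[|q]|[|q]] //=; rewrite ?NegzE; lia.
Qed.

(** The opposite ordering [B (Posz n) (Negz n)] is a sum of positive operators and has eigenvalue
    [2l - mu n] on [v]. *)
Lemma content_le mu (v : F) n : has_content mu v -> v != 0 -> (mu n <= l + l)%N.
Proof.
move=> hv vn0; have : 0 <= form (B (Posz n) (Negz n) v) v.
  rewrite /B form_suml; apply: sumr_ge0 => a _; rewrite form_psi /star /= bar_pos.
  by have [->|/form_gt0 /ltW //] := eqVneq (fpsi (dix a, Negz n) v) 0; rewrite form0l.
rewrite B_swap bar_pos eqxx mul1r hv -scalerBl formZl pmulr_lge0 ?form_gt0 //.
by rewrite subr_ge0 ler_nat.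
Qed.

Definition flip_content (mu : nat -> nat) (n : nat) : nat :=
  if n == 0%N then (l + l - mu 0)%N else mu n.

Lemma flip_has_content mu (v : F) : (mu 0 <= l + l)%N -> has_content mu v ->
  has_content (flip_content mu) (flip v).
Proof.
move=> m0 hv n; rewrite -(swpK (Negz n)) -(swpK (Posz n)) -flip_B /flip_content.
case: n => [|n]; rewrite /swp /=; last by rewrite hv linearZ.
by rewrite B_swap -bar_pos eqxx mul1r hv -scalerBl linearZ /= natrB.
Qed.

Lemma flip_hwv mu (v : F) : (mu 0 <= l + l)%N -> hwv mu v -> hwv (flip_content mu) (flip v).
Proof. by move=> m0 [sv hv]; split; [exact: flip_singular|exact: flip_has_content]. Qed.

(** Both sides intertwine the modes in the same way, so only the image of the vacuum matters: the
    filled level is the top exterior power of the natural representation, where [g] acts by its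
    determinant. *)
Lemma flip_rho (rho : 'M[C]_(l + l) -> F -> F) g v : is_fock_Oact rho -> O2l g ->
  rho g (flip v) = \det g *: flip (rho g v).
Proof.
move=> Hrho og; pose r := mk_linear (rho_linear Hrho og).
have hl : linear (fun v => \det g *: flip (r v)).
  by move=> c u w; rewrite !linearP.
apply: (@fock_linear_ext _ _ _ (r \o flip : {linear F -> F}) (mk_linear hl)
  (fun x => rotated g (swm x))) => [|x u|x u] /=; last 2 first.
- by rewrite flip_fpsi rho_fpsi.
- rewrite rho_fpsi // /rotated [flip _]linear_sum scaler_sumr /=.
  by apply: eq_bigr => b _; rewrite linearZ /= flip_fpsi [in RHS]linearZ /= scaler_swap.
rewrite rho_vac // flip_vac /filled (rho_mono Hrho (fun a => a) (fun=> Negz 0)) //.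
rewrite (bigID (fun b : {ffun 'I_(l + l) -> 'I_(l + l)} => injectiveb b)) /= [X in _ + X]big1 ?addr0.
  rewrite (reindex (fun s : 'S_(l + l) => val s)) /=; last first.
    by exists (fun f => insubd (1%g : 'S_(l + l)) f) => [s _|f fi]; [exact: valKd|exact: insubdK].
  rewrite -det_tr /determinant scaler_suml.
  rewrite [LHS](eq_bigl xpredT) => [|s]; last exact: (valP s).
  apply: eq_bigr => s _.
  have -> : [seq (val s x, Negz 0) | x <- enum 'I_(l + l)] =
      [seq (fun z => (z, Negz 0) : mode l) (s z) | z <- enum 'I_(l + l)].
    by apply: eq_map => x; rewrite pvalE.
  rewrite (mono_perm F s (f := fun z => (z, Negz 0))) // scalerA mulrC; congr (_ * _ *: _).
  by apply: eq_bigr => i _; rewrite mxE pvalE.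
move=> b /injectivePn [x [y xy bxy]]; rewrite mono_nuniq ?scaler0 //.
  by rewrite /creations all_map; apply/allP.
apply/negP => u; have /injectiveP inj : injectiveb (fun x => (b x, Negz 0) : mode l) by [].
by move/eqP: xy; apply; apply: inj; rewrite /= bxy.
Qed.

End Flip.
(** * Tableaux and traceless tensors *)

Section Tableaux.
Variables (R : realType) (l : nat) (m : l.-tuple nat).
Local Notation C := R[i].
Local Notation X := (cell m).
Local Notation index := {ffun X -> 'I_(l + l)}.
Local Notation tens := (tensors R m).
Implicit Types (T : tens) (a b : index) (s t : {perm X}) (x y : X).

Definition col x : nat := tagged x.
Definition rw x : 'I_l := tag x.

Lemma cell_eq x y : rw x = rw y -> col x = col y -> x = y.
Proof.
case: x y => r c [r' c'] e; rewrite /rw /= in e; subst r'.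
by rewrite /col /= => /val_inj ->.
Qed.

Lemma column_permP t : reflect (forall x, col (t x) = col x) (column_perm t).
Proof. by apply: (iffP forallP) => h x; apply/eqP; apply: h. Qed.

Lemma row_permP s : reflect (forall x, rw (s x) = rw x) (Defs.row_perm s).
Proof. by apply: (iffP forallP) => h x; apply/eqP; apply: h. Qed.

Definition pull a s : index := [ffun x => a (s x)].

Lemma tensors_permE s T a : tensors_perm s T a = T (pull a s).
Proof. by rewrite ffunE. Qed.

Lemma pull1 a : pull a 1%g = a.
Proof. by apply/ffunP => x; rewrite ffunE perm1. Qed.

Lemma pullM a s t : pull a (s * t)%g = pull (pull a t) s.
Proof. by apply/ffunP => x; rewrite !ffunE permM. Qed.

Lemma tensors_perm_linear s : linear (@tensors_perm R l m s).
Proof. by move=> c T T'; apply/ffunP => a; rewrite !ffunE. Qed.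
HB.instance Definition _ s := GRing.isLinear.Build C tens tens *:%R (@tensors_perm R l m s)
  (tensors_perm_linear s).

Lemma tensors_permM s t T : tensors_perm (s * t)%g T = tensors_perm t (tensors_perm s T).
Proof. by apply/ffunP => a; rewrite !tensors_permE pullM. Qed.

Definition row_sum T : tens := \sum_(s | Defs.row_perm s) tensors_perm s T.
Definition column_alt T : tens := \sum_(t | column_perm t) (-1) ^+ t *: tensors_perm t T.
Definition column_anti T := forall t, column_perm t -> tensors_perm t T = (-1) ^+ t *: T.
(** The Garnir relation for one cell: swapping [x] with each cell of an earlier column in turn and
    adding up gives back the tensor. *)
Definition exchange T := forall x c, (c < col x)%N ->
  \sum_(y | col y == c) tensors_perm (tperm x y) T = T.

(* The matrix unit e_pq of gl(2l) acting on tensors by derivations. *)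
Definition unit_act (p q : 'I_(l + l)) T : tens :=
  [ffun b : index => \sum_(x | b x == p) T [ffun z => if z == x then q else b z]].

Lemma unit_act_linear p q : linear (unit_act p q).
Proof.
move=> c T T'; apply/ffunP => b; rewrite !ffunE scaler_sumr -big_split.
by apply: eq_bigr => x _; rewrite !ffunE.
Qed.
HB.instance Definition _ p q := GRing.isLinear.Build C tens tens *:%R (unit_act p q)
  (unit_act_linear p q).

Lemma unit_act_perm p q s T : unit_act p q (tensors_perm s T) = tensors_perm s (unit_act p q T).
Proof.
apply/ffunP => b; rewrite !ffunE (reindex_inj (@perm_inj _ s)) /=.
apply: eq_big => [x|x _]; first by rewrite ffunE.
rewrite tensors_permE; congr (T _); apply/ffunP => z; rewrite !ffunE.
by rewrite (inj_eq perm_inj).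
Qed.

Definition garnir T := [/\ column_anti T, exchange T & row_sum T = 0].

Lemma garnir_unit_act p q T : garnir T -> garnir (unit_act p q T).
Proof.
move=> [ca ex rs]; split.
- by move=> t ct; rewrite -unit_act_perm ca // linearZ.
- move=> x c cx; rewrite -[in RHS](ex x c cx) linear_sum; apply: eq_bigr => y _ /=.
  by rewrite unit_act_perm.
- transitivity (unit_act p q (row_sum T)); last by rewrite rs linear0.
  by rewrite /row_sum linear_sum; apply: eq_bigr => s _; rewrite /= unit_act_perm.
Qed.

Lemma column_anti_inj T b x y : column_anti T -> T b != 0 -> col x = col y -> b x = b y -> x = y.
Proof.
move=> ca Tb cxy bxy; apply/eqP/negPn/negP => xy.
have ct : column_perm (tperm x y).
  by apply/column_permP => z; case: tpermP => [->|->|].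
have := congr1 (fun U : tens => U b) (ca _ ct); rewrite tensors_permE odd_tperm xy expr1.
have -> : pull b (tperm x y) = b.
  by apply/ffunP => z; rewrite ffunE; case: tpermP => [->|->|].
rewrite scaleN1r !ffunE => /eqP; rewrite -addr_eq0 -mulr2n mulrn_eq0 /=.
by apply/negP.
Qed.

Hypothesis m_sorted : sorted geq m.

Definition row_index : index := [ffun x => lshift l (rw x)].

(** Rows weakly decrease, so if row [r] stopped short of this column, all cells of the column would
    lie in the first [r] rows. *)
Lemma row_below x (r : nat) : (r < #|[set y | col y == col x]|)%N -> exists2 y, col y = col x & rw y = r :> nat.
Proof.
move=> rN.
have rl : (r < l)%N.
  have : (#|[set y | col y == col x]| <= #|'I_l|)%N.
    rewrite -(card_in_imset (f := rw)) ?max_card //.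
    by move=> y z; rewrite !inE => /eqP cy /eqP cz h; apply: cell_eq => //; rewrite cy cz.
  by rewrite card_ord; exact: leq_trans.
have [h|h] := ltnP (col x) (tnth m (Ordinal rl)).
  by exists (Tagged (fun r => 'I_(tnth m r)) (Ordinal h)).
have : (#|[set y | col y == col x]| <= r)%N; last by rewrite leqNgt rN.
rewrite cardE -(size_map (fun y => val (rw y))) -[in X in (_ <= X)%N](size_iota 0 r).
apply: uniq_leq_size => [|_ /mapP[y + ->]].
  rewrite map_inj_in_uniq ?enum_uniq // => y z; rewrite !mem_enum !inE => /eqP cy /eqP cz /val_inj e.
  by apply: cell_eq => //; rewrite cy cz.
rewrite mem_enum inE mem_iota add0n => /eqP cy /=.
rewrite ltnNge; apply/negP => ry; move: h; rewrite leqNgt => /negP; apply.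
rewrite -cy; apply: leq_trans (ltn_ord (tagged y)) _; rewrite -/(rw y).
rewrite !(tnth_nth 0%N) /=; apply: (sorted_leq_nth (leT := geq)) => //.
- by move=> ? ? ? /= h1 h2; exact: leq_trans h2 h1.
- by move=> ? /=.
- by rewrite inE size_tuple.
- by rewrite inE size_tuple.
Qed.

(* Such tensors form a gl(2l)-module. Take [T b != 0] with [b] of minimal height: raising
   operators annihilate that coefficient, so evaluating the sum over pairs x <> y of
   [T (b o (x y))] by values (raising) and by columns (exchange) gives two contents that
   must agree, which forces [b] to be the row tableau up to a column permutation. There
   the row symmetrizer multiplies the coefficient by a nonzero number. *)
Lemma garnir_eq0 T : garnir T -> T = 0.
Proof.
move=> gT; apply/eqP/negPn/negP => Tn0.
pose ht b := (\sum_x val (b x))%N.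
(* The height is minimized over all such tensors at once, because a raising operator replaces the
   tensor by another one. *)
have [n [[T1 [b [gT1 Tb nb]]] nmin]] : exists n,
    (exists T b, [/\ garnir T, T b != 0 & ht b = n]) /\
    forall T b, garnir T -> (ht b < n)%N -> T b = 0.
  have ex0 : exists n, `[< exists T b, [/\ garnir T, T b != 0 & ht b = n] >].
    have [b Tb] : exists b, T b != 0.
      apply: contrapT => h; case/eqP: Tn0; apply/ffunP => b; rewrite ffunE.
      by apply/eqP/negPn/negP => Tb; apply: h; exists b.
    by exists (ht b); apply/asboolP; exists T, b.
  case: (ex_minnP ex0) => n /asboolP h hmin; exists n; split=> // T' b gT' hb.
  apply/eqP/negPn/negP => T'b; have := hmin (ht b); rewrite leqNgt hb /=.
  by move=> H; have : false by apply: H; apply/asboolP; exists T', b.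
case: (gT1) => ca ex rs.
pose g x y := T1 (pull b (tperm x y)).
have gC x y : g x y = g y x by rewrite /g tpermC.
(* Evaluate [unit_act p (b x) T1] at [b] with the entry of [x] lowered to [p]. By minimality the
   value is zero, and its terms are [T1 b] and the swaps of [x] with the cells of value [p]. *)
have gp x (p : 'I_(l + l)) : (p < b x)%N -> \sum_(y | b y == p) g x y = - T1 b.
  move=> px; pose b' : index := [ffun z => if z == x then p else b z].
  have hb' : (ht b' < n)%N.
    rewrite -nb /ht (bigD1 x) //= [X in (_ < X)%N](bigD1 x) //= ffunE eqxx.
    rewrite (eq_bigr (fun i => val (b i))) => [|i /negbTE ix]; last by rewrite ffunE ix.
    by rewrite ltn_add2r.
  have := nmin _ _ (garnir_unit_act p (b x) gT1) hb'; rewrite ffunE.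
  rewrite (bigD1 x) /=; last by rewrite ffunE eqxx.
  have -> : [ffun z => if z == x then b x else b' z] = b.
    by apply/ffunP => z; rewrite !ffunE; case: eqP => // ->.
  move/eqP; rewrite addrC addr_eq0 => /eqP <-.
  apply: eq_big => [y|y /eqP byp].
    rewrite ffunE; case: (eqVneq y x) => [->|yx]; last by rewrite andbT.
    by rewrite andbF; apply/negbTE/eqP => e; move: px; rewrite e ltnn.
  rewrite /g; congr (T1 _); apply/ffunP => z; rewrite !ffunE.
  case: tpermP => [->|->|/eqP zx /eqP zy].
  - by case: eqP => [->|_] //; rewrite eqxx byp.
  - by rewrite eqxx.
  - by rewrite (negbTE zy) (negbTE zx).
have gc x c : (c < col x)%N -> \sum_(y | col y == c) g x y = T1 b.
  move=> cx; rewrite -[in RHS](ex x c cx) sum_ffunE; apply: eq_bigr => y _.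
  by rewrite tensors_permE.
have binj x y : col x = col y -> b x = b y -> x = y by exact: column_anti_inj Tb.
pose nbr x := #|[set y | (y != x) && (b y == b x)]|.
pose nc x := #|[set y | (y != x) && (col y == col x)]|.
pose lb x := #|[set y | (col y == col x) && (b y < b x)%N]|.
pose lc x := #|[set y | (b y == b x) && (col y < col x)%N]|.
have sumC (P : rel X) : \sum_x \sum_(y | P x y) g x y = \sum_x \sum_(y | P y x) g x y.
  rewrite (exchange_big_dep xpredT) //=; apply: eq_bigr => x _.
  by apply: eq_bigr => y _; rewrite gC.
have Sb : \sum_x \sum_(y | y != x) g x y =
    - T1 b *+ (2 * \sum_x val (b x)) + T1 b *+ \sum_x nbr x.
  have split3 x : \sum_(y | y != x) g x y = \sum_(y | (b y < b x)%N) g x y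
      + \sum_(y | (b x < b y)%N) g x y + T1 b *+ nbr x.
    rewrite (bigID (fun y => b y == b x)) /= addrC; congr (_ + _); last first.
      rewrite (eq_bigr (fun=> T1 b)) => [|y /andP[_ /eqP bxy]]; last first.
        by rewrite /g; congr (T1 _); apply/ffunP => z; rewrite ffunE; case: tpermP => [->|->|].
      by rewrite sumr_const /nbr; congr (_ *+ _); apply: eq_card => y; rewrite !inE.
    rewrite (bigID (fun y => (b y < b x)%N)) /=; congr (_ + _); apply: eq_bigl => y.
      apply/idP/idP => [/andP[] //|h]; rewrite h andbT; apply/andP; split.
        by apply: contraTneq h => ->; rewrite ltnn.
      by apply: contraTneq h => ->; rewrite ltnn.
    apply/idP/idP => [/andP[/andP[_ h1] h2]|h].
      by rewrite ltn_neqAle leqNgt h2 andbT eq_sym.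
    rewrite -leqNgt (ltnW h) andbT; apply/andP; split.
      by apply: contraTneq h => ->; rewrite ltnn.
    by apply: contraTneq h => ->; rewrite ltnn.
  rewrite (eq_bigr _ (fun x _ => split3 x)).
  rewrite !big_split /= (sumC (fun x y => (b x < b y)%N)) -mulr2n -sumrMnr; congr (_ + _).
  rewrite mulnC mulrnA; congr (_ *+ _); rewrite -sumrMnr; apply: eq_bigr => x _.
  rewrite (partition_big b (fun p => (p < b x)%N)) //=.
  rewrite (eq_bigr (fun=> - T1 b)) => [|p px]; last first.
    rewrite -(gp x p px); apply: eq_bigl => y; case: eqP => [->|_]; by rewrite ?px ?andbF.
  rewrite sumr_const; congr (_ *+ _); rewrite cardE -(size_map val) -[RHS](size_iota 0 (val (b x))).
  apply: perm_size; apply: uniq_perm; rewrite ?iota_uniq ?(map_inj_uniq val_inj) ?enum_uniq // => k.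
  rewrite mem_iota add0n /=; apply/mapP/idP => [[p + ->]|kb]; first by rewrite mem_enum unfold_in.
  by exists (Ordinal (ltn_trans kb (ltn_ord (b x)))); rewrite ?mem_enum ?unfold_in.
have Sc : \sum_x \sum_(y | y != x) g x y =
    T1 b *+ (2 * \sum_x col x) - T1 b *+ \sum_x nc x.
  have split3 x : \sum_(y | y != x) g x y = \sum_(y | (col y < col x)%N) g x y
      + \sum_(y | (col x < col y)%N) g x y - T1 b *+ nc x.
    rewrite (bigID (fun y => col y == col x)) /= addrC; congr (_ + _); last first.
      rewrite (eq_bigr (fun=> - T1 b)) => [|y /andP[yx /eqP cyx]]; last first.
        have ct : column_perm (tperm x y).
          by apply/column_permP => z; case: tpermP => [->|->|].
        by rewrite /g -tensors_permE (ca _ ct) odd_tperm eq_sym yx scaleN1r ffunE.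
      by rewrite sumr_const -mulNrn /nc; congr (_ *+ _); apply: eq_card => y; rewrite !inE.
    rewrite (bigID (fun y => (col y < col x)%N)) /=; congr (_ + _); apply: eq_bigl => y.
      apply/idP/idP => [/andP[] //|h]; rewrite h andbT; apply/andP; split.
        by apply: contraTneq h => ->; rewrite ltnn.
      by apply: contraTneq h => ->; rewrite ltnn.
    apply/idP/idP => [/andP[/andP[_ h1] h2]|h].
      by rewrite ltn_neqAle leqNgt h2 andbT eq_sym.
    rewrite -leqNgt (ltnW h) andbT; apply/andP; split.
      by apply: contraTneq h => ->; rewrite ltnn.
    by apply: contraTneq h => ->; rewrite ltnn.
  rewrite (eq_bigr _ (fun x _ => split3 x)).
  rewrite sumrB big_split /= (sumC (fun x y => (col x < col y)%N)) -mulr2n -sumrMnr; congr (_ - _).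
  rewrite mulnC mulrnA; congr (_ *+ _); rewrite -sumrMnr; apply: eq_bigr => x _.
  rewrite (partition_big (fun y => inord (col y) : 'I_(col x).+1) (fun c => (c < col x)%N)) /=; last first.
    by move=> y yx; rewrite inordK // ltnS ltnW.
  rewrite (eq_bigr (fun=> T1 b)) => [|c cx]; last first.
    rewrite -(gc x c cx); apply: eq_bigl => y; apply/andP/eqP => [[yx /eqP <-]|yc].
      by rewrite inordK // ltnS ltnW.
    by rewrite yc cx; split=> //; apply/eqP/val_inj; rewrite /= inordK.
  rewrite sumr_const; congr (_ *+ _); rewrite cardE -(size_map val) -[RHS](size_iota 0 (col x)).
  apply: perm_size; apply: uniq_perm; rewrite ?iota_uniq ?(map_inj_uniq val_inj) ?enum_uniq // => k.
  rewrite mem_iota add0n /=; apply/mapP/idP => [[p + ->]|kb]; first by rewrite mem_enum unfold_in.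
  by exists (Ordinal (leqW kb)); rewrite ?mem_enum ?unfold_in.
(* The two evaluations of the same double sum are compared and the nonzero factor [T1 b] is
   cancelled, leaving an identity of natural numbers. *)
have key : (\sum_x nbr x + \sum_x nc x = 2 * \sum_x val (b x) + 2 * \sum_x col x)%N.
  have e : ((2 * \sum_x col x)%:R - (\sum_x nc x)%:R + (2 * \sum_x val (b x))%:R
      - (\sum_x nbr x)%:R) * T1 b = 0 :> C.
    rewrite mulrBl mulrDl mulrBl !mulr_natl -Sc Sb mulNrn.
    by rewrite [X in X - _]addrAC addNr add0r subrr.
  move/eqP: e; rewrite mulf_eq0 (negbTE Tb) orbF subr_eq0 addrAC subr_eq -!natrD eqr_nat.
  by move/eqP <-; rewrite addnC.
have sym_count (P : rel X) (Q : rel X) :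
    (forall x y, P x y = (Q x y || Q y x)) -> (forall x y, ~~ (Q x y && Q y x)) ->
    (\sum_x #|[set y | P x y]| = 2 * \sum_x #|[set y | Q x y]|)%N.
  move=> PQ QQ; have -> : (\sum_x #|[set y | P x y]| =
      \sum_x #|[set y | Q x y]| + \sum_x #|[set y | Q y x]|)%N.
    rewrite -big_split; apply: eq_bigr => x _ /=.
    rewrite -cardsUI [X in (_ + X)%N](_ : _ = 0%N) ?addn0.
      by apply: eq_card => y; rewrite !inE PQ.
    by apply/eqP; rewrite cards_eq0; apply/eqP/setP => y; rewrite !inE; apply/negbTE/QQ.
  rewrite mul2n -addnn; congr (_ + _)%N.
  under eq_bigr => x _ do rewrite -sum1dep_card.
  rewrite (exchange_big_dep xpredT) //=; apply: eq_bigr => y _.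
  by rewrite sum1dep_card.
have nbE : (\sum_x nbr x = 2 * \sum_x lc x)%N.
  apply: (sym_count (fun x y => (y != x) && (b y == b x)) (fun x y => (b y == b x) && (col y < col x)%N)).
    move=> x y; rewrite [b x == b y]eq_sym; case: (b y =P b x) => [bxy|_]; rewrite ?andbF //= andbT.
    rewrite -neq_ltn; apply/idP/idP; first by apply: contraNneq => c; apply/eqP/binj.
    by apply: contraNneq => ->.
  by move=> x y; apply/negP => /andP[/andP[_ h1] /andP[_ h2]]; move: (ltn_trans h1 h2); rewrite ltnn.
have ncE : (\sum_x nc x = 2 * \sum_x lb x)%N.
  apply: (sym_count (fun x y => (y != x) && (col y == col x)) (fun x y => (col y == col x) && (b y < b x)%N)).
    move=> x y; rewrite [col x == col y]eq_sym; case: (col y =P col x) => [cxy|_]; rewrite ?andbF //= andbT.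
    rewrite -neq_ltn; apply/idP/idP; first by apply: contraNneq => /val_inj e; apply/eqP/binj.
    by apply: contraNneq => ->.
  by move=> x y; apply/negP => /andP[/andP[_ h1] /andP[_ h2]]; move: (ltn_trans h1 h2); rewrite ltnn.
have lcP x : (lc x <= col x)%N.
  rewrite /lc cardE -(size_map col) -[X in (_ <= X)%N](size_iota 0 (col x)).
  apply: uniq_leq_size => [|_ /mapP[y + ->]].
    rewrite map_inj_in_uniq ?enum_uniq // => y z; rewrite !mem_enum !inE.
    by move=> /andP[/eqP by' _] /andP[/eqP bz _] cyz; apply: binj; rewrite // by' bz.
  by rewrite mem_enum inE mem_iota => /andP[].
have lbP x : (lb x <= val (b x))%N.
  rewrite /lb cardE -(size_map (fun y => val (b y))) -[X in (_ <= X)%N](size_iota 0 (val (b x))).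
  apply: uniq_leq_size => [|_ /mapP[y + ->]].
    rewrite map_inj_in_uniq ?enum_uniq // => y z; rewrite !mem_enum !inE.
    by move=> /andP[/eqP cy _] /andP[/eqP cz _] /val_inj byz; apply: binj; rewrite // cy cz.
  by rewrite mem_enum inE mem_iota => /andP[].
(* Termwise [lc x <= col x] and [lb x <= b x], while the total sums agree, so equality holds at
   every cell: each column of [b] contains every value below any of its entries. *)
have lbE x : lb x = val (b x).
  move: key; rewrite nbE ncE -!mulnDr => /eqP; rewrite eqn_pmul2l // addnC.
  have s1 : (\sum_x lc x <= \sum_x col x)%N by apply: leq_sum => y _; exact: lcP.
  move=> /eqP e; have s2 : (\sum_x val (b x) <= \sum_x lb x)%N.
    by rewrite -(leq_add2r (\sum_x col x)) -e leq_add2l.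
  apply/eqP; rewrite eqn_leq lbP /= leqNgt; apply/negP => h.
  move: s2; rewrite leqNgt => /negP; apply.
  rewrite (bigD1 x) //= [X in (_ < X)%N](bigD1 x) //= -addSn.
  by apply: leq_add => //; apply: leq_sum => y _; exact: lbP.
have ux x : exists y, col y = col x /\ rw y = val (b x) :> nat.
  have [|y cy ry] := @row_below x (val (b x)); last by exists y.
  rewrite -lbE; apply: proper_card; apply/properP; split.
    by apply/fintype.subsetP => y; rewrite !inE => /andP[].
  by exists x; rewrite inE ?eqxx // ltnn andbF.
have [u hu] := boolp.choice ux.
have uinj : injective u.
  move=> x y uxy; have [cx rx] := hu x; have [cy ry] := hu y.
  apply: binj; first by rewrite -cx -cy uxy.
  by apply: val_inj; rewrite -rx -ry uxy.
have cu : column_perm (perm uinj) by apply/column_permP => x; rewrite permE; case: (hu x).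
have Tb0 : T1 row_index != 0.
  have := congr1 (fun U : tens => U row_index) (ca _ cu); rewrite tensors_permE.
  have -> : pull row_index (perm uinj) = b.
    by apply/ffunP => x; rewrite !ffunE permE; apply: val_inj; case: (hu x).
  by rewrite ffunE => e; apply: contraNneq Tb => h; rewrite e h scaler0.
(* Row permutations fix [row_index], so the vanishing row sum is a positive multiple of a nonzero
   coefficient. *)
have := congr1 (fun U : tens => U row_index) rs; rewrite /row_sum sum_ffunE ffunE.
rewrite (eq_bigr (fun=> T1 row_index)) => [|s /row_permP hs].
  rewrite sumr_const => /eqP; rewrite mulrn_eq0 (negbTE Tb0) orbF => /eqP /card0_eq /(_ 1%g).
  have r1 : Defs.row_perm (1%g : {perm X}) by apply/row_permP => x; rewrite perm1.
  by move=> h; move: (r1); rewrite -[Defs.row_perm _]/((1%g : {perm X}) \in (fun s => Defs.row_perm s)) h.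
rewrite tensors_permE; congr (T1 _); apply/ffunP => x; rewrite !ffunE.
by rewrite hs.
Qed.

End Tableaux.

(** * Creation words and the operators moving one fermion *)

Section WordCalculus.
Variables (R : realType) (l : nat) (F : fock_space R l).
Local Notation C := R[i].
Local Notation vac := (vac F).
Local Notation form := (@form R l F).
Local Notation B := (@B R l F).
Local Notation mono := (@mono R l F).

Lemma mono_perm_eq (w w' : seq (mode l)) : creations w -> perm_eq w w' ->
  exists e : nat, mono w = (-1) ^+ e *: mono w'.
Proof.
elim: w' w => [|x w' IH] w cw pw.
  by exists 0%N; move/perm_nilP: pw => ->; rewrite scale1r.
have xw : x \in w by rewrite (perm_mem pw) inE eqxx.
have cr : creations (rem x w) by apply/allP => y /mem_rem; apply: (allP cw).
have pr : perm_eq (rem x w) w'.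
  by rewrite -(perm_cons x); apply: perm_trans pw; rewrite perm_sym perm_to_rem.
have [e he] := IH _ cr pr.
exists (index x w + e)%N; rewrite (mono_pull F cw xw) he linearZ scalerA -exprD //.
Qed.

Section Map.
Variables (T : eqType) (f : T -> mode l).
Hypothesis f0 : forall z, (f z).2 < 0.
Implicit Type s : seq T.

Lemma creations_map s : creations [seq f z | z <- s].
Proof. by rewrite /creations all_map; apply/allP => z _; exact: f0. Qed.

Lemma mono_map_pull s x : x \in s ->
  mono [seq f z | z <- s] = (-1) ^+ index x s *: fpsi (f x) (mono [seq f z | z <- rem x s]).
Proof.
move=> xs; have xi := xs; rewrite -index_mem in xi.
have sE : s = take (index x s) s ++ x :: drop (index x s).+1 s.
  by rewrite -[LHS](cat_take_drop (index x s)) (drop_nth x) // nth_index.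
rewrite {1}sE remE !map_cat !mono_cat.
rewrite (creation_word (mono [seq f z | z <- drop _ s]) (f0 x) (creations_map _)).
rewrite size_map size_takel ?(ltnW xi) // scalerA -exprD -signr_odd oddD addbb scale1r.
by [].
Qed.

Lemma mono_map_annih s d : 0 <= d.2 -> uniq s ->
  fpsi d (mono [seq f z | z <- s]) = \sum_(x <- s | f x == star d)
    (-1) ^+ index x s *: mono [seq f z | z <- rem x s].
Proof.
move=> d0; elim: s => [_|x s IH /= /andP[xs us]]; first by rewrite big_nil fpsi_vac.
rewrite -/(mono _) fpsiC big_cons eqxx scale1r IH // linear_sum -sumrN.
have e : \sum_(z <- s | f z == star d) - fpsi (f x) ((-1) ^+ index z s *: mono [seq f y | y <- rem z s]) =
    \sum_(z <- s | f z == star d) (-1) ^+ (if x == z then 0%N else (index z s).+1) *: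
      mono [seq f y | y <- if x == z then s else x :: rem z s].
  rewrite big_seq_cond [RHS]big_seq_cond; apply: eq_bigr => z /andP[zs _].
  have -> : (x == z) = false by apply/negbTE/eqP => e; rewrite e zs in xs.
  by rewrite linearZ exprS mulN1r scaleNr.
by rewrite e; case: eqP => _; rewrite ?scale1r // scale0r add0r.
Qed.

End Map.

Lemma B_move (T : eqType) (a : T -> 'I_(l + l)) (c : T -> nat) (s : seq T) n k : uniq s ->
  B (Negz n) (Posz k) (mono [seq (a z, Negz (c z)) | z <- s]) =
  \sum_(x <- s | c x == k) mono [seq (a z, Negz (if z == x then n else c z)) | z <- s].
Proof.
elim: s => [_|x s IH /= /andP[xs us]].
  rewrite big_nil; apply: big1 => i _; rewrite [fpsi _ (mono _)]fpsi_vac ?linear0 //.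
rewrite -/(mono _) B_psi IH // Posz_bar Negz_bar scale0r subr0 big_cons eqxx addrC.
have -> : (Negz (c x) == Negz k) = (c x == k) by [].
have -> : [seq (a z, Negz (if z == x then n else c z)) | z <- s] = [seq (a z, Negz (c z)) | z <- s].
  by apply/eq_in_map => z zs; case: eqP => // e; rewrite -e zs in xs.
have -> : fpsi (a x, Negz (c x)) (\sum_(y <- s | c y == k)
      mono [seq (a z, Negz (if z == y then n else c z)) | z <- s]) =
    \sum_(y <- s | c y == k) mono ((a x, Negz (if x == y then n else c x)) ::
      [seq (a z, Negz (if z == y then n else c z)) | z <- s]).
  rewrite linear_sum big_seq_cond [RHS]big_seq_cond; apply: eq_bigr => y /andP[ys _].
  by have -> : (x == y) = false by apply/negbTE/eqP => e; rewrite e ys in xs.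
by case: eqP => _; rewrite ?scale1r // scale0r add0r.
Qed.

Lemma form_mono_content (mu : nat -> nat) (u : F) w n : has_content mu u -> creations w ->
  content w n != mu n -> form u (mono w) = 0.
Proof.
by move=> hu cw wn; apply: (content_ortho (n := n) _ hu (mono_content F cw)); rewrite eq_sym.
Qed.

Lemma mono_total (u : F) : (forall w, creations w -> form u (mono w) = 0) -> u = 0.
Proof.
move=> h; apply: form_eq0; have [s [hs {2}->]] := mono_expansion u.
rewrite form_sumr big_seq big1 // => t ts; by rewrite formZr h ?mulr0 //; exact: hs.
Qed.

End WordCalculus.

(** * Hermitian form, symmetrizers and contractions of tensors *)

Section TensorForm.
Variables (R : realType) (l : nat) (m : l.-tuple nat).
Local Notation C := R[i].
Local Notation X := (cell m).
Local Notation index := {ffun X -> 'I_(l + l)}.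
Local Notation tens := (tensors R m).
Implicit Types (T U : tens) (a b : index) (s t : {perm X}) (x y : X) (g : 'M[C]_(l + l)).

Definition tdot T U : C := \sum_a T a * (U a)^*.

Lemma tdotC T U : tdot T U = (tdot U T)^*.
Proof. by rewrite /tdot rmorph_sum; apply: eq_bigr => a _; rewrite rmorphM /= conjCK mulrC. Qed.

Lemma tdot_suml (I : finType) (P : pred I) (f : I -> tens) U :
  tdot (\sum_(i | P i) f i) U = \sum_(i | P i) tdot (f i) U.
Proof.
rewrite /tdot exchange_big; apply: eq_bigr => a _; rewrite sum_ffunE mulr_suml; exact: eq_bigr.
Qed.

Lemma tdotZl c T U : tdot (c *: T) U = c * tdot T U.
Proof. by rewrite /tdot mulr_sumr; apply: eq_bigr => a _; rewrite ffunE mulrA. Qed.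

Lemma tdot_eq0 T : tdot T T = 0 -> T = 0.
Proof.
move=> /eqP; rewrite psumr_eq0 => [/allP h|a _]; last exact: mul_conjC_ge0.
by apply/ffunP => a; have := h a (mem_index_enum a); rewrite mul_conjC_eq0 ffunE => /eqP.
Qed.

Lemma pull_bij s : bijective (fun a : index => pull a s).
Proof.
exists (fun a => pull a (s^-1)%g) => a; rewrite -pullM ?mulVg ?mulgV pull1 //.
Qed.

Lemma tdot_perm s T U : tdot (tensors_perm s T) U = tdot T (tensors_perm (s^-1)%g U).
Proof.
rewrite /tdot [RHS](reindex _ (onW_bij _ (pull_bij s))); apply: eq_bigr => a _.
by rewrite !tensors_permE -pullM mulVg pull1.
Qed.

Lemma row_permM s t : Defs.row_perm s -> Defs.row_perm t -> Defs.row_perm (s * t)%g.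
Proof. by move=> /row_permP h /row_permP k; apply/row_permP => x; rewrite permM k h. Qed.

Lemma row_permV s : Defs.row_perm (s^-1)%g = Defs.row_perm s.
Proof.
by apply/row_permP/row_permP => h x; [rewrite -[in RHS](permK s x) h|rewrite -[in RHS](permKV s x) h].
Qed.

Lemma column_permM s t : column_perm s -> column_perm t -> column_perm (s * t)%g.
Proof. by move=> /column_permP h /column_permP k; apply/column_permP => x; rewrite permM k h. Qed.

Lemma column_permV s : column_perm (s^-1)%g = column_perm s.
Proof.
by apply/column_permP/column_permP => h x; [rewrite -[in RHS](permK s x) h|rewrite -[in RHS](permKV s x) h].
Qed.

Lemma row_sum_sym s T : Defs.row_perm s -> tensors_perm s (row_sum T) = row_sum T.
Proof.
move=> rs; rewrite /row_sum linear_sum /= [RHS](reindex_inj (mulIg s)) /=.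
apply: eq_big => [t|t _]; last by rewrite tensors_permM.
apply/idP/idP => rt; first exact: row_permM.
by rewrite -(mulgK s t) row_permM // row_permV.
Qed.

Lemma column_alt_anti T : column_anti (column_alt T).
Proof.
move=> t ct; rewrite /column_alt linear_sum scaler_sumr /= [RHS](reindex_inj (mulIg t)) /=.
apply: eq_big => [s|s _].
  apply/idP/idP => cs; first exact: column_permM.
  by rewrite -(mulgK t s) column_permM // column_permV.
by rewrite linearZ /= tensors_permM scalerA odd_permM signr_addb mulrCA -signr_addb addbb mulr1.
Qed.

Lemma column_alt_id T : column_anti T -> column_alt T = T *+ #|[pred t : {perm X} | column_perm t]|.
Proof.
move=> ca; rewrite /column_alt (eq_bigr (fun=> T)) ?sumr_const // => t ct.
by rewrite ca // scalerA -signr_addb addbb scale1r.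
Qed.

Lemma tdot_row_sum T : tdot (row_sum T) (row_sum T) =
  tdot T (row_sum T) *+ #|[pred s : {perm X} | Defs.row_perm s]|.
Proof.
rewrite {1}/row_sum tdot_suml (eq_bigr (fun=> tdot T (row_sum T))) ?sumr_const // => s rs.
by rewrite tdot_perm row_sum_sym // row_permV.
Qed.

(** Both symmetrizers are self-adjoint, and [row_sum] is idempotent up to a positive factor, so the
    square norm of [row_sum (column_alt T)] is a multiple of the pairing of [T] with the left-hand
    side of the hypothesis. *)
Lemma row_column_inj T : column_alt (row_sum (column_alt T)) = 0 -> row_sum (column_alt T) = 0.
Proof.
move=> h; apply: tdot_eq0; rewrite tdot_row_sum [X in X *+ _](_ : _ = 0) ?mul0rn //.
set w := row_sum _ in h *; rewrite /column_alt tdot_suml.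
transitivity (tdot T (column_alt w)).
  rewrite [RHS]tdotC /column_alt tdot_suml rmorph_sum /= [RHS](reindex_inj invg_inj) /=.
  apply: eq_big => [t|t ct]; first by rewrite column_permV.
  by rewrite tdotZl [in RHS]tdotZl rmorphM /= -tdotC odd_permV tdot_perm rmorph_sign.
by rewrite h /tdot big1 // => a _; rewrite ffunE rmorph0 mulr0.
Qed.

Lemma young_symmetrizerE T : young_symmetrizer T = row_sum (column_alt T).
Proof.
rewrite /young_symmetrizer /row_sum; apply: eq_bigr => s _.
by rewrite /column_alt linear_sum; apply: eq_bigr => t _; rewrite linearZ.
Qed.

Lemma row_sum_linear : linear (@row_sum R l m).
Proof.
move=> c T U; rewrite /row_sum scaler_sumr -big_split; apply: eq_bigr => s _.
by rewrite linearP.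
Qed.
HB.instance Definition _ := GRing.isLinear.Build C tens tens *:%R (@row_sum R l m) row_sum_linear.

Lemma column_alt_linear : linear (@column_alt R l m).
Proof.
move=> c T U; rewrite /column_alt scaler_sumr -big_split; apply: eq_bigr => s _.
by rewrite linearP scalerDr scaler_swap.
Qed.
HB.instance Definition _ := GRing.isLinear.Build C tens tens *:%R (@column_alt R l m) column_alt_linear.

Lemma young_symmetrizer_linear : linear (@young_symmetrizer R l m).
Proof. by move=> c T U; rewrite !young_symmetrizerE !linearP. Qed.
HB.instance Definition _ := GRing.isLinear.Build C tens tens *:%R (@young_symmetrizer R l m)
  young_symmetrizer_linear.

Lemma contraction_linear x y a : linear (@contraction R l m x y a).
Proof.
move=> c T U; rewrite /contraction scaler_sumr -big_split; apply: eq_bigr => i _ /=.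
rewrite scaler_sumr -big_split; apply: eq_bigr => j _ /=.
by rewrite !ffunE mulrDr; congr (_ + _); rewrite mulrCA.
Qed.
HB.instance Definition _ x y a := GRing.isLinear.Build C tens C^o *:%R (@contraction R l m x y a)
  (contraction_linear x y a).

Definition is_traceless T := forall x y a, x != y -> contraction x y a T = 0.

Lemma tracelessP T : reflect (is_traceless T) (T \in traceless R m).
Proof.
rewrite memvE; apply: (iffP subv_bigcapP) => [h x y a xy|h [x y] /= xy].
  have /subv_bigcapP /(_ a isT) := h (x, y) xy.
  by rewrite -memvE memv_ker lfunE => /eqP.
apply/subv_bigcapP => a _.
by rewrite -memvE memv_ker lfunE /=; apply/eqP/h.
Qed.

Lemma weylP w : reflect (exists2 T, is_traceless T & w = row_sum (column_alt T))
  (w \in weyl_space R m).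
Proof.
apply: (iffP memv_imgP) => [[T /tracelessP hT ->]|[T hT ->]].
  by exists T => //; rewrite lfunE /= young_symmetrizerE.
by exists T; [apply/tracelessP|rewrite lfunE /= young_symmetrizerE].
Qed.

Definition upd2 a x y i j : index := [ffun z => if z == x then i else if z == y then j else a z].

Lemma contractionE x y a T : contraction x y a T = \sum_i T (upd2 a x y i (dix i)).
Proof.
apply: eq_bigr => i _; rewrite (bigD1 (dix i)) //= big1 => [|j ji].
  by rewrite addr0 formJE eqxx mul1r.
by rewrite formJE (negbTE ji) mul0r.
Qed.

Lemma traceless_sum (V : lmodType C) T x y (K : index -> V) : is_traceless T -> x != y ->
  (* The weight ignores the slots [x] and [y], so it factors out of each contraction. *)
  (forall a i j, K (upd2 a x y i j) = K a) ->
  \sum_(a : index | a y == dix (a x)) T a *: K a = 0.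
Proof.
move=> tT xy hK; pose i0 := lshift l (rw x); have yx : (y == x) = false by rewrite eq_sym (negbTE xy).
(* Indices are grouped by their entries away from [x] and [y], the representative having [i0] in
   both slots; the row of [x] supplies this inhabitant. *)
rewrite (partition_big (fun a => upd2 a x y i0 i0) xpredT) //= big1 // => c _.
have [cE|cN] := eqVneq (upd2 c x y i0 i0) c; last first.
  rewrite big1 // => a /andP[_ /eqP e]; case/eqP: cN; rewrite -e.
  by apply/ffunP => z; rewrite !ffunE; case: eqP => // _; case: eqP.
rewrite (reindex_onto (fun i => upd2 c x y i (dix i)) (fun a => a x)) /=; last first.
  move=> a /andP[/eqP ay /eqP ac]; rewrite -ac; apply/ffunP => z; rewrite !ffunE.
  by case: eqP => [->|_] //; case: eqP => [->|].
rewrite (eq_bigl xpredT) => [|i].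
  by under eq_bigr => i _ do rewrite hK; rewrite -scaler_suml -contractionE tT // scale0r.
rewrite !ffunE eqxx yx eqxx !eqxx /= andbT.
by apply/eqP; rewrite -[RHS]cE; apply/ffunP => z; rewrite !ffunE; case: eqP => // _; case: eqP.
Qed.

Lemma tensors_perm_traceless s T : is_traceless T -> is_traceless (tensors_perm s T).
Proof.
move=> tT x y a xy; rewrite contractionE -[RHS](tT ((s^-1)%g x) ((s^-1)%g y) (pull a s)).
  rewrite contractionE; apply: eq_bigr => i _; rewrite tensors_permE; congr (T _).
  apply/ffunP => z; rewrite !ffunE.
  have e u : (z == (s^-1)%g u) = (s z == u) by rewrite -[LHS](inj_eq (@perm_inj _ s)) permKV.
  by rewrite !e.
by rewrite (inj_eq perm_inj).
Qed.

Lemma traceless_subspace : is_subspace is_traceless.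
Proof.
split=> [x y a _|c T U hT hU x y a xy]; first by rewrite linear0.
by rewrite linearP /= hT // hU // scaler0 addr0.
Qed.

Lemma row_sum_traceless T : is_traceless T -> is_traceless (row_sum T).
Proof.
by move=> tT; apply: (sub_sum traceless_subspace) => s _; exact: tensors_perm_traceless.
Qed.

Lemma column_alt_traceless T : is_traceless T -> is_traceless (column_alt T).
Proof.
move=> tT; apply: (sub_sum traceless_subspace) => s _; apply: (subZ traceless_subspace).
exact: tensors_perm_traceless.
Qed.

Lemma tensors_act_linear g : linear (@tensors_act R l m g).
Proof.
move=> c T U; apply/ffunP => a; rewrite !ffunE scaler_sumr -big_split.
by apply: eq_bigr => b _; rewrite !ffunE mulrDr mulrCA.
Qed.
HB.instance Definition _ g := GRing.isLinear.Build C tens tens *:%R (@tensors_act R l m g)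
  (tensors_act_linear g).

Lemma tensors_act_perm g s T : tensors_act g (tensors_perm s T) = tensors_perm s (tensors_act g T).
Proof.
apply/ffunP => a; rewrite tensors_permE !ffunE [RHS](reindex _ (onW_bij _ (pull_bij s))).
apply: eq_bigr => b _; rewrite tensors_permE; congr (_ * _).
by rewrite (reindex_inj (@perm_inj _ s)); apply: eq_bigr => x _; rewrite !ffunE.
Qed.

(** Contracting two output slots contracts the two input slots through [g^T J g = J]; the product
    over the other slots is the weight of [traceless_sum]. *)
Lemma tensors_act_traceless g T : O2l g -> is_traceless T -> is_traceless (tensors_act g T).
Proof.
move=> og tT x y a xy; have yx : (y == x) = false by rewrite eq_sym (negbTE xy).
rewrite contractionE; under eq_bigr => i _ do rewrite ffunE.
rewrite exchange_big /=.
pose K b : C^o := \prod_(z | (z != x) && (z != y)) g (a z) (b z).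
rewrite -[RHS](@traceless_sum C^o T x y K tT xy); last first.
  move=> b i j; apply: eq_bigr => z /andP[/negbTE zx /negbTE zy]; by rewrite ffunE zx zy.
rewrite [RHS]big_mkcond; apply: eq_bigr => b _; rewrite -mulr_suml.
transitivity ((\sum_i g i (b x) * g (dix i) (b y)) * K b * T b); last first.
  by rewrite O2l_col //; case: eqP => _; rewrite ?mul1r ?mul0r // mulrC.
congr (_ * _); rewrite mulr_suml; apply: eq_bigr => i _.
rewrite (bigD1 x) //= (bigD1 y) /=; last by rewrite yx.
rewrite !ffunE !eqxx yx -mulrA; congr (_ * (_ * _)); apply: eq_bigr => z /andP[/negbTE zx /negbTE zy].
by rewrite ffunE zx zy.
Qed.

Lemma weyl_stable g w : O2l g -> w \in weyl_space R m -> tensors_act g w \in weyl_space R m.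
Proof.
move=> og /weylP[T tT ->]; apply/weylP; exists (tensors_act g T); first exact: tensors_act_traceless.
rewrite /row_sum linear_sum; apply: eq_bigr => s _; rewrite /= tensors_act_perm; congr tensors_perm.
by rewrite /column_alt linear_sum; apply: eq_bigr => t _; rewrite linearZ /= tensors_act_perm.
Qed.

End TensorForm.
(** * From tensors to highest weight vectors *)

Section Omega.
Variables (R : realType) (l : nat) (F : fock_space R l) (m : l.-tuple nat).
Hypothesis m_sorted : sorted geq m.
Local Notation C := R[i].
Local Notation vac := (vac F).
Local Notation form := (@form R l F).
Local Notation B := (@B R l F).
Local Notation mono := (@mono R l F).
Local Notation X := (cell m).
Local Notation index := {ffun X -> 'I_(l + l)}.
Local Notation tens := (tensors R m).
Implicit Types (T U : tens) (a b : index) (s t : {perm X}) (x y : X) (g : 'M[C]_(l + l)).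

(* A slot in column c carrying v_a becomes the creation mode of psi_a of index -(c + 1/2),
   so that the slots of a column are antisymmetrized. *)
Definition cell_mode a x : mode l := (a x, Negz (col x)).
Definition cell_word a := [seq cell_mode a x | x <- enum {: X}].
Definition omega T : F := \sum_a T a *: mono (cell_word a).

Definition columns (c : nat) : nat := #|[set x : X | col x == c]|.

Lemma cell_word_creations a : creations (cell_word a).
Proof. exact: creations_map. Qed.

Lemma omega_linear : linear omega.
Proof.
move=> c T U; rewrite /omega scaler_sumr -big_split; apply: eq_bigr => a _ /=.
by rewrite !ffunE scalerDl scalerA.
Qed.
HB.instance Definition _ := GRing.isLinear.Build C tens F *:%R omega omega_linear.

Lemma cell_word_column t a : column_perm t ->
  mono (cell_word (pull a t)) = (-1) ^+ t *: mono (cell_word a).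
Proof.
move=> /column_permP ct; rewrite -(mono_perm F t (f := cell_mode a)) //.
by congr mono; apply: eq_map => x; rewrite /cell_mode ffunE ct.
Qed.

Lemma omega_column t T : column_perm t -> omega (tensors_perm t T) = (-1) ^+ t *: omega T.
Proof.
move=> ct; rewrite /omega [in RHS](reindex _ (onW_bij _ (pull_bij t))) scaler_sumr /=.
apply: eq_bigr => a _; rewrite tensors_permE cell_word_column // !scalerA; congr (_ *: _).
by rewrite mulrAC -signr_addb addbb mul1r.
Qed.

Lemma omega_column_alt T : omega (column_alt T) = omega T *+ #|[pred t : {perm X} | column_perm t]|.
Proof.
rewrite /column_alt linear_sum (eq_bigr (fun=> omega T)) ?sumr_const // => t ct.
by rewrite linearZ /= omega_column // scalerA -signr_addb addbb scale1r.
Qed.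

Lemma omega_rho (rho : 'M[C]_(l + l) -> F -> F) g T : is_fock_Oact rho -> O2l g ->
  rho g (omega T) = omega (tensors_act g T).
Proof.
move=> Hrho og; rewrite /omega -[LHS]/(mk_linear (rho_linear Hrho og) _) linear_sum.
under eq_bigr => a _ do rewrite linearZ /= (rho_mono Hrho a (fun x => Negz (col x))) // scaler_sumr.
rewrite exchange_big /=; apply: eq_bigr => b _; rewrite ffunE scaler_suml.
by apply: eq_bigr => a _; rewrite scalerA mulrC.
Qed.

Lemma content_cell_word a n : content (cell_word a) n = columns n.
Proof.
rewrite /content count_map -size_filter /columns cardE; apply: perm_size.
apply: uniq_perm => [||x]; [exact/filter_uniq/enum_uniq|exact: enum_uniq|].
by rewrite mem_filter !mem_enum [in RHS]inE andbT.
Qed.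

Lemma omega_content T : has_content columns (omega T).
Proof.
apply: (sub_sum (has_content_subspace F columns)) => a _.
apply: (subZ (has_content_subspace F columns)) => n.
by rewrite (mono_content F (cell_word_creations a)) content_cell_word.
Qed.

Lemma B_move_cells a n k : B (Negz n) (Posz k) (mono (cell_word a)) =
  \sum_(x | col x == k) mono [seq (a z, Negz (if z == x then n else col z)) | z <- enum {: X}].
Proof. by rewrite B_move ?enum_uniq // big_enum_cond. Qed.

(* A row-symmetric tensor is antisymmetrized over two cells of the same row. *)
Lemma omega_raise T n k : (forall s, Defs.row_perm s -> tensors_perm s T = T) -> (n < k)%N ->
  B (Negz n) (Posz k) (omega T) = 0.
Proof.
move=> rT nk; rewrite /omega linear_sum /=.
under eq_bigr => a _ do rewrite linearZ /= B_move_cells scaler_sumr.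
rewrite exchange_big big1 //= => x /eqP xk.
have nx : (n < tnth m (rw x))%N by apply: ltn_trans nk _; rewrite -xk; exact: ltn_ord.
pose y : X := Tagged (fun r => 'I_(tnth m r)) (Ordinal nx).
have cy : col y = n by [].
have xy : x != y by apply/eqP => e; move: nk; rewrite -cy -e xk ltnn.
set S := \sum_a _; suff : S = - S.
  by move/eqP; rewrite -addr_eq0 -mulr2n -scaler_nat scaler_eq0 pnatr_eq0 /= => /eqP.
rewrite {1}/S (reindex _ (onW_bij _ (pull_bij (tperm x y)))) -sumrN /=; apply: eq_bigr => a _.
have rt : Defs.row_perm (tperm x y) by apply/row_permP => z; case: tpermP => [->|->|].
rewrite -tensors_permE rT // -scalerN; congr (_ *: _).
pose f z : mode l := (a z, Negz (if z == x then n else col z)).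
rewrite -(mono_tperm F (f := f) _ xy) //; congr mono; apply: eq_map => z; rewrite /f ffunE; congr pair.
have yx : (y == x) = false by rewrite eq_sym (negbTE xy).
by congr Negz; case: tpermP => [->|->|/eqP /negbTE zx _]; rewrite ?eqxx ?zx ?yx.
Qed.

(** Two annihilators remove the fermions of one cell in column [k] and one in column [n] with dual
    species. The remaining word does not depend on these two slots, so the sum over their entries is
    a contraction of [T]. *)
Lemma omega_trace T n k : is_traceless T -> n != k -> B (Posz n) (Posz k) (omega T) = 0.
Proof.
move=> tT nk.
have E a : B (Posz n) (Posz k) (mono (cell_word a)) =
    \sum_(x | col x == k) \sum_(y | (y != x) && (col y == n))
      (if a y == dix (a x) then
        (-1) ^+ (seq.index x (enum {: X}) + seq.index y (rem x (enum {: X}))) *: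
          mono [seq cell_mode a z | z <- rem y (rem x (enum {: X}))] else 0).
  transitivity (\sum_i \sum_(x | cell_mode a x == star (dix i, Posz k))
      (-1) ^+ seq.index x (enum {: X}) *: fpsi (i, Posz n) (mono [seq cell_mode a z | z <- rem x (enum {: X})])).
    apply: eq_bigr => i _; rewrite mono_map_annih ?enum_uniq // linear_sum big_enum_cond /=.
    by apply: eq_bigr => x _; rewrite linearZ.
  under eq_bigr => i _ do rewrite big_mkcond /=.
  rewrite exchange_big [RHS]big_mkcond; apply: eq_bigr => x _ /=.
  rewrite (bigD1 (a x)) //= [X in _ + X]big1 ?addr0; last first.
    by move=> i ix; rewrite star_pair dixK [a x == i]eq_sym (negbTE ix).
  rewrite star_pair dixK eqxx bar_pos -[Negz (col x) == Negz k]/(col x == k) /=.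
  case: eqP => // xk; rewrite mono_map_annih ?rem_uniq ?enum_uniq // scaler_sumr.
  rewrite rem_filter ?enum_uniq // big_filter_cond big_enum_cond /= [LHS]big_mkcond [RHS]big_mkcond.
  apply: eq_bigr => y _; rewrite star_pair bar_pos -[Negz (col y) == Negz n]/(col y == n).
  rewrite -rem_filter ?enum_uniq // scalerA -exprD.
  by case: (y != x); case: (a y == dix (a x)); case: (col y == n).
rewrite /omega linear_sum /=.
under eq_bigr => a _ do rewrite linearZ /= E scaler_sumr.
rewrite exchange_big big1 //= => x xk.
under eq_bigr => a _ do rewrite scaler_sumr.
rewrite exchange_big big1 //= => y /andP[yx yn].
rewrite -[RHS](@traceless_sum R l m F T x y (fun a =>
  (-1) ^+ (seq.index x (enum {: X}) + seq.index y (rem x (enum {: X}))) *: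
          mono [seq cell_mode a z | z <- rem y (rem x (enum {: X}))])) //.
- rewrite [RHS]big_mkcond; apply: eq_bigr => a _; by case: ifP => // _; rewrite scaler0.
- by rewrite eq_sym.
- move=> a i j; congr (_ *: mono _); apply/eq_in_map => z.
  rewrite mem_rem_uniq ?rem_uniq ?enum_uniq // inE => /andP[zy].
  rewrite mem_rem_uniq ?enum_uniq // inE => /andP[zx _].
  by rewrite /cell_mode ffunE (negbTE zx) (negbTE zy).
Qed.

Lemma omega_hwv w : w \in weyl_space R m -> hwv columns (omega w).
Proof.
move=> /weylP[T tT ->]; split; last exact: omega_content.
have tw := row_sum_traceless (column_alt_traceless tT).
case=> p; case=> q pq.
- have [->|npq] := eqVneq p q; first exact: B_diag.
  exact: omega_trace.
- rewrite B_swap; have -> : (Negz q == bar (Posz p)) = false by rewrite bar_pos; apply/eqP => -[]; lia.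
  rewrite mul0r scale0r sub0r omega_raise ?oppr0 //; last by lia.
  by move=> s rs; exact: row_sum_sym.
- by rewrite omega_raise //; [move=> s rs; exact: row_sum_sym | lia].
- by move: pq; rewrite !NegzE; lia.
Qed.

(** Pair [omega U] with the word of an index [a] where [U] is nonzero. Only rearrangements of [a]
    within columns contribute, and the sign of the coefficient cancels that of the word, so all
    contributions are equal. *)
Lemma omega_anti_inj U : column_anti U -> omega U = 0 -> U = 0.
Proof.
move=> cU oU; apply/ffunP => a; rewrite ffunE; apply/eqP/negPn/negP => Ua.
have ainj x y : col x = col y -> a x = a y -> x = y by exact: column_anti_inj Ua.
have minj : injective (cell_mode a).
  by move=> x y [h1 h2]; apply: ainj => //; move: h2 => /(congr1 Negz).
have ua : uniq (cell_word a) by rewrite map_inj_uniq ?enum_uniq.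
have : form (omega U) (mono (cell_word a)) = 0 by rewrite oU form0l.
rewrite /omega form_suml.
have tm b : form (U b *: mono (cell_word b)) (mono (cell_word a)) =
    (if form (mono (cell_word b)) (mono (cell_word a)) != 0 then 1 else 0) * (U a * form vac vac).
  rewrite formZl; case: ifP => [n0|/negbFE /eqP ->]; last by rewrite mulr0 mul0r.
  have pe := form_mono_perm (cell_word_creations b) (cell_word_creations a) n0.
  have ub : uniq (cell_word b) by rewrite (perm_uniq pe).
  have ex x : exists y, cell_mode a y = cell_mode b x.
    have : cell_mode b x \in cell_word a by rewrite -(perm_mem pe) map_f ?mem_enum.
    by move=> /mapP[y _ ->]; exists y.
  have [u hu] := boolp.choice ex.
  have uinj : injective u.
    move=> x y uxy; have /injectiveP inj : injectiveb (cell_mode b) by [].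
    by apply: inj; rewrite -!hu uxy.
  have cu : column_perm (perm uinj).
    by apply/column_permP => x; rewrite permE; have [_ /(congr1 Negz)] := hu x; move=> [].
  have bE : b = pull a (perm uinj).
    by apply/ffunP => x; rewrite ffunE permE; have [] := hu x.
  rewrite bE -tensors_permE cU // ffunE cell_word_column // formZl.
  rewrite (form_mono F (cell_word_creations a) ua) mul1r.
  set e := (-1) ^+ _; have ee : e * e = 1 :> C by rewrite -signr_addb addbb.
  by transitivity (e * U a * (e * form vac vac)); rewrite // mulrACA ee mul1r.
rewrite (eq_bigr _ (fun b _ => tm b)) -mulr_suml => /eqP.
have f0 : form vac vac != 0 by rewrite gt_eqF // form_gt0 // vac_neq0.
rewrite !mulf_eq0 (negbTE Ua) (negbTE f0) !orbF psumr_eq0 => [/allP /(_ a (mem_index_enum a))|b _].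
  by rewrite (form_mono F (cell_word_creations a) ua) f0 oner_eq0.
by case: ifP.
Qed.

Lemma omega_inj w : w \in weyl_space R m -> omega w = 0 -> w = 0.
Proof.
move=> /weylP[T tT ->] ow; apply: row_column_inj; apply: omega_anti_inj.
  exact: column_alt_anti.
by rewrite omega_column_alt ow mul0rn.
Qed.

Section Surjective.
Variable u : F.
Hypothesis hu : hwv columns u.

Definition coefs : tens := [ffun a : index => form u (mono (cell_word a)) : C^o].

Lemma coefs_anti : column_anti coefs.
Proof.
move=> t ct; apply/ffunP => a; rewrite tensors_permE !ffunE cell_word_column // formZr.
by rewrite rmorph_sign.
Qed.

Lemma coefs_exchange : exchange coefs.
Proof.
move=> x c cx; apply/ffunP => b; rewrite sum_ffunE ffunE.
under eq_bigr => y _ do rewrite tensors_permE ffunE.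
(* Put cell [x] on level [c]. The adjoint of the raising operator then moves one fermion from level
   [c] to level [col x]: that of [x], which restores [b], or that of a cell [y] of column [c], which
   gives [b] swapped at [x] and [y] with a minus sign. *)
pose f z : mode l := (b z, Negz (if z == x then c else col z)).
have cx' : (col x == c) = false by apply/negbTE; rewrite eq_sym ltn_eqF.
have e0 : form u (B (Negz (col x)) (Posz c) (mono [seq f z | z <- enum {: X}])) = 0.
  have e1 : B (Negz c) (Posz (col x)) u = 0 by apply: hu.1; lia.
  by have := form_B (Negz c) (Posz (col x)) u (mono [seq f z | z <- enum {: X}]);
    rewrite e1 form0l bar_pos bar_neg => <-.
move: e0; rewrite B_move ?enum_uniq // big_enum_cond (bigD1 x) /=; last by rewrite eqxx.
have -> : [seq (b z, Negz (if z == x then col x else if z == x then c else col z)) | z <- enum {: X}]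
    = cell_word b.
  by apply: eq_map => z; rewrite /cell_mode; case: eqP => [->|].
rewrite formDr form_sumr => /eqP; rewrite addr_eq0 => /eqP ->; rewrite -sumrN.
apply: eq_big => [y|y /eqP yc].
  case: (eqVneq y x) => [->|yx]; last by rewrite andbT.
  by rewrite eqxx cx' andbF.
have xy : x != y by apply/eqP => e; move: cx'; rewrite e yc eqxx.
set W := mono [seq _ | z <- _]; have -> : W = - mono (cell_word (pull b (tperm x y))).
  rewrite -(mono_tperm F (f := cell_mode (pull b (tperm x y))) _ xy) //; congr mono.
  apply: eq_map => z; rewrite /cell_mode ffunE tpermK; congr (_, Negz _).
  case: tpermP => [->|->|/eqP zx /eqP zy].
  - by rewrite (negbTE xy) eqxx yc.
  - by rewrite eqxx.
  - by rewrite (negbTE zx) (negbTE zy).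
by rewrite -scaleN1r formZr rmorphN1 mulN1r opprK.
Qed.

(** Pulling the two contracted fermions to the front exhibits the sum over species as an operator
    [B] with two creators, whose adjoint has positive degree and kills [u]. *)
Lemma coefs_traceless : is_traceless coefs.
Proof.
move=> x y a xy; rewrite contractionE; under eq_bigr => i _ do rewrite ffunE.
have yx : (y == x) = false by rewrite eq_sym (negbTE xy).
pose rest := rem y (rem x (enum {: X})).
pose e : C := (-1) ^+ seq.index x (enum {: X}) * (-1) ^+ seq.index y (rem x (enum {: X})).
have E i : mono (cell_word (upd2 a x y i (dix i))) =
    e *: fpsi (i, Negz (col x)) (fpsi (dix i, Negz (col y)) (mono [seq cell_mode a z | z <- rest])).
  have xe : x \in enum {: X} by rewrite mem_enum.
  have ye : y \in rem x (enum {: X}) by rewrite mem_rem_uniq ?enum_uniq // inE yx mem_enum.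
  rewrite /cell_word (mono_map_pull F _ xe) // (mono_map_pull F _ ye) //.
  rewrite linearZ scalerA; congr (_ *: _); rewrite /cell_mode !ffunE !eqxx yx.
  do 2!congr (fpsi _ _); congr mono; apply/eq_in_map => z.
  rewrite mem_rem_uniq ?rem_uniq ?enum_uniq // inE => /andP[zy].
  rewrite mem_rem_uniq ?enum_uniq // inE => /andP[zx _].
  by rewrite ffunE (negbTE zx) (negbTE zy).
under eq_bigr => i _ do rewrite E.
rewrite -form_sumr -scaler_sumr -/(B (Negz (col x)) (Negz (col y)) _) formZr.
have e1 : B (Posz (col y)) (Posz (col x)) u = 0 by apply: hu.1; lia.
have := form_B (Posz (col y)) (Posz (col x)) u (mono [seq cell_mode a z | z <- rest]).
by rewrite e1 form0l !bar_pos => <-; rewrite mulr0.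
Qed.

Lemma coefs_weyl : row_sum coefs \in weyl_space R m.
Proof.
set n := #|[pred t : {perm X} | column_perm t]|.
have n0 : (n%:R : C) != 0.
  rewrite pnatr_eq0 -lt0n; apply/card_gt0P; exists 1%g.
  by rewrite inE; apply/column_permP => x; rewrite perm1.
apply/weylP; exists (n%:R^-1 *: coefs).
  by apply: (subZ (traceless_subspace R m)); exact: coefs_traceless.
rewrite linearZ /= (column_alt_id coefs_anti) -/n -[X in _ *: X]scaler_nat scalerA mulVf //.
by rewrite scale1r.
Qed.

(** Words of another content are orthogonal to [u], and a word of the right content is, up to sign,
    the word of some index. *)
Lemma coefs_eq0 : coefs = 0 -> u = 0.
Proof.
move=> c0; apply: mono_total => w cw.
have [[n wn]|h] := pselect (exists n, content w n != columns n).
  exact: (form_mono_content hu.2 cw wn).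
have {}h n : content w n = columns n by apply/eqP/negPn/negP => ne; apply: h; exists n.
have [a pa] : exists a, perm_eq w (cell_word a).
  have pw : perm_eq [seq p.2 | p <- w] [seq Negz (col x) | x <- enum {: X}].
    apply/allP => k _ /=; apply/eqP; rewrite [LHS]count_map [RHS]count_map.
    case: k => n.
      rewrite [LHS](_ : _ = 0%N); last first.
        apply/eqP; rewrite -leqn0 leqNgt -has_count; apply/negP => /hasP[x xw /eqP /= xn].
        by have := allP cw x xw; rewrite xn.
      by apply/esym/eqP; rewrite -leqn0 leqNgt -has_count; apply/negP => /hasP[z _].
    rewrite -[LHS]/(content w n) h -(content_cell_word [ffun x => lshift l (rw x)]).
    by rewrite /content /cell_word count_map; apply: eq_count.
  (* The word is reordered so that its levels follow the enumeration of the cells; the species read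
     in that order form the index. *)
  have reord (s : seq (mode l)) (ks : seq int) : perm_eq [seq p.2 | p <- s] ks ->
      exists2 s', perm_eq s s' & [seq p.2 | p <- s'] = ks.
    elim: ks s => [|k ks IH] s ps; first by exists [::] => //; move/perm_nilP: ps; case: s.
    have /mapP[x xs kx] : k \in [seq p.2 | p <- s] by rewrite (perm_mem ps) inE eqxx.
    have [|s' ps' es'] := IH (rem x s).
      rewrite -(perm_cons k); apply: perm_trans ps; rewrite perm_sym kx.
      by rewrite -[x.2 :: _]/[seq p.2 | p <- x :: rem x s] perm_map // perm_to_rem.
    exists (x :: s'); last by rewrite /= es' kx.
    by apply: (perm_trans (perm_to_rem xs)); rewrite perm_cons.
  have [s' ps' es'] := reord _ _ pw.
  have sz : size s' = size (enum {: X}) by rewrite -(size_map snd) es' size_map.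
  exists [ffun x => (nth (lshift l (rw x), 0) s' (seq.index x (enum {: X}))).1].
  set a := finfun _; apply: (perm_trans ps'); suff -> : s' = cell_word a by [].
  rewrite /a {a}.
  case: s' ps' es' sz => [|d s'] _ es' sz.
    by move: sz; rewrite /cell_word; case: (enum {: X}).
  apply: (@eq_from_nth _ d) => [|k]; first by rewrite size_map sz.
  rewrite sz => kX; have [x0 _] : exists x0 : X, true.
    by move: kX; case: (enum {: X}) => [//|x0 e _]; exists x0.
  rewrite (nth_map x0) // /cell_mode ffunE index_uniq ?enum_uniq // [RHS]surjective_pairing /=.
  have : nth 0 [seq p.2 | p <- d :: s'] k = nth 0 [seq Negz (col x) | x <- enum {: X}] k by rewrite es'.
  rewrite (nth_map d) ?sz // (nth_map x0) // => <-.
  rewrite [nth (lshift _ _, _) _ _](set_nth_default d) ?sz //.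
  exact: surjective_pairing.
have [e ->] := mono_perm_eq F cw pa; rewrite formZr.
by have := congr1 (fun U : tens => U a) c0; rewrite !ffunE => ->; rewrite mulr0.
Qed.

End Surjective.

(* The coefficients on [mono (cell_word a)] of a highest weight vector orthogonal to the image
   of [omega] form a traceless tensor satisfying the column and exchange relations, and
   orthogonality kills its row symmetrization, so [garnir_eq0] applies. *)
Lemma omega_surj v : hwv columns v -> exists2 w, w \in weyl_space R m & omega w = v.
Proof.
move=> hv; pose P u := exists2 w, w \in weyl_space R m & omega w = u.
have PS : is_subspace P.
  split=> [|c _ _ [w ww <-] [w' ww' <-]]; first by exists 0; rewrite ?mem0v ?linear0.
  by exists (c *: w + w'); rewrite ?linearP // memvD ?memvZ.
pose s := [seq omega e | e <- vbasis (weyl_space R m)].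
have hs u : P u -> exists c : 'I_(size s) -> C, u = \sum_i c i *: s`_i.
  move=> [w ww <-]; have sz : size s = \dim (weyl_space R m) by rewrite size_map size_tuple.
  exists (fun i => coord (vbasis (weyl_space R m)) (cast_ord sz i) w).
  rewrite {1}(coord_vbasis ww) linear_sum [RHS](reindex _ (onW_bij _ (Bijective (cast_ordK (esym sz)) (cast_ordKV (esym sz))))).
  apply: eq_bigr => i _; rewrite linearZ /= (_ : cast_ord sz _ = i); last exact: val_inj.
  congr (_ *: _).
  by rewrite (nth_map 0) // size_tuple.
have [p [w ww <-] po] := ortho_proj PS hs v.
set u := v - omega w in po; have hu : hwv columns u.
  by apply: (subB (hwv_subspace F columns)) => //; exact: omega_hwv.
suff u0 : u = 0 by exists w => //; apply/esym/eqP; rewrite -subr_eq0 -/u u0.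
apply: (coefs_eq0 hu); apply: (garnir_eq0 m_sorted); split.
- exact: coefs_anti.
- exact: coefs_exchange.
apply: tdot_eq0; rewrite tdot_row_sum [X in X *+ _](_ : _ = 0) ?mul0rn //.
have : form u (omega (row_sum (coefs u))) = 0 by apply: po; exists (row_sum (coefs u)); first exact: coefs_weyl.
rewrite /omega form_sumr /tdot => {2}<-; apply: eq_bigr => a _.
by rewrite formZr mulrC ffunE.
Qed.

End Omega.
(** * Partitions and weights *)

Section Diagrams.
Variable l : nat.
Implicit Types (m : l.-tuple nat) (mu : nat -> nat).

Lemma count_initial (P : pred nat) K : (forall c, P c.+1 -> P c) ->
  (forall c, (K <= c)%N -> ~~ P c) -> forall c, (c < count P (iota 0 K))%N = P c.
Proof.
move=> dec fin.
have dec' c d : P (c + d)%N -> P c by elim: d => [|d IH]; rewrite ?addn0 // addnS => /dec.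
have [n Pn] : exists n, forall c, P c = (c < n)%N.
  have ex : exists c, ~~ P c by exists K; exact: fin.
  exists (ex_minn ex) => c; case: ex_minnP => n nPn h; apply/idP/idP => [Pc|cn].
    by rewrite ltnNge; apply: contra nPn => nc; apply: (dec' _ (c - n)%N); rewrite subnKC.
  by apply: contraLR cn => /h; rewrite -leqNgt.
have nK : (n <= K)%N by rewrite leqNgt -Pn; exact: fin.
suff -> : count P (iota 0 K) = n by move=> c; rewrite Pn.
rewrite (eq_count Pn) -(subnKC nK) iotaD count_cat add0n.
rewrite [X in (X + _)%N](eq_in_count (a2 := predT)) => [|c]; last by rewrite mem_iota.
rewrite count_predT size_iota [X in (_ + X)%N](eq_in_count (a2 := pred0)) ?count_pred0 ?addn0 // => c.
by rewrite mem_iota => /andP[nc _]; rewrite ltnNge nc.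
Qed.

Lemma columns_count m c : columns m c = count (fun r => c < nth 0 m r)%N (iota 0 l).
Proof.
transitivity (\sum_(r < l) \sum_(j < tnth m r | (j : nat) == c) 1)%N.
  rewrite (@sig_big_dep _ _ addn _ (fun r => 'I_(tnth m r)) predT (fun r j => (j : nat) == c) (fun _ _ => 1%N)).
  by rewrite /columns -sum1_card; apply: eq_bigl => x; rewrite inE.
have -> : iota 0 l = index_iota 0 l by rewrite /index_iota subn0.
rewrite -[RHS]sum1_count [RHS]big_mkcond /= big_mkord.
apply: eq_bigr => r _; rewrite big_mkcond /=.
rewrite -tnth_nth; case: ltnP => cr.
  by rewrite (bigD1 (Ordinal cr)) //= eqxx big1 // => j /negbTE; rewrite -val_eqE /= => ->.
by rewrite big1 // => j _; case: eqP => // jc; move: cr; rewrite -jc leqNgt ltn_ord.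
Qed.

Lemma sorted_nth m r : sorted geq m -> (nth 0 m r.+1 <= nth 0 m r)%N.
Proof.
move=> sm; have [rl|lr] := ltnP r.+1 l; last by rewrite nth_default // size_tuple.
by move/(sortedP 0): sm; apply; rewrite size_tuple.
Qed.

(** The Galois connection between a partition and its conjugate: both sides say that the diagram has
    a cell in row [r] and column [c]. *)
Lemma ltn_columns m r c : sorted geq m -> (r < columns m c)%N = (c < nth 0 m r)%N.
Proof.
move=> sm; rewrite columns_count (@count_initial (fun r => c < nth 0 m r)%N) // => {}r.
  by move=> h; apply: leq_trans h _; exact: sorted_nth.
by move=> lr; rewrite nth_default ?size_tuple.
Qed.

Lemma columns_inj m m' : sorted geq m -> sorted geq m' -> columns m =1 columns m' -> m = m'.
Proof.
move=> sm sm' e; apply: eq_from_tnth => r; rewrite !(tnth_nth 0).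
have h c : (c < nth 0 m r)%N = (c < nth 0 m' r)%N by rewrite -!ltn_columns ?e.
by have := h (nth 0 m r); have := h (nth 0 m' r); rewrite !ltnn; case: ltngtP.
Qed.

Lemma columns_le m c : (columns m c <= l)%N.
Proof. by rewrite columns_count (leq_trans (count_size _ _)) // size_iota. Qed.

Lemma columns_last m : (0 < l)%N -> sorted geq m -> (last 0 m == 0)%N = (columns m 0 < l)%N.
Proof.
move=> l0 sm; rewrite -nth_last size_tuple.
by rewrite -leqn0 leqNgt -ltn_columns // -leqNgt; lia.
Qed.

Lemma columns_surj mu K : (mu 0 <= l)%N -> (forall c, (mu c.+1 <= mu c)%N) ->
  (forall c, (K <= c)%N -> mu c = 0%N) -> exists2 m : l.-tuple nat, sorted geq m & columns m =1 mu.
Proof.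
move=> m0 dec fin; have mul c : (mu c <= l)%N by elim: c => // c /(leq_trans (dec c)).
pose f r := count (fun c => r < mu c)%N (iota 0 K).
have fE r c : (c < f r)%N = (r < mu c)%N.
  rewrite (@count_initial (fun c => r < mu c)%N) // => {}c; last by move/fin->.
  by move=> h; apply: leq_trans h _.
have sz : size (mkseq f l) == l by rewrite size_mkseq.
have nE r : (r < l)%N -> nth 0 (Tuple sz) r = f r by exact: nth_mkseq.
exists (Tuple sz) => [|c].
  apply/(sortedP 0) => r; rewrite size_tuple => rl; rewrite !nE // 1?ltnW //=.
  by apply: sub_count => c /= /ltnW.
rewrite columns_count (eq_in_count (a2 := fun r => (r < mu c)%N)) => [|r]; last first.
  by rewrite mem_iota => /= rl; rewrite nE ?fE.
have P r : (r < count (fun r => r < mu c)%N (iota 0 l))%N = (r < mu c)%N.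
  apply: (@count_initial (fun r => r < mu c)%N) => [d /ltnW //|d ld].
  by rewrite -leqNgt; exact: leq_trans (mul c) ld.
by have := P (mu c); have := P (count (fun r => r < mu c)%N (iota 0 l)); rewrite !ltnn; case: ltngtP.
Qed.

Definition hw_content (x : SigmaD l) : nat -> nat :=
  if (val x).2 then flip_content l (columns (val x).1) else columns (val x).1.

Lemma sorted_SigmaD (x : SigmaD l) : sorted geq (val x).1.
Proof. by have /andP[] := valP x. Qed.

Lemma SigmaD_last (x : SigmaD l) : (0 < l)%N -> (val x).2 -> (columns (val x).1 0 < l)%N.
Proof.
by move=> l0 x2; have /andP[sm /implyP/(_ x2)] := valP x; rewrite columns_last.
Qed.

(** The value at 0 separates the two kinds of labels: it is at most [l] without the twist and
    exceeds [l] with it. *)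
Lemma hw_content_inj (x y : SigmaD l) : (0 < l)%N -> hw_content x =1 hw_content y -> x = y.
Proof.
move=> l0 e; apply: val_inj; have := sorted_SigmaD x; have := sorted_SigmaD y.
have := SigmaD_last (x := x) l0; have := SigmaD_last (x := y) l0.
move: (e); rewrite /hw_content; move: (val x) (val y) => [m b] [m' b'] /= {}e h h' sm' sm.
have lm := columns_le m 0; have lm' := columns_le m' 0.
have e0 := e 0%N; rewrite /flip_content in e, e0.
case: b b' e e0 h h' => [] [] e e0 h h' /=.
- congr pair; apply: columns_inj => // -[|c]; last by have := e c.+1.
  by move: e0 => /=; lia.
- by have := h' isT; move: e0 => /=; lia.
- by have := h isT; move: e0 => /=; lia.
- by congr pair; exact: columns_inj.
Qed.

(** The hypothesis on [mu 1] is Weyl's condition on the first two columns; it makes the content a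
    partition again after the first column is complemented to [2l]. *)
Lemma hw_content_surj mu K : (0 < l)%N -> (forall c, (mu c.+1 <= mu c)%N) ->
  (mu 0 <= l + l)%N -> ((l < mu 0)%N -> (mu 1 <= l + l - mu 0)%N) ->
  (forall c, (K <= c)%N -> mu c = 0%N) -> exists x : SigmaD l, hw_content x =1 mu.
Proof.
move=> l0 dec mu0 mu1 fin; have [small|large] := leqP (mu 0) l.
  have [m sm cm] := columns_surj small dec fin.
  have Hx : sorted geq (m, false).1 && ((m, false).2 ==> (last 0 (m, false).1 == 0))%N by rewrite sm.
  by exists (exist _ (m, false) Hx).
have [|c|c Kc|m sm cm] := @columns_surj (flip_content l mu) K.+1.
- by rewrite /flip_content /= leq_subLR leq_add2r ltnW.
- by rewrite /flip_content; case: c => [|c] /=; [exact: mu1|exact: dec].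
- by rewrite /flip_content; case: c Kc => [|c] //= Kc; apply: fin; lia.
have Hx : sorted geq (m, true).1 && ((m, true).2 ==> (last 0 (m, true).1 == 0))%N.
  by rewrite sm columns_last // cm /flip_content /=; move: large mu0; clear -l0; move: (mu 0%N) => a; lia.
exists (exist _ (m, true) Hx) => c; rewrite /hw_content /flip_content /= !cm /flip_content.
by case: c => [|c] //=; move: mu0; clear; move: (mu 0%N) => a; lia.
Qed.

Lemma hw_content_fin (x : SigmaD l) c : (nth 0 (val x).1 0 < c)%N -> hw_content x c = 0%N.
Proof.
move=> h; have E : columns (val x).1 c = 0%N.
  apply/eqP; rewrite -leqn0 leqNgt ltn_columns -?leqNgt 1?ltnW //; exact: sorted_SigmaD.
by rewrite /hw_content /flip_content; case: ifP => // _; case: c h E.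
Qed.

End Diagrams.

(** * Power series identities for the highest weights *)

Section Series.
Variable R : realType.
Local Notation C := R[i].
Implicit Types (a b : C) (n : nat).

Lemma fps_mul_suml (I : Type) (s : seq I) (c : I -> C) (f : I -> fps R) (g : fps R) n :
  fps_mul (fun k => \sum_(i <- s) c i * f i k) g n = \sum_(i <- s) c i * fps_mul (f i) g n.
Proof.
rewrite /fps_mul; under [in RHS]eq_bigr => i _ do rewrite mulr_sumr.
rewrite exchange_big /=; apply: eq_bigr => k _; rewrite mulr_suml.
by apply: eq_bigr => i _; rewrite mulrA.
Qed.

Lemma sinh_mul a b n : fps_mul (sinh_fps a) (fun k => 2 * sinh_fps b k) n =
  cosh_fps (a + b) n - cosh_fps (a - b) n.
Proof.
rewrite /fps_mul /cosh_fps /sinh_fps; case: ifP => on.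
  rewrite subrr big1 // => i _; case: ifP => oi; last by rewrite mul0r.
  by rewrite oddB ?on ?oi //= ?mulr0 // -ltnS.
rewrite -mulrBl [a + b]addrC [a - b]addrC !exprDn -sumrB mulr_suml; apply: eq_bigr => i _.
have iLn : (i <= n)%N by rewrite -ltnS.
rewrite oddB // on /= -mulrnBl -mulrBl exprNn -signr_odd oddB // on /=.
case: ifP => oi; last by rewrite mul0r expr0 mul1r subrr mul0r mul0rn mul0r.
rewrite expr1 mulN1r opprK -[_ *+ 'C(n, i)]mulr_natr.
have -> : 'C(n, i)%:R = n`!%:R / (i`!%:R * (n - i)`!%:R) :> C.
  rewrite -(bin_fact iLn) natrM natrM mulfK // mulf_neq0 // pnatr_eq0 -lt0n fact_gt0 //.
have f0 k : (k`!%:R : C) != 0 by rewrite pnatr_eq0 -lt0n fact_gt0.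
by field; rewrite !f0.
Qed.

Lemma cosh_fps0 n : cosh_fps (0 : C) n = (n == 0%N)%:R.
Proof.
rewrite /cosh_fps; case: n => [|n]; first by rewrite expr0 fact0 divr1.
by rewrite expr0n mul0r if_same.
Qed.

(** By [sinh_mul] the term of index [c] is the coefficient of [cosh((c+1)x) - cosh(c x)]. *)
Lemma sinh_telescope n k :
  \sum_(c < k) fps_mul (sinh_fps (c%:R + 2^-1 : C)) (fun k => 2 * sinh_fps 2^-1 k) n =
  cosh_fps k%:R n - (n == 0%N)%:R.
Proof.
rewrite -cosh_fps0; elim: k => [|k IH]; first by rewrite big_ord0 subrr.
rewrite big_ord_recr /= IH sinh_mul addrK (_ : k%:R + 2^-1 + 2^-1 = k.+1%:R); last by rewrite -natr1; field.
by rewrite addrC addrA subrK.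
Qed.

Lemma sum_undup (V : zmodType) (T : eqType) (s : seq T) (f : T -> V) :
  \sum_(x <- s) f x = \sum_(x <- undup s) f x *+ count_mem x s.
Proof.
rewrite [RHS](eq_bigr (fun x => \sum_(y <- s) (if y == x then f y else 0))) => [|x _]; last first.
  rewrite -[in RHS]big_mkcond /= (eq_bigr (fun=> f x)) => [|y /eqP -> //].
  by rewrite big_const_seq iter_addr_0.
rewrite exchange_big /=; apply: eq_big_seq => y ys.
rewrite (bigD1_seq y) ?undup_uniq ?mem_undup //= eqxx big1 ?addr0 //.
by move=> x /negbTE; rewrite eq_sym => ->.
Qed.

End Series.

Section Weight.
Variables (R : realType) (l : nat).
Local Notation C := R[i].

(** A fermion on level [n] has mode index [-(n+1)] and contributes the value of [f] there, as
    [act_psi] shows for degree 0. The functional is extended by zero to the other degrees of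
    [Dalg]. *)
Definition weight (mu : nat -> nat) (K : nat) (a : Dhat R) : C^o :=
  a.2 * l%:R + \sum_(n < K) (a.1 0).[- n.+1%:R] * (mu n)%:R.

Lemma weight_linear mu K : linear (weight mu K).
Proof.
move=> c a b; rewrite /weight scalerDr addrACA; congr (_ + _).
  by rewrite -[(_ + _).2]/(c * a.2 + b.2) mulrDl -mulrA.
rewrite scaler_sumr -big_split; apply: eq_bigr => n _.
by rewrite (_ : (c *: a + b).1 0 = c *: a.1 0 + b.1 0) // hornerD hornerZ mulrDl -mulrA.
Qed.
HB.instance Definition _ mu K := GRing.isLinear.Build C (Dhat R) C^o *:%R (weight mu K) (weight_linear mu K).

Lemma weight_seriesE mu K n : weight_series (weight mu K) n =
  \sum_(c <- iota 0 K) (mu c)%:R * sinh_fps (c%:R + 2^-1) n.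
Proof.
rewrite /weight_series /sinh_fps; case: ifP => on; last by rewrite big1 // => c _; rewrite mulr0.
rewrite /weight mul0r add0r -[dirsum_at _ 0]/(tD 0 (('X + (2^-1)%:P) ^+ n) 0) tDE eqxx.
have -> : iota 0 K = index_iota 0 K by rewrite /index_iota subn0.
rewrite big_mkord mulr_suml -sumrN; apply: eq_bigr => c _.
rewrite horner_exp hornerD hornerX hornerC.
have -> : - c.+1%:R + 2^-1 = - (c%:R + 2^-1) :> C.
  by rewrite -natr1 !opprD -addrA; congr (_ + _); field.
by rewrite exprNn -signr_odd on expr1 mulN1r mulNr mulNr opprK mulrAC mulrC mulrA.
Qed.

(** Counting cells by rows instead of columns, a row of length [k] collects the terms [c < k], which
    telescope. *)
Lemma weight_columns (m : l.-tuple nat) K n : (forall r, nth 0 m r <= K)%N ->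
  \sum_(c <- iota 0 K) (columns m c)%:R *
     fps_mul (sinh_fps (c%:R + 2^-1 : C)) (fun k => 2 * sinh_fps 2^-1 k) n =
  \sum_(k <- m) (cosh_fps k%:R n - (n == 0%N)%:R).
Proof.
move=> mK; have -> : iota 0 K = index_iota 0 K by rewrite /index_iota subn0.
rewrite [RHS](big_nth 0%N) size_tuple !big_mkord /=.
pose S (c : nat) : C := fps_mul (sinh_fps (c%:R + 2^-1 : C)) (fun k => 2 * sinh_fps 2^-1 k) n.
rewrite [RHS](eq_bigr (fun r : 'I_l => \sum_(c < K) if (c < nth 0%N m r)%N then S c else 0)) => [|r _]; last first.
  by rewrite -sinh_telescope (big_ord_widen K S) // big_mkcond.
rewrite exchange_big; apply: eq_bigr => c _ /=.
rewrite columns_count -sum1_count natr_sum mulr_suml.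
have -> : iota 0 l = index_iota 0 l by rewrite /index_iota subn0.
by rewrite big_mkord big_mkcond; apply: eq_bigr => r _; case: ifP; rewrite ?mul1r.
Qed.

(** With [j] the length of the first column, complementing it adds [2l - 2j] cells, each
    contributing one exponent 1; this accounts for [2l - i - j = (j - i) + (2l - 2j)]. *)
Lemma weight_numeratorE (x : SigmaD l) n : (0 < l)%N ->
  weight_numerator (e_exponents R x) n =
  \sum_(k <- (val x).1) (cosh_fps k%:R n - (n == 0%N)%:R)
  + (if (val x).2 then (l + l - columns (val x).1 0 - columns (val x).1 0)%:R else 0)
    * (cosh_fps (1 : C) n - (n == 0%N)%:R).
Proof.
move=> l0; rewrite /weight_numerator /e_exponents big_cat big_map big_seq1 /=.
set m := (val x).1; set G := fun k : nat => cosh_fps (k%:R : C) n - (n == 0%N)%:R.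
have c0 : columns m 0 = count (fun k => 0 < k)%N m.
  rewrite columns_count -[in RHS](mkseq_nth 0 m) size_tuple count_map; exact: eq_count.
have jl := columns_le m 0; rewrite c0 in jl *.
set i := count (fun k => 1 < k)%N m; set j := count (fun k => 0 < k)%N m in jl *.
have ji : j = (i + count (pred1 1%N) m)%N.
  by rewrite /j /i; elim: (tval m) => //= k s ->; case: k => [|[|k]] /=; lia.
have E : \sum_(k <- m) G k = \sum_(k <- undup [seq k <- m | (1 < k)%N]) (count_mem k m)%:R * G k
    + (j - i)%:R * G 1%N.
  rewrite (bigID (fun k => 1 < k)%N) -big_filter sum_undup /=; congr (_ + _).
    apply: eq_big_seq => k; rewrite mem_undup mem_filter => /andP[k1 _].
    rewrite mulr_natl count_filter; congr (_ *+ _); apply: eq_count => k' /=.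
    by case: eqP => // ->.
  have -> : (j - i)%N = count (pred1 1%N) m by rewrite ji addKn.
  rewrite [LHS](bigID (pred1 1%N)) /= [X in _ + X]big1 ?addr0 => [|k].
    rewrite (eq_big (pred1 1%N) (fun=> G 1%N)) => [|k|k /andP[_ /eqP ->] //].
      by rewrite big_const_seq iter_addr_0 mulr_natl.
    by rewrite andb_idl // => /eqP ->.
  by case: k => [|[|k]] //= _; rewrite /G cosh_fps0 subrr.
rewrite E -!addrA; congr (_ + _); rewrite /G -mulrDl; congr (_ * _).
case: (sval x).2; last by rewrite addr0.
rewrite -natrD; congr _%:R; rewrite mulnC muln2 -addnn; move: ji jl; clear; lia.
Qed.

Lemma has_weight_exponents (x : SigmaD l) : (0 < l)%N ->
  has_weight (e_exponents R x) l%:R (weight (hw_content x) (nth 0 (val x).1 0).+1).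
Proof.
move=> l0; set K := (nth 0 _ 0).+1; split=> [|n].
  rewrite /weight mul1r big1 ?addr0 // => c _.
  by rewrite [dirsum_at _ _](_ : _ = 0) // horner0 mul0r.
set T := fun k => 2 * sinh_fps 2^-1 k.
transitivity (\sum_(c <- iota 0 K) (hw_content x c)%:R * fps_mul (sinh_fps (c%:R + 2^-1 : C)) T n).
  rewrite -fps_mul_suml /fps_mul; apply: eq_bigr => i _; by rewrite weight_seriesE.
have mK r : (nth 0 (val x).1 r <= K)%N.
  apply: leqW; elim: r => // r; apply: leq_trans; exact: sorted_nth (sorted_SigmaD x).
rewrite weight_numeratorE // -(weight_columns n mK) /hw_content.
case: ifP => x2; last by rewrite mul0r addr0.
have <- : fps_mul (sinh_fps (0%:R + 2^-1 : C)) T n = cosh_fps 1 n - (n == 0%N)%:R.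
  by rewrite -[1]/(1%:R) -sinh_telescope big_ord1.
rewrite /= !big_cons /= addrAC -mulrDl -natrD /flip_content /= subnKC.
  congr (_ + _); apply: eq_big_seq => c; rewrite mem_iota; by case: c.
by have := SigmaD_last l0 x2; clear; move: (columns _ _) => c; lia.
Qed.

End Weight.

Lemma sum_irange (V : zmodType) (g : int -> V) N :
  \sum_(j <- irange N) g j = \sum_(n < N.+1) g (- n%:Z) + \sum_(n < N) g n.+1%:Z.
Proof.
have e k : iota 0 k = index_iota 0 k by rewrite /index_iota subn0.
rewrite (perm_big ([seq - n%:Z | n <- iota 0 N.+1] ++ [seq n.+1%:Z | n <- iota 0 N])).
  by rewrite big_cat !big_map !e !big_mkord.
apply: uniq_perm => [||j]; first exact: irange_uniq.
  rewrite cat_uniq !map_inj_uniq ?iota_uniq => [|p q []|p q] //; last by lia.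
  by rewrite andbT; apply/hasPn => _ /mapP[n _ ->]; apply/mapP => -[k _]; lia.
rewrite mem_irange mem_cat; apply/idP/orP => [jN|[] /mapP[n]].
- case: j jN => n nN; [|left; apply/mapP; exists n.+1 => //; by rewrite mem_iota; lia].
  case: n nN => [|n] nN; [left|right]; apply/mapP; first by exists 0%N.
  by exists n => //; rewrite mem_iota; lia.
- by rewrite mem_iota => h ->; lia.
- by rewrite mem_iota => h ->; lia.
Qed.

Section WeightVectors.
Variables (R : realType) (l : nat) (F : fock_space R l).
Local Notation act := (@fock_Dact R l F).

Lemma act_singular k (a : Dhat R) v : singular v -> 0 < k -> homogeneous k a -> act a v = 0.
Proof.
move=> sv k0 [ak ac]; have [N /(_ _ (leqnn N)) ->] := fock_Dact_cut a v.
rewrite /Dact_cut ac ?gt_eqF // mul0r scale0r add0r big1 // => r _.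
have [->|/eqP rk] := eqVneq r k; last first.
  by rewrite big1 ?scaler0 // => j _; rewrite ak ?horner0 ?scale0r //; apply/eqP.
rewrite big1 ?scaler0 // => j _; rewrite /nB sv; last by lia.
by rewrite (_ : _ && _ = false) ?mul0r ?scale0r ?subrr ?scaler0 // /bar; lia.
Qed.

(** The terms with [j <= 0] and those with [j > 0] give the same sum over levels, by the symmetry of
    [f] and the antisymmetry of [nB]; this cancels the factor 1/2. *)
Lemma act_weight mu K (a : Dhat R) v : hwv mu v -> (forall n, (K <= n)%N -> mu n = 0%N) ->
  Dplus a -> homogeneous 0 a -> act a v = (weight l mu K a : R[i]) *: v.
Proof.
move=> [sv cv] fin pa [ak _]; have [N0 /(_ (N0 + K)%N (leq_addr _ _)) ->] := fock_Dact_cut a v.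
set N := (N0 + K)%N; rewrite /Dact_cut /weight scalerDl; congr (_ + _).
rewrite (bigD1_seq 0) ?irange_uniq ?mem_irange //= [X in _ + X]big1 ?addr0 => [|k k0]; last first.
  by rewrite big1 ?scaler0 // => j _; rewrite ak // horner0 scale0r.
have nBv n : nB (Negz n) (Posz n) v = (mu n)%:R *: v by rewrite /nB /= mul0r scale0r subr0 cv.
have muK n : (K <= n)%N -> (mu n)%:R *: v = 0 by move=> /fin ->; rewrite scale0r.
have sa := Dplus_sym 0 pa; set f := a.1 0 in sa *.
pose S := \sum_(n < N) (f.[- n.+1%:R] * (mu n)%:R) *: v.
rewrite sum_irange [X in X + _](_ : _ = S); last first.
  (* The nonpositive half has one more term, at level [N], where the content vanishes because
     [K <= N]. *)
  rewrite big_ord_recr /= [X in _ + X](_ : _ = 0) ?addr0.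
    apply: eq_bigr => n _; rewrite -scalerA -nBv.
    have -> : 0 - - n%:Z = Posz n by lia.
    have -> : - n%:Z - 1 = Negz n by rewrite NegzE; lia.
    rewrite nB_swap scalerN -scaleNr -sa; congr (_.[_] *: _).
    by rewrite rmorphN /= opprK -natr1 opprD mulr0z; ring.
  have -> : 0 - - N%:Z = Posz N by lia.
  have -> : - N%:Z - 1 = Negz N by rewrite NegzE; lia.
  by rewrite nB_swap nBv muK ?oppr0 ?scaler0 // leq_addl.
rewrite [X in _ + X](_ : _ = S); last first.
  apply: eq_bigr => n _; rewrite -scalerA -nBv; congr (_ *: nB _ _ v); last by lia.
  by rewrite NegzE; lia.
have -> : S + S = (2 : R[i]) *: S by rewrite scaler_nat mulr2n.
rewrite scalerA mulVf ?pnatr_eq0 // scale1r /S -scaler_suml; congr (_ *: _).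
rewrite [RHS](big_ord_widen N (fun n : nat => f.[- n.+1%:R] * (mu n)%:R)) ?leq_addl // [RHS]big_mkcond.
apply: eq_bigr => n _; case: ltnP => // /fin ->; by rewrite mulr0.
Qed.

End WeightVectors.

Section Highest.
Variables (R : realType) (l : nat) (F : fock_space R l).
Local Notation C := R[i].
Local Notation B := (@B R l F).
Local Notation mono := (@mono R l F).
Local Notation flip := (@flip R l F).
Implicit Types (x : SigmaD l) (v : F).

Lemma hwv_ext mu nu v : mu =1 nu -> hwv mu v -> hwv nu v.
Proof. by move=> e [sv cv]; split=> // n; rewrite -e. Qed.

Section Top.
Variable m : l.-tuple nat.
Local Notation X := (cell m).

(* Only [psi^+] modes occur, and the cells of a row fill an initial segment of levels. *)
Definition top_word := cell_word [ffun x : X => lshift l (rw x)].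

Lemma top_word_creations : creations top_word.
Proof. exact: cell_word_creations. Qed.

Lemma top_word_uniq : uniq top_word.
Proof.
rewrite map_inj_uniq ?enum_uniq // => x y [] /=; rewrite /cell_mode !ffunE => /lshift_inj rxy cxy.
exact: cell_eq.
Qed.

Lemma top_word_rshift k n : (rshift l k, n) \notin top_word.
Proof. by apply/mapP => -[x _ []]; rewrite ffunE => /eqP; rewrite eq_rlshift. Qed.

Lemma mono_top_neq0 : mono top_word != 0.
Proof.
apply/eqP => t0; have := form_mono F top_word_creations top_word_uniq.
by rewrite t0 form0l; move: (form_gt0 (vac_neq0 F)) => /[swap] <-; rewrite ltxx.
Qed.

(** A fermion moved to an earlier level of its row meets one of the same species already there. *)
Lemma top_raise n k : (n < k)%N -> B (Negz n) (Posz k) (mono top_word) = 0.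
Proof.
move=> nk; rewrite /top_word /cell_word B_move ?enum_uniq // big_enum_cond big1 // => x /eqP xk.
have nx : (n < tnth m (rw x))%N by apply: ltn_trans nk _; rewrite -xk; exact: ltn_ord.
pose y : X := Tagged (fun r => 'I_(tnth m r)) (Ordinal nx).
have yx : y != x by apply/eqP => e; move: nk; rewrite -xk -e /= ltnn.
apply: mono_nuniq; first exact: creations_map.
apply: contra yx => u; apply/eqP; pose f z : mode l :=
  ([ffun x : X => lshift l (rw x)] z, Negz (if z == x then n else col z)).
have /injectiveP inj : injectiveb f by [].
by apply: inj; rewrite /f !ffunE eqxx if_same.
Qed.

(** Each term annihilates one psi^+ and one psi^- fermion, and the word contains none of the
    latter. *)
Lemma top_trace n k : B (Posz n) (Posz k) (mono top_word) = 0.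
Proof.
apply: big1 => a _; case: (split_ordP a) => i ->.
  rewrite dix_lshift fpsiC star_pair bar_pos [fpsi (lshift l i, _) _]mono_annih ?top_word_creations //.
    by rewrite linear0 subr0 andbF scale0r.
  by rewrite /star dix_lshift top_word_rshift.
rewrite dix_rshift [fpsi (lshift l i, _) _]mono_annih ?linear0 ?top_word_creations //.
by rewrite /star dix_lshift top_word_rshift.
Qed.

Lemma top_hwv : hwv (columns m) (mono top_word).
Proof.
split=> [|n]; last by rewrite (mono_content F top_word_creations) content_cell_word.
case=> p; case=> q pq.
- exact: top_trace.
- rewrite B_swap; have -> : (Negz q == bar (Posz p)) = false by rewrite bar_pos; apply/eqP => -[]; lia.
  by rewrite mul0r scale0r sub0r top_raise ?oppr0 //; lia.
- by rewrite top_raise //; lia.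
- by move: pq; rewrite !NegzE; lia.
Qed.

End Top.

Definition embed x (w : VO R x) : F :=
  if (val x).2 then flip (omega F (vsval w)) else omega F (vsval w).

Lemma embed_linear x : linear (@embed x).
Proof. by move=> c w w'; rewrite /embed; case: ifP => _; rewrite !linearP. Qed.
HB.instance Definition _ x := GRing.isLinear.Build C (VO R x) F *:%R (@embed x) (@embed_linear x).

(** An explicit monomial, exchanged in the twisted case, shows that every label occurs. *)
Lemma top_exists x : exists v, hwv (hw_content x) v /\ v != 0.
Proof.
rewrite /hw_content; case: ifP => x2; last first.
  by exists (mono (top_word (val x).1)); split; [exact: top_hwv|exact: mono_top_neq0].
exists (flip (mono (top_word (val x).1))); split.
  by apply: flip_hwv (top_hwv _); rewrite (leq_trans (columns_le _ _)) ?leq_addr.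
by apply/eqP => /flip_inj /eqP; rewrite (negbTE (mono_top_neq0 _)).
Qed.

Lemma embed_hwv x (w : VO R x) : hwv (hw_content x) (embed w).
Proof.
have hw := omega_hwv F (sorted_SigmaD x) (valP w); rewrite /embed /hw_content; case: ifP => // _.
by apply: flip_hwv hw; rewrite (leq_trans (columns_le _ _)) ?leq_addr.
Qed.

Lemma embed_eq0 x (w : VO R x) : embed w = 0 -> w = 0.
Proof.
move=> w0; have e : vsval w = 0.
  apply: (omega_inj (F := F) (valP w)).
  by move: w0; rewrite /embed; case: ifP => // _; exact: flip_inj.
by apply: val_inj; rewrite -[LHS]/(vsval w) e -[RHS]/(vsval 0) linear0.
Qed.

(** In the twisted case [flip v] has small columns and comes from a tensor; [flip] is its own
    inverse up to the scalar of [flip_flip], which is divided out. *)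
Lemma embed_surj x v : hwv (hw_content x) v -> exists w : VO R x, embed w = v.
Proof.
have srt := sorted_SigmaD x; rewrite /embed /hw_content; case: ifP => x2 hv; last first.
  by have [w ww <-] := omega_surj srt hv; exists (vsproj _ w); rewrite vsprojK.
have cl := columns_le (val x).1 0.
have hf : hwv (columns (val x).1) (flip v).
  have le : (flip_content l (columns (val x).1) 0 <= l + l)%N by rewrite /flip_content /= leq_subr.
  apply: hwv_ext (flip_hwv le hv) => -[|n] //.
  by rewrite /flip_content /= subKn // (leq_trans cl) ?leq_addr.
have [w ww wv] := omega_surj srt hf; have [a a0 ff] := flip_flip F.
exists (vsproj _ (a^-1 *: w)); rewrite vsprojK ?memvZ // 2!linearZ /= wv ff scalerA mulVf //.
by rewrite scale1r.
Qed.

Lemma embed_rho (rho : 'M[C]_(l + l) -> F -> F) g x (w : VO R x) : is_fock_Oact rho -> O2l g ->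
  rho g (embed w) = embed (VO_act g w).
Proof.
move=> Hrho og; have E : vsval (weyl_act g w) = tensors_act g (vsval w).
  by rewrite vsprojK // weyl_stable // (valP w).
rewrite /embed /VO_act; case: ifP => x2; last by rewrite scale1r E omega_rho.
by rewrite flip_rho // omega_rho // !linearZ /= E.
Qed.

Lemma hwv_embedded mu K v : (0 < l)%N -> hwv mu v -> (forall n, (K <= n)%N -> mu n = 0%N) ->
  exists x (w : VO R x), embed w = v.
Proof.
move=> l_gt0; have [-> _ _|vn0 hv fin] := eqVneq v 0.
  have s : sorted geq ([tuple of nseq l 0], false).1 && (([tuple of nseq l 0], false).2 ==> (last 0 ([tuple of nseq l 0], false).1 == 0))%N.
    by rewrite andbT; apply/(sortedP 0%N) => i; rewrite !nth_nseq !if_same.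
  by exists (exist _ ([tuple of nseq l 0], false) s), 0; rewrite linear0.
have m0 := content_le 0 hv.2 vn0.
have [x xmu] : exists x : SigmaD l, hw_content x =1 mu.
  apply: (hw_content_surj (K := K)) => // [c|_]; first exact: dominant hv.2 hv.1 vn0.
  (* Dominance of [flip v] between levels 0 and 1 is the bound [mu 1 <= 2l - mu 0]. *)
  have [sf cf] := flip_hwv m0 hv.
  have fn0 : flip v != 0 by apply/eqP => /flip_inj /eqP; rewrite (negbTE vn0).
  exact: dominant 0%N cf sf fn0.
by have [|w wv] := @embed_surj x v; [apply: hwv_ext hv => n; rewrite xmu|exists x, w].
Qed.

End Highest.
(** * The decomposition *)

Section Summands.
Variables (R : realType) (l : nat) (F : fock_space R l).
Local Notation C := R[i].
Local Notation B := (@B R l F).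
Local Notation act := (@fock_Dact R l F).
Implicit Types (x : SigmaD l) (v : F).

Lemma subspace_act (P : F -> Prop) (a : Dhat R) v : is_subspace P ->
  (forall p q, P (B p q v)) -> P v -> P (act a v).
Proof.
move=> PS PB Pv; have [N /(_ _ (leqnn N)) ->] := fock_Dact_cut a v.
rewrite /Dact_cut; apply: (subD PS); first exact: (subZ PS).
apply: (sub_sum PS) => k _; apply: (subZ PS); apply: (sub_sum PS) => j _; apply: (subZ PS).
by rewrite /nB; apply: (subB PS) => //; exact: (subZ PS).
Qed.

Definition highest x : F := projT1 (cid (top_exists F x)).

Lemma highest_hwv x : hwv (hw_content x) (highest x).
Proof. by case: (projT2 (cid (top_exists F x))). Qed.

Lemma highest_neq0 x : highest x != 0.
Proof. by case: (projT2 (cid (top_exists F x))). Qed.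

Definition in_summand x : pred F := fun y => `[< lower B (highest x) y >].

Lemma in_summand_submod x : submod_closed (in_summand x).
Proof.
have S := lower_subspace B (highest x); split=> [|c u v /asboolP lu /asboolP lv]; apply/asboolP.
  exact: (sub0 S).
exact: (subL S).
Qed.
HB.instance Definition _ x := GRing.isSubmodClosed.Build C F (in_summand x) (in_summand_submod x).

Record summand x := Summand { summand_val : F; _ : summand_val \in in_summand x }.
HB.instance Definition _ x := [isSub for @summand_val x].
HB.instance Definition _ x := [Choice of summand x by <:].
HB.instance Definition _ x := [SubChoice_isSubLmodule of summand x by <:].

Lemma summandP x (y : summand x) : lower B (highest x) (val y).
Proof. by have /asboolP := valP y. Qed.

Lemma lower_act x (a : Dhat R) y : lower B (highest x) y -> lower B (highest x) (act a y).
Proof.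
move=> ly; apply: (subspace_act _ (lower_subspace B (highest x))) => // p q.
exact: lower_B (highest_hwv x) ly.
Qed.

Lemma summand_act_subproof x (a : Dhat R) (y : summand x) : act a (val y) \in in_summand x.
Proof. by apply/asboolP/lower_act/summandP. Qed.

Definition summand_act x (a : Dhat R) (y : summand x) : summand x :=
  Summand (summand_act_subproof a y).

Lemma summand_actP x : is_Dplus_action (@summand_act x).
Proof.
have [_ h2 h3] := @fock_Dact_action R l F.
split=> [a pa c u v|c a b v pa pb|a b v pa pb]; apply: val_inj.
- have E : val (c *: u + v) = c *: val u + val v by exact: linearP.
  rewrite [RHS]linearP -[LHS]/(act a (val (c *: u + v))) E; exact: fock_Dact_linear.
- rewrite [RHS]linearP -[LHS]/(act (c *: a + b) (val v)); exact: h2.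
- rewrite [RHS]linearB -[LHS]/(act (lie a b) (val v)); exact: h3.
Qed.

Definition Lmod x : Dplus_module R := DplusModule (summand_actP x).

Lemma highest_in_summand x : highest x \in in_summand x.
Proof. by apply/asboolP; exact: lower_base. Qed.

Definition top x : summand x := Summand (highest_in_summand x).

Lemma top_neq0 x : top x != 0.
Proof.
apply: contraNneq (highest_neq0 x) => e; apply/eqP.
by rewrite -[LHS]/(val (top x)) e linear0.
Qed.

Lemma Lmod_irreducible x : irreducible_Dplus (Lmod x).
Proof.
have hh := highest_hwv x.
split; first by exists (top x); exact: top_neq0.
move=> P PS Pact [u Pu un0] y.
pose Q (z : F) := exists2 y : Lmod x, P y & val y = z.
suff [y' Py' /val_inj <-] : Q (val y) by [].
apply: (lower_irreducible hh) (summandP y).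
- split=> [|c _ _ [y1 P1 <-] [y2 P2 <-]]; first by exists 0; [exact: PS.1|].
  by exists (c *: y1 + y2); [exact: PS.2|].
(* On this one vector [nB p q] is the action of an element of the subalgebra; the constant [c]
   undoes the normal ordering. *)
- move=> p q _ [z Pz <-] _; have [M bM] := bounded_exists (val z).
  have [a [pa _ /(_ _ bM) az]] := Dplus_dense F p q M.
  pose c := ((0 <= p) && (q == bar p))%:R * (l + l)%:R : C.
  exists (c *: z + Dmod_act a z); first by apply: PS.2 => //; exact: Pact.
  by rewrite linearP /= az /nB addrC subrK.
- by exists (val u); [split; [exists u|exact: summandP]|rewrite -(inj_eq val_inj) in un0].
Qed.

Lemma Lmod_is_Lmodule x : (0 < l)%N -> is_Lmodule (e_exponents R x) l%:R (Lmod x).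
Proof.
move=> l0; split; first exact: Lmod_irreducible.
have hh := highest_hwv x.
exists (weight l (hw_content x) (nth 0 (val x).1 0).+1 : {linear Dhat R -> C^o}), (top x).
split; first exact: has_weight_exponents.
split=> [|k a k0 pa ha|a pa ha].
- exact: top_neq0.
- apply: val_inj; rewrite linear0; exact: (act_singular hh.1 k0 ha).
- apply: val_inj; rewrite [RHS]linearZ; exact: (act_weight hh (@hw_content_fin _ x) pa ha).
Qed.

End Summands.

Section TransferLinear.
Variables (R : realType) (l : nat) (F : fock_space R l) (mu : nat -> nat) (v s : F).
Hypotheses (hv : hwv mu v) (v0 : v != 0) (hs : hwv mu s).

Lemma transfer0 : transfer mu v s 0 = 0.
Proof.
have l0 := sub0 (lower_subspace (@B R l F) v).
by rewrite -{1}(addNr (0 : F)) -scaleN1r (transfer_lin hv v0) // scaleN1r addNr.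
Qed.

Lemma transferZ c y : lower (@B R l F) v y -> transfer mu v s (c *: y) = c *: transfer mu v s y.
Proof.
move=> ly; rewrite -[c *: y]addr0 (transfer_lin hv v0) ?transfer0 ?addr0 //.
exact: sub0 (lower_subspace _ _).
Qed.

End TransferLinear.

(** Tuples satisfying the relation are stable under the diagonal action of the operators [B]. If one
    is nonzero, a lowest one consists of multiples [c i *: v i], and the relation becomes a linear
    dependence of the vectors [s i]. *)
Lemma transfer_independent (R : realType) (l : nat) (F : fock_space R l) (I : finType)
    (mu : I -> nat -> nat) (v s u : I -> F) :
  (forall i, hwv (mu i) (v i)) -> (forall i, v i != 0) -> (forall i, hwv (mu i) (s i)) ->
  (forall c : I -> R[i], \sum_i c i *: s i = 0 -> forall i, c i = 0) ->
  (forall i, lower (@B R l F) (v i) (u i)) -> \sum_i transfer (mu i) (v i) (s i) (u i) = 0 ->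
  forall i, u i = 0.
Proof.
move=> hv v0 hs free lu su; have [u0 i|un0] := eqVneq (finfun u) 0.
  by have := congr1 (fun f : {ffun I -> F} => f i) u0; rewrite !ffunE.
pose P (f : {ffun I -> F}) := (forall i, lower (@B R l F) (v i) (f i)) /\
  \sum_i transfer (mu i) (v i) (s i) (f i) = 0.
have [||||||f [[lf sf] fn0 low]] := @lowest_exists _ {ffun I -> F}
  (fun p q f => [ffun i => B p q (f i)]) (fun N f => forall i, below N (f i)) P (finfun u) => //.
- by move=> N f N0 bf; apply/ffunP => i; rewrite [RHS]ffunE; exact: below_neg N0 (bf i).
- by move=> N p q f bf i; rewrite ffunE; exact: below_B.
- move=> p q f [lf sf]; split=> [i|]; first by rewrite ffunE; exact: lower_B (hv i) (lf i).
  under eq_bigr => i _ do rewrite ffunE (transfer_B (hv i)) //.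
  by rewrite -linear_sum sf linear0.
- pose N i := projT1 (cid (below_exists (u i))); exists (\max_i N i)%N => i; rewrite ffunE.
  by apply: belowS (projT2 (cid (below_exists (u i)))); rewrite lez_nat; exact: (leq_bigmax i).
- by split=> [i|]; [rewrite ffunE|under eq_bigr => i _ do rewrite ffunE].
have sing i : exists a, f i = a *: v i.
  apply: (lower_singular (hv i) (lf i)) => p q pq.
  by have := congr1 (fun g : {ffun I -> F} => g i) (low p q pq); rewrite !ffunE.
pose c i := projT1 (cid (sing i)); have fc i : f i = c i *: v i := projT2 (cid (sing i)).
have c0 : forall i, c i = 0.
  apply: free; rewrite -[RHS]sf; apply: eq_bigr => i _.
  by rewrite fc (transferZ (hv i)) ?(transfer_base (hv i)) //; exact: lower_base.
by case/eqP: fn0; apply/ffunP => i; rewrite fc c0 scale0r ffunE.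
Qed.

(** * The isomorphism with the sum of tensor products *)

Section Duality.
Variables (R : realType) (l : nat) (F : fock_space R l).
Local Notation C := R[i].
Local Notation B := (@B R l F).
Local Notation act := (@fock_Dact R l F).
Local Notation sigma := (SigmaD l).
Hypothesis l_gt0 : (0 < l)%N.
Implicit Types (x : sigma) (v : F).

Definition summand_tensor x : lmodType C := tensor (VO R x) (Lmod F x).

(** The image of the tensor of [w] and [y]: the operators producing [y] from the chosen highest
    weight vector are applied to [embed F w] instead. *)
Definition move_top x (w : VO R x) (y : Lmod F x) : F :=
  transfer (hw_content x) (highest F x) (embed F w) (val y).

Lemma move_top_linl x y : linear ((@move_top x)^~ y : VO R x -> F).
Proof.
move=> c w w'; rewrite /move_top linearP.
by apply: (transfer_linl (highest_hwv F x) (highest_neq0 F x)); [exact: embed_hwv..|exact: summandP].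
Qed.

Lemma move_top_linr x w : linear (@move_top x w).
Proof.
move=> c y y'; rewrite /move_top linearP.
by apply: (transfer_lin (highest_hwv F x) (highest_neq0 F x)); [exact: embed_hwv|exact: summandP..].
Qed.
HB.instance Definition _ x w := GRing.isLinear.Build C (Lmod F x) F *:%R (@move_top x w) (@move_top_linr x w).

Definition block x (t : summand_tensor x) : F :=
  \sum_(k < \dim {:VO R x}) move_top (vbasis {:VO R x})`_k ((t : tensor _ _) k).

Lemma block_linear x : linear (@block x).
Proof.
move=> c t t'; rewrite /block scaler_sumr -big_split; apply: eq_bigr => k _ /=.
by rewrite !ffunE linearP.
Qed.
HB.instance Definition _ x := GRing.isLinear.Build C (summand_tensor x) F *:%R (@block x) (@block_linear x).

Lemma block_pure x w y : block (pure_tensor w y : summand_tensor x) = move_top w y.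
Proof.
rewrite /block [in RHS](coord_vbasis (memvf w)) -[RHS]/(mk_linear (move_top_linl y) _) linear_sum.
by apply: eq_bigr => k _; rewrite ffunE linearZ [RHS]linearZ.
Qed.

Lemma block_map x f h t : block (tensor_map f h t : summand_tensor x) =
  \sum_(k < \dim {:VO R x}) move_top (f (vbasis {:VO R x})`_k) (h ((t : tensor _ _) k)).
Proof. rewrite /tensor_map linear_sum; apply: eq_bigr => k _; exact: block_pure. Qed.

(** In coordinates this is a relation among transfers indexed by a summand and a basis vector of its
    multiplicity space. The singular vectors involved are independent: contents separate the
    summands, and [embed] is injective on each. *)
Lemma blocks_free (s : seq sigma) (u : forall x, summand_tensor x) : uniq s ->
  \sum_(x <- s) block (u x) = 0 -> forall x, x \in s -> u x = 0.
Proof.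
move=> us; pose X i := tnth (in_tuple s) i.
pose I := {i : 'I_(size s) & 'I_(\dim {:VO R (X i)})}.
pose e (p : I) := (vbasis {:VO R (X (tag p))})`_(tagged p).
have Xinj : injective X by move=> i j /eqP; rewrite /X !(tnth_nth (X i)) nth_uniq // => /eqP /val_inj.
rewrite big_tnth => S0.
have ind : forall p : I, val (((u (X (tag p)) : tensor _ _)) (tagged p)) = 0.
  apply: (transfer_independent (mu := fun p : I => hw_content (X (tag p)))
    (v := fun p => highest F (X (tag p))) (s := fun p => embed F (e p))) => [p|p|p|c c0 p|p|].
  - exact: highest_hwv.
  - exact: highest_neq0.
  - exact: embed_hwv.
  - pose w i : VO R (X i) := \sum_(k < \dim {:VO R (X i)}) c (Tagged (fun i => 'I_(\dim {:VO R (X i)})) k) *: (vbasis {:VO R (X i)})`_k.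
    have w0 : \sum_i embed F (w i) = 0.
      rewrite -[RHS]c0; under eq_bigr => i _ do rewrite linear_sum.
      rewrite (@sig_big_dep _ _ _ _ (fun i => 'I_(\dim {:VO R (X i)})) predT (fun _ => predT)
        (fun i k => embed F (c (Tagged (fun i => 'I_(\dim {:VO R (X i)})) k) *: (vbasis {:VO R (X i)})`_k))).
      by apply: eq_bigr => -[i k] _; rewrite linearZ.
    have wi i : w i = 0.
      apply: (embed_eq0 (F := F)); apply: form_eq0; have := congr1 (form (embed F (w i))) w0.
      rewrite form0r form_sumr (bigD1 i) //= big1 ?addr0 // => j ji.
      have [n hn] : exists n, hw_content (X i) n != hw_content (X j) n.
        apply: contrapT => h; case/negP: ji; apply/eqP/Xinj/hw_content_inj => // n.
        by apply/eqP/negPn/negP => ne; apply: h; exists n; rewrite eq_sym.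
      exact: (content_ortho hn (embed_hwv F (w i)).2 (embed_hwv F (w j)).2).
    by case: p => i k; have /freeP := basis_free (vbasisP {:VO R (X i)}); move=> /(_ _ (wi i) k).
  - exact: summandP.
  - rewrite -[RHS]S0 (@sig_big_dep _ _ _ _ (fun i => 'I_(\dim {:VO R (X i)})) predT (fun _ => predT)
      (fun i k => move_top (vbasis {:VO R (X i)})`_k ((u (X i) : tensor _ _) k))).
    exact: eq_bigr.
move=> x /(tnthP (in_tuple s)) [i ->]; apply/ffunP => k; rewrite ffunE; apply: val_inj.
by rewrite linear0; exact: (ind (Tagged (fun i => 'I_(\dim {:VO R (X i)})) k)).
Qed.

Local Notation howe := (howe_sum (Lmod F)).

Lemma howe_support (u : howe) : exists2 s : seq sigma, uniq s & forall x, x \notin s -> u x = 0.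
Proof.
have /asboolP /finite_seqP [s us] := valP u; exists (undup s) => [|x]; first exact: undup_uniq.
rewrite mem_undup => xs; apply/eqP/negPn/negP => ux.
have : [set` s]%classic x by rewrite -us; exact: ux.
by rewrite /= (negbTE xs).
Qed.

Definition assemble (u : howe) : F := \sum_(x \in [set: sigma]) block (u x).

Lemma assembleE (s : seq sigma) (u : howe) : uniq s -> (forall x, x \notin s -> u x = 0) ->
  assemble u = \sum_(x <- s) block (u x).
Proof.
move=> us su; rewrite /assemble (fsbigE s) //; first by apply: eq_bigl => x; rewrite in_setT.
by move=> x _ /su ->; rewrite linear0.
Qed.

Lemma assemble_linear : linear assemble.
Proof.
move=> c u u'; have [s us su] := howe_support u; have [s' us' su'] := howe_support u'.
pose r := undup (s ++ s').
have ru x : x \notin r -> u x = 0 /\ u' x = 0.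
  by rewrite mem_undup mem_cat negb_or => /andP[/su -> /su' ->].
have ur : uniq r := undup_uniq _.
rewrite !(assembleE ur) => [|x /ru[]//|x /ru[]//|x /ru[ux u'x]]; last first.
  by rewrite -[LHS]/(c *: u x + u' x) ux u'x scaler0 addr0.
rewrite scaler_sumr -big_split; apply: eq_bigr => x _.
by rewrite -[(c *: u + u') x]/(c *: u x + u' x) linearP.
Qed.
HB.instance Definition _ := GRing.isLinear.Build C howe F *:%R assemble assemble_linear.

Definition inject x (t : summand_tensor x) : howe := @dsum_in _ sigma _ x t.

Lemma inject_in x t : inject t x = t :> summand_tensor x.
Proof. by rewrite /inject /dsum_in /dirsum_at /= dfwith_in. Qed.

Lemma inject_out x y (t : summand_tensor x) : y != x -> inject t y = 0.
Proof. by move=> yx; rewrite /inject /dsum_in /dirsum_at /= dfwith_out // eq_sym. Qed.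

Lemma assemble_inject x (t : summand_tensor x) : assemble (inject t) = block t.
Proof.
rewrite (@assembleE [:: x]) ?big_seq1 ?inject_in // => y.
by rewrite inE; exact: inject_out.
Qed.

Lemma assemble_inj u : assemble u = 0 -> u = 0.
Proof.
have [s us su] := howe_support u; rewrite (assembleE us su) => /(blocks_free us) h.
apply: val_inj; apply: functional_extensionality_dep => x.
by have [/h|/su] := boolP (x \in s).
Qed.

Lemma subspace_assembled (P : F -> Prop) : is_subspace P ->
  (forall x t, P (block (t : summand_tensor x))) -> forall u, P (assemble u).
Proof.
move=> PS Pb u; have [s us su] := howe_support u.
by rewrite (assembleE us su); apply: (sub_sum PS).
Qed.

Lemma move_top_B x p q w (y : Lmod F x) :
  exists2 y', val y' = B p q (val y) & B p q (move_top w y) = move_top w y'.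
Proof.
have ly := lower_B p q (highest_hwv F x) (summandP y).
have ly' : B p q (val y) \in in_summand x by apply/asboolP.
exists (Summand ly') => //; rewrite /move_top.
by rewrite -(transfer_B (highest_hwv F x) (highest_neq0 F x)) //; [exact: embed_hwv|exact: summandP].
Qed.

(** The image is stable under all [B p q] and contains every singular vector of finite content,
    which [hwv_embedded] exhibits as the image of a tensor with [top F x]. *)
Lemma assemble_surj v : exists u, assemble u = v.
Proof.
move: v; pose P v := exists u, assemble u = v; rewrite -[forall v, _]/(forall v, P v).
have PS : is_subspace P.
  split=> [|c _ _ [u <-] [u' <-]]; first by exists 0; rewrite linear0.
  by exists (c *: u + u'); rewrite linearP.
apply: singular_spans => // [p q _ [u <-]|].
  apply: (subspace_assembled (P := fun v => P (B p q v))).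
    by split=> [|c v v' Pv Pv']; [rewrite linear0; exact: (sub0 PS)|rewrite linearP; exact: (subL PS)].
  move=> x t; rewrite /block linear_sum; apply: (sub_sum PS) => k _.
  have [y _ e] := move_top_B p q (vbasis {:VO R x})`_k ((t : tensor _ _) k).
  suff : P (B p q (move_top (vbasis {:VO R x})`_k ((t : tensor _ _) k))) by []; rewrite e.
  by exists (inject (pure_tensor (vbasis {:VO R x})`_k y : summand_tensor x)); rewrite assemble_inject block_pure.
apply: singular_contents => // mu v cv sv [K fin].
have [x [w <-]] := hwv_embedded l_gt0 (conj sv cv) fin.
exists (inject (pure_tensor w (top F x) : summand_tensor x)).
rewrite assemble_inject block_pure /move_top.
exact: (transfer_base (highest_hwv F x) (highest_neq0 F x) (embed_hwv F w)).
Qed.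

(** At a common truncation both sides are the same combination of operators [nB]. The relation [Q]
    keeps the intermediate vectors inside the summand, where [move_top w] is defined. *)
Lemma move_top_act x (a : Dhat R) w (y : Lmod F x) :
  act a (move_top w y) = move_top w (summand_act a y).
Proof.
pose Q z1 z2 := exists2 y' : Lmod F x, val y' = z1 & move_top w y' = z2.
have QD z1 z2 z1' z2' : Q z1 z2 -> Q z1' z2' -> Q (z1 + z1') (z2 + z2').
  by move=> [y1 <- <-] [y2 <- <-]; exists (y1 + y2); rewrite linearD.
have QZ c z1 z2 : Q z1 z2 -> Q (c *: z1) (c *: z2).
  by move=> [y1 <- <-]; exists (c *: y1); rewrite linearZ.
have Qsum (s : seq int) f g : (forall i, Q (f i) (g i)) -> Q (\sum_(i <- s) f i) (\sum_(i <- s) g i).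
  by move=> Qfg; apply: (big_ind2 Q) => //; exists 0; rewrite linear0.
have Qy : Q (val y) (move_top w y) by exists y.
have QB p q : Q (nB p q (val y)) (nB p q (move_top w y)).
  rewrite /nB -!scaleNr; apply: QD; last exact: QZ.
  by have [y' e1 e2] := move_top_B p q w y; exists y'.
have [N1 h1] := fock_Dact_cut a (val y); have [N2 h2] := fock_Dact_cut a (move_top w y).
have [y' e1 <-] : Q (act a (val y)) (act a (move_top w y)).
  rewrite (h1 (N1 + N2)%N) ?leq_addr // (h2 (N1 + N2)%N) ?leq_addl // /Dact_cut.
  apply: QD; first exact: QZ.
  by apply: (Qsum) => k; apply: (QZ); apply: (Qsum) => j; exact: QZ.
by congr move_top; exact: val_inj.
Qed.

Lemma block_act x (a : Dhat R) (t : summand_tensor x) :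
  act a (block t) = block (tensor_map id (@summand_act _ _ F x a) t : summand_tensor x).
Proof.
rewrite block_map /block linear_sum; apply: eq_bigr => k _; exact: move_top_act.
Qed.

Lemma block_rho (rho : 'M[C]_(l + l) -> F -> F) g x (t : summand_tensor x) :
  is_fock_Oact rho -> O2l g ->
  rho g (block t) = block (tensor_map (@VO_act R l x g) id t : summand_tensor x).
Proof.
move=> Hrho og; rewrite block_map -[LHS]/(mk_linear (rho_linear Hrho og) _) linear_sum.
apply: eq_bigr => k _; rewrite /move_top -(embed_rho _ Hrho og).
apply: (transfer_comm (highest_hwv F x) (highest_neq0 F x)).
- by move=> p q u; exact: rho_B.
- exact: embed_hwv.
- by rewrite /= (embed_rho _ Hrho og); exact: embed_hwv.
- exact: summandP.
Qed.

Lemma tensor_map_linear x f (h : Lmod F x -> Lmod F x) : linear h ->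
  linear (tensor_map f h : summand_tensor x -> summand_tensor x).
Proof.
move=> hl c t t'; rewrite /tensor_map scaler_sumr -big_split; apply: eq_bigr => k _ /=.
by apply/ffunP => i; rewrite !ffunE hl scalerDr !scalerA mulrC.
Qed.

Lemma disassemble_exists : exists Phi : {linear F -> howe}, cancel Phi assemble /\ cancel assemble Phi.
Proof.
pose f v := projT1 (cid (assemble_surj v)).
have fK : cancel f assemble by move=> v; exact: projT2 (cid (assemble_surj v)).
have inj u u' : assemble u = assemble u' -> u = u'.
  move=> e; apply/eqP; rewrite -subr_eq0; apply/eqP/assemble_inj.
  by rewrite linearB /= e subrr.
have fl : linear f by move=> c v v'; apply: inj; rewrite linearP /= !fK.
by exists (mk_linear fl); split=> [v|u]; [exact: fK|apply: inj; exact: fK].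
Qed.

Lemma disassemble_intertwines (Phi : {linear F -> howe}) (H : {linear F -> F})
    (h : forall x, summand_tensor x -> summand_tensor x) :
  cancel Phi assemble -> cancel assemble Phi -> (forall x, linear (h x)) ->
  (forall x t, H (block t) = block (h x t)) -> forall v x, Phi (H v) x = h x (Phi v x).
Proof.
move=> PhiK assK hl Hh v; rewrite -(PhiK v); move: (Phi v) => {v}.
have h0 x : h x 0 = 0 by have := hl x (-1) 0 0; rewrite scaler0 addr0 scaleN1r addNr.
apply: (subspace_assembled (P := fun v => forall x, Phi (H v) x = h x (Phi v x))).
  split=> [x|c v v' Pv Pv' x]; first by rewrite !linear0 -[LHS]/(0 : summand_tensor x) h0.
  by rewrite !linearP -[LHS]/(c *: Phi (H v) x + Phi (H v') x) Pv Pv' -hl.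
move=> x t y; rewrite Hh -!assemble_inject !assK.
have [->|yx] := eqVneq y x; first by rewrite !inject_in.
by rewrite !inject_out ?h0.
Qed.

End Duality.
Local Open Scope complex_scope.

Theorem theorem11p2 (R : realType) (l : nat) (hl : (1 <= l)%N)
    (F : fock_space R l) :
  is_Dplus_action (@fock_Dact R l F) /\
  (exists rho : 'M[R[i]]_(l + l) -> F -> F, is_fock_Oact rho) /\
  forall rho : 'M[R[i]]_(l + l) -> F -> F, is_fock_Oact rho ->
    (forall g a v, O2l g -> Dplus a ->
       rho g (fock_Dact a v) = fock_Dact a (rho g v)) /\
    exists L : SigmaD l -> Dplus_module R,
      (forall x, is_Lmodule (e_exponents R x) l%:R (L x)) /\
      exists Phi : {linear F -> howe_sum L}, is_bimodule_iso rho Phi.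
Proof.
split; first exact: fock_Dact_action.
split; first exact: fock_Oact_exists.
move=> rho Hrho; split=> [g a v og pa|]; first exact: rho_act.
(* The modules and the isomorphism depend on [F] alone; [rho] enters only in the intertwining
   property. *)
exists (Lmod F); split=> [x|]; first exact: Lmod_is_Lmodule.
have [Phi [PhiK assK]] := disassemble_exists F hl.
exists Phi; split=> [|g v x og|a v x pa].
- by exists (@assemble R l F).
- apply: (disassemble_intertwines (H := mk_linear (rho_linear Hrho og))
    (h := fun x t => tensor_map (@VO_act R l x g) id t) PhiK assK) => [y|y t].
    exact: tensor_map_linear.
  exact: block_rho.
- apply: (disassemble_intertwines (H := mk_linear (@fock_Dact_linear R l F a))
    (h := fun x t => tensor_map id (@Dmod_act R (Lmod F x) a) t) PhiK assK) => [y|y t].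
    by apply: tensor_map_linear; case: (summand_actP F y) => + _ _; apply.
  exact: block_act.
Qed.
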